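(* Let $k,m\ge 1$ be integers and let $a=\gcd(k,m)$. Let $\mu(\gamma)$ denote the Milnor number of the arc $\gamma$ and $\mu_{\mathrm{Mob}}$ the Möbius function of elementary number theory. Then $$G_{k,m}(t,\mathbb{L})=\int_{\{\mathrm{Ord}\,x=k,\ \mathrm{Ord}\,y=m\}}t^{\mu(\gamma)}\,d\gamma$$ $$=(\mathbb{L}-1)^2\, t^{(k-1)(m-1)}\,\mathbb{L}^{-k-m}\sum_{\underline{a},\underline{b}}\ \prod_{j=1}^{r}\mu_{\mathrm{Mob}}\!\left(\frac{b_j}{a_{j-1}}\right)\frac{(\mathbb{L}-1)\,t^{(a_j-1)b_j}\,\mathbb{L}^{-b_j}\left(1-t^{(a_j-1)(a_j-b_j)}\mathbb{L}^{b_j-a_j}\right)}{\left(1-t^{a_j(a_j-1)}\mathbb{L}^{1-a_j}\right)\left(1-t^{(a_j-1)b_j}\mathbb{L}^{-b_j}\right)},$$ where the sum is over all $r\ge 0$ and all tuples of integers $$1=a_0\le b_1<a_1\le b_2<a_2\le\cdots\le a_{r-1}\le b_r<a_r=a$$ such that $a_{j-1}\mid b_j$ and $b_j\mid a_j$ for all $j=1,\dots,r$ ($r$ is not fixed; for $a=1$ the only tuple is $r=0$, with empty product equal to $1$).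
   Context: Arcs: $\mathcal{L}$ is the space of arcs at the origin of $\mathbb{C}^2$, i.e. pairs $\gamma=(x(s),y(s))$ of formal power series over $\mathbb{C}$ without constant terms. $\mathcal{L}_n$ is the space of their $n$-jets (truncations modulo $s^{n+1}$, so $\mathcal{L}_n\cong\mathbb{C}^{2n}$) and $\pi_n:\mathcal{L}\to\mathcal{L}_n$ is the truncation map. $\mathrm{Ord}$ denotes the order of a power series in $s$. Grothendieck ring: $K_0(Var_{\mathbb{C}})$ is generated by isomorphism classes $[X]$ of complex quasi-projective varieties modulo $[X]=[Y]+[X\setminus Y]$ for $Y\subset X$ Zariski closed, with product $[X][Y]=[X\times Y]$; $\mathbb{L}$ is the class of the affine line. $\mathcal{M}$ is the completion of $K_0(Var_{\mathbb{C}})[\mathbb{L}^{-1}]$ with respect to the filtration in which $F_k$ is generated by the elements $[X]\mathbb{L}^{-n}$ with $n-\dim X\ge k$. Motivic measure (Kontsevich, Denef–Loeser): a set $A\subset\mathcal{L}$ is cylindric if $A=\pi_n^{-1}(A_n)$ for some $n$ and some constructible $A_n\subset\mathcal{L}_n$, and its measure is $[A_n]\mathbb{L}^{-2n}\in\mathcal{M}$; this extends to an additive $\mathcal{M}$-valued measure $\chi_g$ on a suitable algebra of subsets of $\mathcal{L}$. For a function $f$ with countably many values and measurable level sets, $\int f\,d\gamma=\sum_g g\cdot\chi_g(f^{-1}(g))$ whenever this sum converges. The integrals: $\mu(\gamma)$ is the Milnor number of the germ of plane curve parametrised by $\gamma$, i.e. $\mu=\dim_{\mathbb{C}}\mathbb{C}[[x,y]]/(f_x,f_y)$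 for a reduced equation $f=0$ of the branch when $\gamma$ is a primitive parametrisation; for non-primitive arcs (a set of measure zero) $\mu(\gamma)=\infty$ and $t^{\infty}=0$. For integers $k,m\ge1$, $$G_{k,m}(t)=G_{k,m}(t,\mathbb{L})=\int_{\{\mathrm{Ord}\,x=k,\ \mathrm{Ord}\,y=m\}}t^{\mu(\gamma)}d\gamma=\sum_{n\ge 0}t^n\chi_g\{\gamma:\mathrm{Ord}\,x=k,\ \mathrm{Ord}\,y=m,\ \mu(\gamma)=n\}\in\mathcal{M}[[t]].$$ Identities with rational expressions in $t$ and $\mathbb{L}$ are understood in $\mathcal{M}[[t]]$, the denominators (of the form $1-t^{p}\mathbb{L}^{-q}$ with $p\geq 1$) being expanded as geometric series in $t$. *)

(* Defs.v *)
From HB Require Import structures.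
From mathcomp Require Import all_boot all_order all_algebra.
From mathcomp Require Import boolp classical_sets.
From mathcomp Require Import reals.
From mathcomp Require Export complex.
From mathcomp Require Import mpoly.

Set Implicit Arguments.
Unset Strict Implicit.
Unset Printing Implicit Defensive.

Import Order.TTheory GRing.Theory Num.Theory.

Local Open Scope classical_set_scope.
Local Open Scope ring_scope.

Record setoid_ring := SetoidRing {
  sr_car :> Type;
  sr_eq : sr_car -> sr_car -> Prop;
  sr0 : sr_car;
  sr1 : sr_car;
  sr_add : sr_car -> sr_car -> sr_car;
  sr_opp : sr_car -> sr_car;
  sr_mul : sr_car -> sr_car -> sr_car;
  sr_refl : forall x, sr_eq x x;
  sr_sym : forall x y, sr_eq x y -> sr_eq y x;
  sr_trans : forall y x z, sr_eq x y -> sr_eq y z -> sr_eq x z;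
  sr_addE : forall x x' y y',
    sr_eq x x' -> sr_eq y y' -> sr_eq (sr_add x y) (sr_add x' y');
  sr_oppE : forall x x', sr_eq x x' -> sr_eq (sr_opp x) (sr_opp x');
  sr_mulE : forall x x' y y',
    sr_eq x x' -> sr_eq y y' -> sr_eq (sr_mul x y) (sr_mul x' y');
  sr_addA : forall x y z, sr_eq (sr_add x (sr_add y z)) (sr_add (sr_add x y) z);
  sr_addC : forall x y, sr_eq (sr_add x y) (sr_add y x);
  sr_add0 : forall x, sr_eq (sr_add sr0 x) x;
  sr_addN : forall x, sr_eq (sr_add (sr_opp x) x) sr0;
  sr_mulA : forall x y z, sr_eq (sr_mul x (sr_mul y z)) (sr_mul (sr_mul x y) z);
  sr_mulC : forall x y, sr_eq (sr_mul x y) (sr_mul y x);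
  sr_mul1 : forall x, sr_eq (sr_mul sr1 x) x;
  sr_mulD : forall x y z,
    sr_eq (sr_mul (sr_add x y) z) (sr_add (sr_mul x z) (sr_mul y z)) }.

Definition squot (S : setoid_ring) : Type :=
  {A : set S | exists x, A = [set y | sr_eq x y]}.

Definition spi (S : setoid_ring) (x : S) : squot S :=
  exist _ [set y | sr_eq x y] (ex_intro _ x erefl).

Definition srepr (S : setoid_ring) (a : squot S) : S :=
  projT1 (cid (projT2 a)).

Lemma spiP (S : setoid_ring) (x y : S) : spi x = spi y <-> sr_eq x y.
Proof.
split=> [/(congr1 sval) /= /seteqP[_ /(_ y)]|xy]; first by apply; exact: sr_refl.
apply: eq_sig_hprop => /= [*|]; first exact: Prop_irrelevance.
apply/seteqP; split=> z /= xz.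
  exact: sr_trans (sr_sym xy) xz.
exact: sr_trans xy xz.
Qed.

Lemma sreprK (S : setoid_ring) (a : squot S) : spi (srepr a) = a.
Proof.
apply: eq_sig_hprop => /= [*|]; first exact: Prop_irrelevance.
by rewrite /srepr; case: cid => /= x ->.
Qed.

Lemma spi_repr (S : setoid_ring) (x : S) : sr_eq (srepr (spi x)) x.
Proof. by apply/spiP; exact: sreprK. Qed.

Lemma spi_ind (S : setoid_ring) (P : squot S -> Prop) :
  (forall x, P (spi x)) -> forall a, P a.
Proof. by move=> Pspi a; rewrite -(sreprK a). Qed.

HB.instance Definition _ (S : setoid_ring) := gen_eqMixin (squot S).
HB.instance Definition _ (S : setoid_ring) := gen_choiceMixin (squot S).

Definition sq_add (S : setoid_ring) (a b : squot S) :=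
  spi (sr_add (srepr a) (srepr b)).
Definition sq_opp (S : setoid_ring) (a : squot S) := spi (sr_opp (srepr a)).
Definition sq_mul (S : setoid_ring) (a b : squot S) :=
  spi (sr_mul (srepr a) (srepr b)).

Lemma sq_addE (S : setoid_ring) (x y : S) :
  sq_add (spi x) (spi y) = spi (sr_add x y).
Proof. by apply/spiP; apply: sr_addE; exact: spi_repr. Qed.

Lemma sq_oppE (S : setoid_ring) (x : S) : sq_opp (spi x) = spi (sr_opp x).
Proof. by apply/spiP; apply: sr_oppE; exact: spi_repr. Qed.

Lemma sq_mulE (S : setoid_ring) (x y : S) :
  sq_mul (spi x) (spi y) = spi (sr_mul x y).
Proof. by apply/spiP; apply: sr_mulE; exact: spi_repr. Qed.

Lemma sq_addA (S : setoid_ring) : associative (@sq_add S).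
Proof.
elim/spi_ind=> x; elim/spi_ind=> y; elim/spi_ind=> z.
by rewrite !sq_addE; apply/spiP; exact: sr_addA.
Qed.

Lemma sq_addC (S : setoid_ring) : commutative (@sq_add S).
Proof.
elim/spi_ind=> x; elim/spi_ind=> y.
by rewrite !sq_addE; apply/spiP; exact: sr_addC.
Qed.

Lemma sq_add0 (S : setoid_ring) : left_id (spi (sr0 S)) (@sq_add S).
Proof.
by elim/spi_ind=> x; rewrite !sq_addE; apply/spiP; exact: sr_add0.
Qed.

Lemma sq_addN (S : setoid_ring) :
  left_inverse (spi (sr0 S)) (@sq_opp S) (@sq_add S).
Proof.
by elim/spi_ind=> x; rewrite sq_oppE !sq_addE; apply/spiP; exact: sr_addN.
Qed.

Lemma sq_mulA (S : setoid_ring) : associative (@sq_mul S).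
Proof.
elim/spi_ind=> x; elim/spi_ind=> y; elim/spi_ind=> z.
by rewrite !sq_mulE; apply/spiP; exact: sr_mulA.
Qed.

Lemma sq_mulC (S : setoid_ring) : commutative (@sq_mul S).
Proof.
elim/spi_ind=> x; elim/spi_ind=> y.
by rewrite !sq_mulE; apply/spiP; exact: sr_mulC.
Qed.

Lemma sq_mul1 (S : setoid_ring) : left_id (spi (sr1 S)) (@sq_mul S).
Proof.
by elim/spi_ind=> x; rewrite !sq_mulE; apply/spiP; exact: sr_mul1.
Qed.

Lemma sq_mulD (S : setoid_ring) : left_distributive (@sq_mul S) (@sq_add S).
Proof.
elim/spi_ind=> x; elim/spi_ind=> y; elim/spi_ind=> z.
by rewrite !(sq_addE, sq_mulE); apply/spiP; exact: sr_mulD.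
Qed.

HB.instance Definition _ (S : setoid_ring) :=
  GRing.isZmodule.Build (squot S)
    (@sq_addA S) (@sq_addC S) (@sq_add0 S) (@sq_addN S).
HB.instance Definition _ (S : setoid_ring) :=
  GRing.Zmodule_isComPzRing.Build (squot S)
    (@sq_mulA S) (@sq_mulC S) (@sq_mul1 S) (@sq_mulD S).

(* A subset of the projective space with N homogeneous coordinates is
   represented by its punctured cone in F^N, a set of nonzero vectors stable
   under nonzero scalars.  (For N = 0 the projective space is empty.) *)

Definition proj_closed (F : closedFieldType) (N : nat) (C : set 'rV[F]_N) : Prop :=
  exists s : seq {mpoly F[N]},
    (forall p, p \in s -> exists d, p \is d.-homog) /\
    C = [set v : 'rV[F]_N | v != 0 /\ forall p, p \in s -> p.@[v 0] = 0].

Definition locally_closed (F : closedFieldType) (N : nat) (X : set 'rV[F]_N) : Prop :=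
  exists C D, [/\ proj_closed C, proj_closed D & X = C `\` D].

Record qvar (F : closedFieldType) (N : nat) := QVar {
  qset :> set 'rV[F]_N;
  qsetP : locally_closed qset }.

Definition same_point (F : closedFieldType) (N : nat) (v w : 'rV[F]_N) : Prop :=
  exists2 c : F, c != 0 & w = c *: v.

(* Locally on X, f is given by homogeneous polynomials of the same degree. *)
Definition regular_map (F : closedFieldType) (N M : nat)
    (X : set 'rV[F]_N) (Y : set 'rV[F]_M) (f : 'rV[F]_N -> 'rV[F]_M) : Prop :=
  (forall v, X v -> Y (f v)) /\
  forall v, X v ->
    exists (h : {mpoly F[N]}) (P : 'I_M -> {mpoly F[N]}) (e d : nat),
      [/\ h \is e.-homog, forall i, P i \is d.-homog, h.@[v 0] != 0 &
          forall w, X w -> h.@[w 0] != 0 ->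
            same_point (f w) (\row_i (P i).@[w 0])].

Definition isomorphic (F : closedFieldType) (N M : nat)
    (X : set 'rV[F]_N) (Y : set 'rV[F]_M) : Prop :=
  exists f g, [/\ regular_map X Y f, regular_map Y X g,
    forall v, X v -> same_point v (g (f v)) &
    forall w, Y w -> same_point w (f (g w))].

(* The Segre embedding of X x Y: (v, w) is sent to the tensor (v_i w_j). *)
Definition segre (F : closedFieldType) (N M : nat)
    (X : set 'rV[F]_N) (Y : set 'rV[F]_M) : set 'rV[F]_(N * M) :=
  [set z | exists v w, [/\ X v, Y w & z = mxvec (v^T *m w)]].

Definition irreducible_closed_in (F : closedFieldType) (N : nat)
    (X Z : set 'rV[F]_N) : Prop :=
  [/\ Z !=set0, exists2 C, proj_closed C & Z = X `&` C &
      forall C D, proj_closed C -> proj_closed D ->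
        Z `<=` C `|` D -> Z `<=` C \/ Z `<=` D].

Definition has_chain (F : closedFieldType) (N : nat) (X : set 'rV[F]_N)
    (r : nat) : Prop :=
  exists Z : nat -> set 'rV[F]_N,
    (forall i, (i <= r)%N -> irreducible_closed_in X (Z i)) /\
    (forall i, (i < r)%N -> Z i `<` Z i.+1).

(* Krull dimension.  Restricting to r < N loses nothing, since X lies in a
   projective space of dimension N - 1; the empty set gets dimension 0, which
   is immaterial below because its class is 0. *)
Definition vdim (F : closedFieldType) (N : nat) (X : set 'rV[F]_N) : nat :=
  \max_(r < N | `[< has_chain X r >]) r.

Lemma proj_closedT (F : closedFieldType) (N : nat) :
  proj_closed [set v : 'rV[F]_N | v != 0].
Proof. by exists [::]; split=> //; apply/seteqP; split=> v //= []. Qed.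

Lemma proj_closed0 (F : closedFieldType) (N : nat) :
  proj_closed (set0 : set 'rV[F]_N).
Proof.
exists [:: 1]; split; first by move=> p; rewrite inE => /eqP ->; exists 0%N; exact: dhomog1.
apply/seteqP; split=> v //= [_ /(_ 1)]; rewrite inE eqxx meval1 => /(_ isT) /eqP.
by rewrite oner_eq0.
Qed.

Lemma point_locally_closed (F : closedFieldType) :
  locally_closed [set v : 'rV[F]_1 | v != 0].
Proof.
exists [set v : 'rV[F]_1 | v != 0], set0; split; [exact: proj_closedT|exact: proj_closed0|].
by rewrite setD0.
Qed.

Definition qpoint (F : closedFieldType) : qvar F 1 := QVar (point_locally_closed F).

Lemma affline_locally_closed (F : closedFieldType) :
  locally_closed [set v : 'rV[F]_2 | v 0 0 != 0].
Proof.
exists [set v : 'rV[F]_2 | v != 0], [set v : 'rV[F]_2 | v != 0 /\ forall p, p \in [:: 'X_0] -> p.@[v 0] = 0].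
split; first exact: proj_closedT.
  exists [:: 'X_0]; split=> // p; rewrite inE => /eqP ->; exists 1%N.
  by rewrite dhomogX; apply/eqP; exact: mdeg1.
apply/seteqP; split=> v /= [].
  move=> v00; split; first by apply: contra v00 => /eqP ->; rewrite mxE.
  by move=> [_ /(_ 'X_0)]; rewrite inE eqxx mevalXU => /(_ isT) v0; rewrite v0 eqxx in v00.
move=> v0 nv; apply/eqP => v00; apply: nv; split=> // p.
by rewrite inE => /eqP ->; rewrite mevalXU.
Qed.

(* The affine line, as the standard chart of the projective line. *)
Definition qline (F : closedFieldType) : qvar F 2 := QVar (affline_locally_closed F).

(* K_0(Var)[L^-1] is given by generators and relations as a commutative ring: the
   generators are the classes of varieties and an inverse of L, and the
   relations other than the ring axioms are the last five clauses of kg_eq. *)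

Inductive kg_term (F : closedFieldType) : Type :=
| KgVar N of qvar F N
| KgLinv
| Kg0
| Kg1
| KgAdd of kg_term F & kg_term F
| KgOpp of kg_term F
| KgMul of kg_term F & kg_term F.
Arguments KgLinv {F}.
Arguments Kg0 {F}.
Arguments Kg1 {F}.

Inductive kg_eq (F : closedFieldType) : kg_term F -> kg_term F -> Prop :=
| kg_refl x : kg_eq x x
| kg_sym x y : kg_eq x y -> kg_eq y x
| kg_trans y x z : kg_eq x y -> kg_eq y z -> kg_eq x z
| kg_addE x x' y y' : kg_eq x x' -> kg_eq y y' -> kg_eq (KgAdd x y) (KgAdd x' y')
| kg_oppE x x' : kg_eq x x' -> kg_eq (KgOpp x) (KgOpp x')
| kg_mulE x x' y y' : kg_eq x x' -> kg_eq y y' -> kg_eq (KgMul x y) (KgMul x' y')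
| kg_addA x y z : kg_eq (KgAdd x (KgAdd y z)) (KgAdd (KgAdd x y) z)
| kg_addC x y : kg_eq (KgAdd x y) (KgAdd y x)
| kg_add0 x : kg_eq (KgAdd Kg0 x) x
| kg_addN x : kg_eq (KgAdd (KgOpp x) x) Kg0
| kg_mulA x y z : kg_eq (KgMul x (KgMul y z)) (KgMul (KgMul x y) z)
| kg_mulC x y : kg_eq (KgMul x y) (KgMul y x)
| kg_mul1 x : kg_eq (KgMul Kg1 x) x
| kg_mulD x y z : kg_eq (KgMul (KgAdd x y) z) (KgAdd (KgMul x z) (KgMul y z))
| kg_iso N M (X : qvar F N) (Y : qvar F M) :
    isomorphic X Y -> kg_eq (KgVar X) (KgVar Y)
| kg_scissor N (X Y Z : qvar F N) (C : set 'rV[F]_N) :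
    proj_closed C -> qset Y = qset X `&` C -> qset Z = qset X `\` C ->
    kg_eq (KgVar X) (KgAdd (KgVar Y) (KgVar Z))
| kg_prod N M (X : qvar F N) (Y : qvar F M) (Z : qvar F (N * M)) :
    qset Z = segre X Y -> kg_eq (KgMul (KgVar X) (KgVar Y)) (KgVar Z)
| kg_point : kg_eq (KgVar (qpoint F)) Kg1
| kg_Linv : kg_eq (KgMul (KgVar (qline F)) KgLinv) Kg1.

Definition kg_setoid (F : closedFieldType) : setoid_ring :=
  SetoidRing (@kg_refl F) (@kg_sym F) (@kg_trans F) (@kg_addE F) (@kg_oppE F)
    (@kg_mulE F) (@kg_addA F) (@kg_addC F) (@kg_add0 F) (@kg_addN F)
    (@kg_mulA F) (@kg_mulC F) (@kg_mul1 F) (@kg_mulD F).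

Definition KVarL (F : closedFieldType) : Type := squot (kg_setoid F).
HB.instance Definition _ (F : closedFieldType) :=
  GRing.ComPzRing.on (KVarL F).

Definition kclass (F : closedFieldType) (N : nat) (X : qvar F N) : KVarL F :=
  spi (KgVar X : kg_setoid F).

Definition kLinv (F : closedFieldType) : KVarL F := spi (KgLinv : kg_setoid F).

Definition kLpow (F : closedFieldType) (z : int) : KVarL F :=
  match z with
  | Posz n => kclass (qline F) ^+ n
  | Negz n => kLinv F ^+ n.+1
  end.

(* The filtration of K_0(Var)[L^-1].  The last clause does not enlarge the
   subgroups generated by the first one, because dim (X x Y) = dim X + dim Y;
   it makes multiplicativity, hence the ring structure of the completion,
   available by definition. *)
Inductive kfilt (F : closedFieldType) : int -> KVarL F -> Prop :=
| kfilt_gen N (X : qvar F N) (n k : int) :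
    k <= n - (vdim X)%:Z -> kfilt k (kclass X * kLpow F (- n))
| kfilt0 k : kfilt k 0
| kfiltD k x y : kfilt k x -> kfilt k y -> kfilt k (x + y)
| kfiltN k x : kfilt k x -> kfilt k (- x)
| kfiltM k l x y : kfilt k x -> kfilt l y -> kfilt (k + l) (x * y).

Lemma kfilt_le (F : closedFieldType) (k k' : int) (x : KVarL F) :
  k' <= k -> kfilt k x -> kfilt k' x.
Proof.
move=> + kx; elim: kx k' => {k x}.
- by move=> N X n k kn k' k'k; apply: kfilt_gen; exact: le_trans kn.
- by move=> k k' _; exact: kfilt0.
- by move=> k x y _ xP _ yP k' k'k; apply: kfiltD; [exact: xP|exact: yP].
- by move=> k x _ xP k' k'k; apply: kfiltN; exact: xP.
- move=> k l x y _ xP ly _ k' k'k; rewrite -(subrK l k').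
  by apply: kfiltM => //; apply: xP; rewrite lerBlDr.
Qed.

Lemma kfiltB (F : closedFieldType) (k : int) (x y : KVarL F) :
  kfilt k x -> kfilt k y -> kfilt k (x - y).
Proof. by move=> kx ky; apply: kfiltD => //; exact: kfiltN. Qed.

Lemma kclass_point (F : closedFieldType) : kclass (qpoint F) = 1.
Proof. by apply/(@spiP (kg_setoid F)); exact: kg_point. Qed.

Lemma kfilt_exhaustive (F : closedFieldType) (x : KVarL F) : exists k, kfilt k x.
Proof.
elim/(@spi_ind (kg_setoid F)): x => t.
have one : kfilt 0 (1 : KVarL F).
  rewrite -[X in kfilt _ X](mulr1 1) -{1}kclass_point.
  rewrite -[X in _ * X]/(kLpow F (- 0)); apply: kfilt_gen.
  by rewrite /vdim big1// => -[[|//] ? ?].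
elim: t => [N X||||a [k ka] b [l lb]|a [k ka]|a [k ka] b [l lb]].
- exists (- (vdim X)%:Z); rewrite -[X in kfilt _ X]mulr1.
  by rewrite -[X in _ * X]/(kLpow F (- 0)); apply: kfilt_gen; rewrite sub0r.
- exists (1 - (vdim (qpoint F))%:Z).
  by rewrite -[X in kfilt _ X]mul1r -kclass_point; exact: (kfilt_gen (n := 1)).
- by exists 0; exact: kfilt0.
- by exists 0.
- exists (Order.min k l); rewrite -(@sq_addE (kg_setoid F)).
  by apply: kfiltD; [apply: kfilt_le ka|apply: kfilt_le lb]; rewrite ge_min lexx ?orbT.
- by exists k; rewrite -(@sq_oppE (kg_setoid F)); exact: kfiltN.
- by exists (k + l); rewrite -(@sq_mulE (kg_setoid F)); exact: kfiltM.
Qed.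

Definition kcauchy (F : closedFieldType) (u : nat -> KVarL F) : Prop :=
  forall k : int, exists n, forall i j,
    (n <= i)%N -> (n <= j)%N -> kfilt k (u i - u j).

Definition knull (F : closedFieldType) (u : nat -> KVarL F) : Prop :=
  forall k : int, exists n, forall i, (n <= i)%N -> kfilt k (u i).

Lemma kcauchy_bounded (F : closedFieldType) (u : nat -> KVarL F) :
  kcauchy u -> exists c : int, exists n, forall i, (n <= i)%N -> kfilt c (u i).
Proof.
move=> /(_ 0)[n un]; have [c cn] := kfilt_exhaustive (u n).
exists (Order.min 0 c), n => i ni; rewrite -(subrK (u n) (u i)).
by apply: kfiltD; [apply: kfilt_le (un _ _ ni (leqnn n))|apply: kfilt_le cn];
  rewrite ge_min lexx ?orbT.
Qed.

Lemma kcauchy_cst (F : closedFieldType) (x : KVarL F) : kcauchy (fun=> x).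
Proof. by move=> k; exists 0%N => i j _ _; rewrite subrr; exact: kfilt0. Qed.

Lemma kcauchyD (F : closedFieldType) (u v : nat -> KVarL F) :
  kcauchy u -> kcauchy v -> kcauchy (fun i => u i + v i).
Proof.
move=> uc vc k; have [n un] := uc k; have [m vm] := vc k.
exists (maxn n m) => i j; rewrite !geq_max => /andP[ni mi] /andP[nj mj].
by rewrite opprD addrACA; apply: kfiltD; [exact: un|exact: vm].
Qed.

Lemma kcauchyN (F : closedFieldType) (u : nat -> KVarL F) :
  kcauchy u -> kcauchy (fun i => - u i).
Proof.
move=> uc k; have [n un] := uc k; exists n => i j ni nj.
by rewrite -opprD; apply: kfiltN; exact: un.
Qed.

Lemma kcauchyM (F : closedFieldType) (u v : nat -> KVarL F) :
  kcauchy u -> kcauchy v -> kcauchy (fun i => u i * v i).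
Proof.
move=> uc vc k.
have [c [n1 uc1]] := kcauchy_bounded uc; have [d [n2 vd2]] := kcauchy_bounded vc.
have [n3 u3] := uc (k - d); have [n4 v4] := vc (k - c).
exists (maxn (maxn n1 n2) (maxn n3 n4)) => i j; rewrite !geq_max.
move=> /andP[/andP[i1 i2] /andP[i3 i4]] /andP[/andP[j1 j2] /andP[j3 j4]].
have -> : u i * v i - u j * v j = u i * (v i - v j) + (u i - u j) * v j.
  by rewrite mulrBr mulrBl addrA subrK.
apply: kfiltD.
- by rewrite -(subrK c k) addrC; apply: kfiltM; [exact: uc1|exact: v4].
- by rewrite -(subrK d k); apply: kfiltM; [exact: u3|exact: vd2].
Qed.

Lemma knullD (F : closedFieldType) (u v : nat -> KVarL F) :
  knull u -> knull v -> knull (fun i => u i + v i).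
Proof.
move=> u0 v0 k; have [n un] := u0 k; have [m vm] := v0 k.
exists (maxn n m) => i; rewrite !geq_max => /andP[ni mi].
by apply: kfiltD; [exact: un|exact: vm].
Qed.

Lemma knullN (F : closedFieldType) (u : nat -> KVarL F) :
  knull u -> knull (fun i => - u i).
Proof.
by move=> u0 k; have [n un] := u0 k; exists n => i ni; apply: kfiltN; exact: un.
Qed.

Lemma knullM (F : closedFieldType) (u v : nat -> KVarL F) :
  kcauchy u -> knull v -> knull (fun i => u i * v i).
Proof.
move=> uc v0 k; have [c [n uc1]] := kcauchy_bounded uc.
have [m vm] := v0 (k - c); exists (maxn n m) => i; rewrite !geq_max => /andP[ni mi].
by rewrite -(subrK c k) addrC; apply: kfiltM; [exact: uc1|exact: vm].
Qed.

Definition kseq (F : closedFieldType) : Type := {u : nat -> KVarL F | kcauchy u}.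

Definition kseq_eq (F : closedFieldType) (u v : kseq F) : Prop :=
  knull (fun i => sval u i - sval v i).

Definition kseq_cst (F : closedFieldType) (x : KVarL F) : kseq F :=
  exist _ (fun=> x) (kcauchy_cst x).
Definition kseq_add (F : closedFieldType) (u v : kseq F) : kseq F :=
  exist _ (fun i => sval u i + sval v i) (kcauchyD (svalP u) (svalP v)).
Definition kseq_opp (F : closedFieldType) (u : kseq F) : kseq F :=
  exist _ (fun i => - sval u i) (kcauchyN (svalP u)).
Definition kseq_mul (F : closedFieldType) (u v : kseq F) : kseq F :=
  exist _ (fun i => sval u i * sval v i) (kcauchyM (svalP u) (svalP v)).

Lemma kseq_eqE (F : closedFieldType) (u v : kseq F) :
  sval u =1 sval v -> kseq_eq u v.
Proof.
by move=> uv k; exists 0%N => i _; rewrite uv subrr; exact: kfilt0.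
Qed.

Lemma kseq_refl (F : closedFieldType) (u : kseq F) : kseq_eq u u.
Proof. exact: kseq_eqE. Qed.

Lemma kseq_sym (F : closedFieldType) (u v : kseq F) : kseq_eq u v -> kseq_eq v u.
Proof.
move=> /knullN uv k; have [n un] := uv k; exists n => i ni.
by rewrite -opprB; exact: un.
Qed.

Lemma kseq_trans (F : closedFieldType) (v u w : kseq F) :
  kseq_eq u v -> kseq_eq v w -> kseq_eq u w.
Proof.
move=> uv vw k; have [n un] := knullD uv vw k; exists n => i ni.
by have := un _ ni; rewrite addrA subrK.
Qed.

Lemma kseq_addE (F : closedFieldType) (u u' v v' : kseq F) :
  kseq_eq u u' -> kseq_eq v v' -> kseq_eq (kseq_add u v) (kseq_add u' v').
Proof.
move=> uu vv k; have [n un] := knullD uu vv k; exists n => i ni /=.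
by rewrite opprD addrACA; exact: un.
Qed.

Lemma kseq_oppE (F : closedFieldType) (u u' : kseq F) :
  kseq_eq u u' -> kseq_eq (kseq_opp u) (kseq_opp u').
Proof.
move=> uu k; have [n un] := knullN uu k; exists n => i ni /=.
by rewrite -opprD; exact: un.
Qed.

Lemma kseq_mulE (F : closedFieldType) (u u' v v' : kseq F) :
  kseq_eq u u' -> kseq_eq v v' -> kseq_eq (kseq_mul u v) (kseq_mul u' v').
Proof.
move=> uu vv k.
have [n un] := knullD (knullM (svalP u) vv) (knullM (svalP v') uu) k.
exists n => i ni /=; have := un _ ni; rewrite mulrBr [sval v' i * _]mulrC mulrBl.
by rewrite addrA subrK.
Qed.

Definition kseq_setoid (F : closedFieldType) : setoid_ring.
Proof.
apply: (@SetoidRing (kseq F) (@kseq_eq F) (kseq_cst 0) (kseq_cst 1)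
  (@kseq_add F) (@kseq_opp F) (@kseq_mul F)
  (@kseq_refl F) (@kseq_sym F) (@kseq_trans F)
  (@kseq_addE F) (@kseq_oppE F) (@kseq_mulE F)).
- by move=> x y z; apply: kseq_eqE => i /=; rewrite addrA.
- by move=> x y; apply: kseq_eqE => i /=; rewrite addrC.
- by move=> x; apply: kseq_eqE => i /=; rewrite add0r.
- by move=> x; apply: kseq_eqE => i /=; rewrite addNr.
- by move=> x y z; apply: kseq_eqE => i /=; rewrite mulrA.
- by move=> x y; apply: kseq_eqE => i /=; rewrite mulrC.
- by move=> x; apply: kseq_eqE => i /=; rewrite mul1r.
- by move=> x y z; apply: kseq_eqE => i /=; rewrite mulrDl.
Defined.

(* The completion, as Cauchy sequences modulo null sequences *)
Definition Mot (F : closedFieldType) : Type := squot (kseq_setoid F).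
HB.instance Definition _ (F : closedFieldType) := GRing.ComPzRing.on (Mot F).

Definition mot (F : closedFieldType) (x : KVarL F) : Mot F :=
  spi (kseq_cst x : kseq_setoid F).

Definition Lpow (F : closedFieldType) (z : int) : Mot F := mot (kLpow F z).

Record fps (R : Type) := FPS { fcoef :> nat -> R }.

Lemma fpsP (R : Type) (f g : fps R) : f =1 g -> f = g.
Proof. by case: f g => [f] [g] /= /funext ->. Qed.

HB.instance Definition _ (R : Type) := gen_eqMixin (fps R).
HB.instance Definition _ (R : Type) := gen_choiceMixin (fps R).

Definition fpsC (R : comPzRingType) (c : R) : fps R :=
  FPS (fun n => if n == 0%N then c else 0).
Definition fps_add (R : comPzRingType) (f g : fps R) := FPS (fun n => f n + g n).
Definition fps_opp (R : comPzRingType) (f : fps R) := FPS (fun n => - f n).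
Definition fps_mul (R : comPzRingType) (f g : fps R) :=
  FPS (fun n => \sum_(i < n.+1) f i * g (n - i)%N).

Lemma fps_addA (R : comPzRingType) : associative (@fps_add R).
Proof. by move=> f g h; apply: fpsP => n /=; rewrite addrA. Qed.

Lemma fps_addC (R : comPzRingType) : commutative (@fps_add R).
Proof. by move=> f g; apply: fpsP => n /=; rewrite addrC. Qed.

Lemma fps_add0 (R : comPzRingType) : left_id (fpsC 0) (@fps_add R).
Proof. by move=> f; apply: fpsP => n /=; case: ifP; rewrite add0r. Qed.

Lemma fps_addN (R : comPzRingType) : left_inverse (fpsC 0) (@fps_opp R) (@fps_add R).
Proof. by move=> f; apply: fpsP => n /=; rewrite addNr; case: ifP. Qed.

Lemma fps_mulC (R : comPzRingType) : commutative (@fps_mul R).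
Proof.
move=> f g; apply: fpsP => n /=; rewrite (reindex_inj rev_ord_inj) /=.
by apply: eq_bigr => i _; rewrite mulrC subSS subKn // -ltnS.
Qed.

Lemma fps_mulA (R : comPzRingType) : associative (@fps_mul R).
Proof.
move=> f g h; rewrite [RHS]fps_mulC [X in fps_mul f X]fps_mulC.
apply: fpsP => i /=; pose a j k := f j * (h k * g (i - j - k)%N).
transitivity (\sum_(j < i.+1) \sum_(k < i.+1 | (k <= i - j)%N) a j k).
  apply: eq_bigr => /= j _; rewrite big_distrr /=.
  by rewrite (big_ord_narrow_leq (leq_subr _ _)).
rewrite (exchange_big_dep predT) //=; apply: eq_bigr => k _.
transitivity (\sum_(j < i.+1 | (j <= i - k)%N) a j k).
  by apply: eq_bigl => j; rewrite !leq_subRL ?leq_ord // addnC.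
rewrite (big_ord_narrow_leq (leq_subr _ _)) big_distrr /=.
by apply: eq_bigr => j _; rewrite /a mulrCA -!subnDA addnC.
Qed.

Lemma fps_mul1 (R : comPzRingType) : left_id (fpsC 1) (@fps_mul R).
Proof.
move=> f; apply: fpsP => n /=; rewrite big_ord_recl /= subn0 mul1r big1 ?addr0 //.
by move=> i _; rewrite mul0r.
Qed.

Lemma fps_mulD (R : comPzRingType) : left_distributive (@fps_mul R) (@fps_add R).
Proof.
move=> f g h; apply: fpsP => n /=; rewrite -big_split /=.
by apply: eq_bigr => i _; rewrite mulrDl.
Qed.

HB.instance Definition _ (R : comPzRingType) :=
  GRing.isZmodule.Build (fps R)
    (@fps_addA R) (@fps_addC R) (@fps_add0 R) (@fps_addN R).
HB.instance Definition _ (R : comPzRingType) :=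
  GRing.Zmodule_isComPzRing.Build (fps R)
    (@fps_mulA R) (@fps_mulC R) (@fps_mul1 R) (@fps_mulD R).

Definition fps_t (R : comPzRingType) : fps R :=
  FPS (fun n => if n == 1%N then 1 else 0).

Definition fps_deriv (R : comPzRingType) (f : fps R) : fps R :=
  FPS (fun n => f n.+1 *+ n.+1).

Definition fps_ord (R : comPzRingType) (f : fps R) (k : nat) : Prop :=
  f k != 0 /\ forall i, (i < k)%N -> f i = 0.

(* The expansion 1 + f + f ^+ 2 + ... of 1 / (1 - f).  It is only used for f
   without constant term, so that f ^+ i does not contribute to t^n if i > n. *)
Definition fps_geom (R : comPzRingType) (f : fps R) : fps R :=
  FPS (fun n => \sum_(i < n.+1) (f ^+ i) n).

(* g (phi (s)), for phi without constant term *)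
Definition fps_comp (R : comPzRingType) (g phi : fps R) : fps R :=
  FPS (fun n => \sum_(i < n.+1) g i * (phi ^+ i) n).

Record plane_arc (F : closedFieldType) := PlaneArc {
  arcx : fps F;
  arcy : fps F;
  arcx0 : arcx 0 = 0;
  arcy0 : arcy 0 = 0 }.

(* F[[x, y]]; the coefficient of x^i y^j in f is f j i. *)
Notation fps2 F := (fps (fps F)).

Definition fps2_dx (F : closedFieldType) (f : fps2 F) : fps2 F :=
  FPS (fun j => fps_deriv (f j)).
Definition fps2_dy (F : closedFieldType) (f : fps2 F) : fps2 F := fps_deriv f.

(* f (x (s), y (s)) *)
Definition arc_subst (F : closedFieldType) (f : fps2 F) (g : plane_arc F) : fps F :=
  FPS (fun n => \sum_(j < n.+1) \sum_(i < n.+1)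
    f j i * (arcx g ^+ i * arcy g ^+ j) n).

Definition primitive_arc (F : closedFieldType) (g : plane_arc F) : Prop :=
  ~ exists (d : plane_arc F) (phi : fps F),
      [/\ phi 0 = 0, phi 1 = 0, arcx g = fps_comp (arcx d) phi &
          arcy g = fps_comp (arcy d) phi].

(* f generates the ideal of all series vanishing on the arc. *)
Definition reduced_equation (F : closedFieldType) (g : plane_arc F) (f : fps2 F) : Prop :=
  forall h : fps2 F, arc_subst h g = 0 <-> exists u, h = u * f.

(* The quotient F[[x, y]] / (a, b) has a basis with n elements. *)
Definition ideal2_codim (F : closedFieldType) (a b : fps2 F) (n : nat) : Prop :=
  exists e : 'I_n -> fps2 F, forall h : fps2 F,
    exists! c : 'rV[F]_n, exists u v : fps2 F,
      h = \sum_(i < n) fpsC (fpsC (c 0 i)) * e i + (u * a + v * b).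

(* None stands for infinity. *)
Definition milnor (F : closedFieldType) (g : plane_arc F) : option nat :=
  xget None [set o | exists (n : nat) (f : fps2 F),
    [/\ o = Some n, primitive_arc g, reduced_equation g f &
        ideal2_codim (fps2_dx f) (fps2_dy f) n]].

(* The n-jet of an arc: the coefficients of s, ..., s^n in x, then in y. *)
Definition jet (F : closedFieldType) (n : nat) (g : plane_arc F) : 'rV[F]_(n + n) :=
  row_mx (\row_(i < n) arcx g i.+1) (\row_(i < n) arcy g i.+1).

(* The affine space F^N as a chart of the projective space of dimension N *)
Definition aff_cone (F : closedFieldType) (N : nat) (A : set 'rV[F]_N) :
    set 'rV[F]_(1 + N) :=
  [set w | exists c v, [/\ c != 0, A v & w = c *: row_mx 1%:M v]].

Definition lc_partition (F : closedFieldType) (N : nat) (A : set 'rV[F]_N)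
    (r : nat) (X : 'I_r -> qvar F (1 + N)) : Prop :=
  (forall i j, i != j -> qset (X i) `&` qset (X j) = set0) /\
  aff_cone A = [set w | exists i, qset (X i) w].

Definition constructible (F : closedFieldType) (N : nat) (A : set 'rV[F]_N) : Prop :=
  exists r (X : 'I_r -> qvar F (1 + N)), lc_partition A X.

(* The class of a constructible set, computed from any partition of it into
   locally closed sets; it does not depend on the partition. *)
Definition constr_class (F : closedFieldType) (N : nat) (A : set 'rV[F]_N) : KVarL F :=
  xget 0 [set c | exists r (X : 'I_r -> qvar F (1 + N)),
    lc_partition A X /\ c = \sum_(i < r) kclass (X i)].

(* An additive extension of the measure of cylindric sets to an algebra of
   sets of arcs.  Which algebra is left open: the cylindric sets form the
   smallest one. *)
Record motivic_measure (F : closedFieldType) := MotivicMeasure {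
  mm_measurable : set (set (plane_arc F));
  mm_val :> set (plane_arc F) -> Mot F;
  mm_measurableC : forall A, mm_measurable A -> mm_measurable (~` A);
  mm_measurableU : forall A B,
    mm_measurable A -> mm_measurable B -> mm_measurable (A `|` B);
  mm_add : forall A B, mm_measurable A -> mm_measurable B ->
    A `&` B = set0 -> mm_val (A `|` B) = mm_val A + mm_val B;
  mm_cylinder : forall n (A : set 'rV[F]_(n + n)), constructible A ->
    mm_measurable (@jet F n @^-1` A) /\
    mm_val (@jet F n @^-1` A) = mot (constr_class A * kLpow F (- (2 * n)%:Z)) }.

(* The integral over D of t^(e g), where t^infinity = 0 *)
Definition motivic_integral (F : closedFieldType) (chi : motivic_measure F)
    (D : set (plane_arc F)) (e : plane_arc F -> option nat) : fps (Mot F) :=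
  FPS (fun n => chi [set g | D g /\ e g = Some n]).

Definition motivic_integrable (F : closedFieldType) (chi : motivic_measure F)
    (D : set (plane_arc F)) (e : plane_arc F -> option nat) : Prop :=
  forall n, mm_measurable chi [set g | D g /\ e g = Some n].

Definition arcs_ord (F : closedFieldType) (k m : nat) : set (plane_arc F) :=
  [set g | fps_ord (arcx g) k /\ fps_ord (arcy g) m].

Definition moebius (n : nat) : int :=
  if all (fun p => logn p n == 1%N) (primes n) then (-1) ^+ size (primes n) else 0.

Definition LL (F : closedFieldType) (z : int) : fps (Mot F) := fpsC (Lpow F z).

(* A lists a_0, ..., a_r and B lists b_1, ..., b_r; the index j runs from 0 to
   r - 1, so that A at widen_ord, B, and A at lift are a_j, b_(j+1), a_(j+1). *)
Definition admissible (a r : nat) (A : {ffun 'I_r.+1 -> 'I_a.+1})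
    (B : {ffun 'I_r -> 'I_a.+1}) : bool :=
  [&& A ord0 == 1%N :> nat, A ord_max == a :> nat &
    [forall j : 'I_r,
      let a0 := A (widen_ord (leqnSn r) j) in
      let a1 := A (lift ord0 j) in
      [&& (a0 <= B j)%N, (B j < a1)%N, (a0 %| B j)%N & (B j %| a1)%N]]].

(* Main.v *)
Require Import Defs.
From HB Require Import structures.
From mathcomp Require Import all_boot all_order all_algebra.
From mathcomp Require Import boolp classical_sets reals.
From mathcomp Require Import complex.
From mathcomp Require Import separable cyclic cyclotomic.
From mathcomp Require Import ring zify.
Set Implicit Arguments.
Unset Strict Implicit.
Unset Printing Implicit Defensive.
Import Order.TTheory GRing.Theory Num.Theory.
Local Open Scope ring_scope.

(** An arc with Ord x = k is (rho^k, Y(rho)) for a series rho of order 1.  Let e_i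
    be the gcd of k and of the exponents at most i that occur in Y.  Factoring the
    equation of the branch and its polar curve into Puiseux roots (Teissier's
    lemma), its Milnor number is the sum of the (i - 1)(e_(i-1) - e_i), and it is
    infinite if e_i never reaches 1.  Each coefficient of Y contributes the factor
    L^-1 to the measure if it must vanish and 1 - L^-1 if it must not, so that the
    integral is the generating function of a walk on the pairs (e, i).  Shifting i
    by e multiplies this function by t^(e(e-1)), whence a recursion over the next
    gcd e' = gcd(e, r), r < e.  Moebius inversion writes the sum over the r with
    gcd(e, r) = d in terms of the geometric sums over the multiples of the b with
    d | b | e; unrolling the recursion gives the sum over the tuples. *)

(** * Formal power series *)

(** The measure is only known to be finitely additive on some algebra containing the cylinders, so
    every level set of the Milnor number must be shown to be a finite union of cylinders: a gcd
    other than 1 at index i forces mu >= i, whence mu = n is decided by finitely many coefficients.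
    The cylinders in turn must be described by rational functions of the jet. The coefficients of Y
    are not rational: rho contains a k-th root of the leading coefficient x_k. So y is expanded in
    powers of tau, where x = x_k tau^k and tau = s + ...; its coefficients are rational where x_k is
    nonzero, and vanish exactly where those of Y do. Roots z(x) exist only over fractional powers of
    x. Codimensions of ideals of F[[x, y]] are therefore computed after x -> x^N, as sums of orders
    along the roots, and divided by N, since F[[x, y]] is free of rank N over F[[x^N, y]]. As no
    cancellation is available in the completed Grothendieck ring, the denominators 1 - t^p L^-q are
    inverted through their geometric series. *)

Lemma fps_eqP (R : Type) (f g : fps R) : f = g <-> f =1 g.
Proof. by split=> [-> //|]; exact: fpsP. Qed.

Section FpsPz.
Variable R : comPzRingType.
Implicit Types f g h : fps R.

Lemma fpsCE (c : R) n : fpsC c n = if n == 0%N then c else 0.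
Proof. by []. Qed.

Lemma fps0E n : (0 : fps R) n = 0.
Proof. by rewrite [LHS]fpsCE if_same. Qed.

Lemma fps1E n : (1 : fps R) n = (n == 0%N)%:R.
Proof. by rewrite [LHS]fpsCE; case: eqP. Qed.

Lemma fpsDE f g n : (f + g) n = f n + g n.
Proof. by []. Qed.

Lemma fpsBE f g n : (f - g) n = f n - g n.
Proof. by []. Qed.

Lemma fpsME f g n : (f * g) n = \sum_(i < n.+1) f i * g (n - i)%N.
Proof. by []. Qed.

Lemma fps_sumE (I : Type) (r : seq I) (P : pred I) (F : I -> fps R) n :
  (\sum_(i <- r | P i) F i) n = \sum_(i <- r | P i) F i n.
Proof.
by elim/big_rec2: _ => [|i x y _ <-]; [exact: fps0E|].
Qed.

Lemma fpsMnE f n m : (f *+ m) n = f n *+ m.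
Proof. by rewrite -[m in LHS]card_ord -sumr_const fps_sumE sumr_const card_ord. Qed.

Lemma fpsCM (c : R) f n : (fpsC c * f) n = c * f n.
Proof.
rewrite fpsME big_ord_recl subn0 big1 ?addr0 // => i _.
by rewrite fpsCE mul0r.
Qed.

Lemma fpsM0 f g : (f * g) 0 = f 0 * g 0.
Proof. by rewrite fpsME big_ord1. Qed.

Lemma fpsX0 f n : (f ^+ n) 0 = f 0 ^+ n.
Proof. by elim: n => [|n IH]; rewrite ?expr0 // !exprS fpsM0 IH. Qed.

Lemma fpsC_is_zmod : zmod_morphism (@fpsC R).
Proof. by move=> x y; apply: fpsP => n; rewrite fpsBE !fpsCE; case: eqP; rewrite ?subr0. Qed.

Lemma fpsC_is_monoid : monoid_morphism (@fpsC R).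
Proof.
by split=> // x y; apply: fpsP => n; rewrite fpsCM !fpsCE; case: eqP; rewrite ?mulr0.
Qed.

HB.instance Definition _ := GRing.isZmodMorphism.Build R (fps R) (@fpsC R) fpsC_is_zmod.
HB.instance Definition _ := GRing.isMonoidMorphism.Build R (fps R) (@fpsC R) fpsC_is_monoid.

Local Notation t := (fps_t R).

Lemma fps_tM f n : (t * f) n = if n is m.+1 then f m else 0.
Proof.
rewrite fpsME big_ord_recl mul0r add0r; case: n => [|n]; first by rewrite big_ord0.
rewrite big_ord_recl big1 ?addr0 => [|i _]; last by rewrite /= mul0r.
by rewrite /= mul1r subn1.
Qed.

Lemma fps_tXM k f n : (t ^+ k * f) n = if (n < k)%N then 0 else f (n - k)%N.
Proof.
elim: k n => [|k IH] n; first by rewrite mul1r subn0.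
by rewrite exprS -mulrA fps_tM; case: n => [|n] //; rewrite IH ltnS subSS.
Qed.

Lemma fps_tXE k n : (t ^+ k) n = (n == k)%:R.
Proof.
rewrite -[t ^+ k]mulr1 fps_tXM fps1E subn_eq0.
by case: ltngtP.
Qed.

Definition fps_dvd k f := forall i, (i < k)%N -> f i = 0.

Lemma fps_dvdW k l f : (l <= k)%N -> fps_dvd k f -> fps_dvd l f.
Proof. by move=> lk fk i il; apply: fk; exact: leq_trans lk. Qed.

Lemma fps_dvdM k l f g : fps_dvd k f -> fps_dvd l g -> fps_dvd (k + l) (f * g).
Proof.
move=> fk gl i ikl; rewrite fpsME big1 // => j _.
have [jk|kj] := ltnP j k; first by rewrite fk ?mul0r.
by rewrite gl ?mulr0 //; have := ltn_ord j; lia.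
Qed.

Lemma fps_dvdX f n : f 0%N = 0 -> fps_dvd n (f ^+ n).
Proof.
move=> f0; elim: n => [|n IH] //; rewrite exprS -add1n.
by apply: fps_dvdM => // -[].
Qed.

Lemma fps_dvdtP k f : fps_dvd k f <-> exists g, f = t ^+ k * g.
Proof.
split=> [fk|[g -> i ik]]; last by rewrite fps_tXM ik.
exists (FPS (fun n => f (k + n)%N)); apply: fpsP => n; rewrite fps_tXM.
by case: ltnP => [/fk //|kn]; rewrite /= subnKC.
Qed.

Lemma fps_agreeM k f f' g g' : (forall i, (i <= k)%N -> f i = f' i) ->
  (forall i, (i <= k)%N -> g i = g' i) -> (f * g) k = (f' * g') k.
Proof.
move=> ff gg; rewrite !fpsME; apply: eq_bigr => i _.
by rewrite ff ?gg ?leq_subr // -ltnS.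
Qed.

(** Up to degree n the series [fps_geom f] agrees with the finite sum of the f^i, i <= n, because
    f^i has no term below degree i; with the finite sum the product telescopes. *)
Lemma fps_geomP f : f 0%N = 0 -> (1 - f) * fps_geom f = 1.
Proof.
move=> f0; apply: fpsP => n.
have -> : ((1 - f) * fps_geom f) n = ((1 - f) * \sum_(i < n.+1) f ^+ i) n.
  apply: fps_agreeM => // i ilen; rewrite fps_sumE /= (big_ord_widen n.+1 (fun j => (f ^+ j) i)) ?ltnS //.
  rewrite big_mkcond; apply: eq_bigr => j _; case: ltnP => // ij.
  by rewrite (@fps_dvdX f j f0).
have -> : (1 - f) * \sum_(i < n.+1) f ^+ i = 1 - f ^+ n.+1.
  by rewrite -opprB -[RHS]opprB subrX1 mulNr.
by rewrite fpsBE (@fps_dvdX f n.+1 f0) // subr0.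
Qed.

Lemma fps_split f n : f = \sum_(i < n) fpsC (f i) * t ^+ i +
  t ^+ n * FPS (fun i => f (n + i)%N).
Proof.
apply: fpsP => j; rewrite fpsDE fps_tXM fps_sumE.
under eq_bigr do rewrite fpsCM fps_tXE.
case: ltnP => jn.
  rewrite addr0 (bigD1 (Ordinal jn)) //= eqxx mulr1 big1 ?addr0 // => i.
  by rewrite eq_sym -val_eqE /= => /negbTE ->; rewrite mulr0.
rewrite big1 ?add0r /= ?subnKC // => i _; rewrite gtn_eqF ?mulr0 //.
exact: leq_trans jn.
Qed.

End FpsPz.

Lemma fps_nonzero (R : comNzRingType) : (1 : fps R) != 0.
Proof. by apply/eqP => /(congr1 (fun f : fps R => f 0%N)) /eqP; rewrite fps1E fps0E oner_eq0. Qed.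

HB.instance Definition _ (R : comNzRingType) :=
  GRing.PzSemiRing_isNonZero.Build (fps R) (@fps_nonzero R).

Section FpsUnit.
Variable R : comUnitRingType.
Implicit Types f g : fps R.

Definition fps_unit : {pred fps R} := fun f => f 0%N \is a GRing.unit.
Definition fps_inv f : fps R :=
  if f \in fps_unit then fpsC (f 0%N)^-1 * fps_geom (1 - fpsC (f 0%N)^-1 * f) else f.

Lemma fps_mulVr : {in fps_unit, left_inverse 1 fps_inv *%R}.
Proof.
move=> f fu; rewrite /fps_inv fu mulrAC mulrC.
set g := 1 - _; have -> : fpsC (f 0%N)^-1 * f = 1 - g by rewrite /g subKr.
by rewrite mulrC fps_geomP // /g fpsBE fpsM0 fps1E fpsCE eqxx mulVr ?subrr.
Qed.

Lemma fps_unitPl f g : g * f = 1 -> f \in fps_unit.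
Proof.
move=> /(congr1 (fun f : fps R => f 0%N)); rewrite fpsM0 fps1E eqxx => gf.
by apply/unitrPr; exists (g 0%N); rewrite mulrC.
Qed.

Lemma fps_inv_out : {in [predC fps_unit], fps_inv =1 id}.
Proof. by move=> f; rewrite !inE /fps_inv => /negbTE ->. Qed.

HB.instance Definition _ := GRing.ComNzRing_hasMulInverse.Build (fps R)
  fps_mulVr fps_unitPl fps_inv_out.

Lemma fps_unitE f : (f \is a GRing.unit) = (f 0%N \is a GRing.unit).
Proof. by []. Qed.

End FpsUnit.

Section FpsIdomain.
Variable R : idomainType.
Implicit Types f g : fps R.

Lemma fps_ord_ex f : f != 0 -> exists k, fps_ord f k.
Proof.
move=> f0; have /asboolP ex : `[< exists k, f k != 0 >].
  apply/asboolP; apply: contrapT => nf; move/eqP: f0; apply; apply: fpsP => n.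
  by apply/eqP; apply: contrapT => /negP fn; apply: nf; exists n; rewrite fps0E in fn.
exists (ex_minn ex); split; first by case: ex_minnP.
move=> i; case: ex_minnP => k _ mink ik; apply/eqP; apply: contraLR ik.
by rewrite -leqNgt; exact: mink.
Qed.

Lemma fps_ordM f g k l : fps_ord f k -> fps_ord g l -> fps_ord (f * g) (k + l).
Proof.
move=> [fk fk0] [gl gl0]; split; last exact: (fps_dvdM fk0 gl0).
rewrite fpsME (bigD1 (inord k)) //= inordK ?ltnS ?leq_addr // addKn big1 ?addr0.
  by rewrite mulf_neq0.
move=> i ik; have {ik}: val i != k.
  apply: contra ik => /eqP ik; apply/eqP/val_inj; rewrite /= inordK ?ltnS ?leq_addr //.
rewrite neq_ltn => /orP[/fk0 ->|ki]; first by rewrite mul0r.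
by rewrite gl0 ?mulr0 //; move: ki (ltn_ord i) => /=; lia.
Qed.

Lemma fps_ord_neq0 f k : fps_ord f k -> f != 0.
Proof. by move=> [fk _]; apply: contra fk => /eqP ->; rewrite fps0E. Qed.

Lemma fps_integral f g : f * g = 0 -> (f == 0) || (g == 0).
Proof.
move=> fg; apply/orP; apply: contrapT => /not_orP[/negP f0 /negP g0].
have [k fk] := fps_ord_ex f0; have [l gl] := fps_ord_ex g0.
by have := fps_ord_neq0 (fps_ordM fk gl); rewrite fg eqxx.
Qed.

HB.instance Definition _ := GRing.ComUnitRing_isIntegral.Build (fps R) fps_integral.

End FpsIdomain.

Section FpsOrd.
Variable R : idomainType.
Implicit Types f g : fps R.

Lemma fps_ord_uniq f k l : fps_ord f k -> fps_ord f l -> k = l.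
Proof.
move=> [fk fk0] [fl fl0]; case: (ltngtP k l) => // [/fl0|/fk0] e.
  by rewrite e eqxx in fk.
by rewrite e eqxx in fl.
Qed.

Lemma fps_ordP f k : fps_ord f k <-> exists2 u : fps R, u 0%N != 0 & f = fps_t R ^+ k * u.
Proof.
split=> [[fk fk0]|[u u0 ->]].
  have /fps_dvdtP [u fE] : fps_dvd k f by [].
  by exists u => //; move: fk; rewrite fE fps_tXM ltnn subnn.
by split=> [|i ik]; rewrite fps_tXM ?ltnn ?subnn ?ik.
Qed.

Lemma fps_ord1 : fps_ord (1 : fps R) 0.
Proof. by split=> //; rewrite fps1E oner_neq0. Qed.

Lemma fps_ord_prod (I : Type) (r : seq I) (P : pred I) (F : I -> fps R) (d : I -> nat) :
  (forall i, P i -> fps_ord (F i) (d i)) ->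
  fps_ord (\prod_(i <- r | P i) F i) (\sum_(i <- r | P i) d i)%N.
Proof.
by move=> Fd; elim/big_rec2: _ => [|i x y /Fd Fi IH]; [exact: fps_ord1|exact: fps_ordM].
Qed.

Lemma fps_t_neq0 : fps_t R != 0.
Proof. by apply/eqP => /(congr1 (fun f : fps R => f 1%N)) /eqP; rewrite fps0E /= oner_eq0. Qed.

End FpsOrd.

Definition fps_map (R S : Type) (phi : R -> S) (f : fps R) : fps S := FPS (fun n => phi (f n)).

Lemma fps_mapE (R S : Type) (phi : R -> S) f n : fps_map phi f n = phi (f n).
Proof. by []. Qed.

Lemma fps_mapC (R S : comPzRingType) (phi : {rmorphism R -> S}) c :
  fps_map phi (fpsC c) = fpsC (phi c).
Proof. by apply: fpsP => n; rewrite fps_mapE !fpsCE; case: eqP; rewrite ?rmorph0. Qed.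

Lemma fps_map_t (R S : comPzRingType) (phi : {rmorphism R -> S}) :
  fps_map phi (fps_t R) = fps_t S.
Proof. by apply: fpsP => n /=; case: eqP; rewrite ?rmorph0 ?rmorph1. Qed.

Section FpsMap.
Variables (R S : comPzRingType) (phi : {rmorphism R -> S}).
Local Notation fps_map := (@fps_map R S phi).

Lemma fps_map_is_zmod : zmod_morphism fps_map.
Proof. by move=> f g; apply: fpsP => n; rewrite /= rmorphB. Qed.

Lemma fps_map_is_monoid : monoid_morphism fps_map.
Proof.
split=> [|f g]; apply: fpsP => n; first by rewrite fps_mapE !fps1E rmorph_nat.
by rewrite /= rmorph_sum; apply: eq_bigr => i _; rewrite rmorphM.
Qed.

HB.instance Definition _ := GRing.isZmodMorphism.Build _ _ fps_map fps_map_is_zmod.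
HB.instance Definition _ := GRing.isMonoidMorphism.Build _ _ fps_map fps_map_is_monoid.

End FpsMap.

(* Evaluation of H(y), a series with coefficients in R[[x]], at y = z(x). *)
Section FpsEval.
Variable R : comPzRingType.
Implicit Types (z : fps R) (H K : fps (fps R)).

Definition fps_ev z H : fps R := FPS (fun n => \sum_(i < n.+1) (H i * z ^+ i) n).

Lemma fps_ev_coef z H n : fps_ev z H n = \sum_(i < n.+1) (H i * z ^+ i) n.
Proof. by []. Qed.

Lemma fps_evE z H n m : z 0%N = 0 -> (n < m)%N ->
  fps_ev z H n = \sum_(i < m) (H i * z ^+ i) n.
Proof.
move=> z0 nm; rewrite [LHS](big_ord_widen m (fun i => (H i * z ^+ i) n)) //.
rewrite big_mkcond; apply: eq_bigr => i _; case: ltnP => // ni.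
by rewrite (@fps_dvdM _ 0 i) //; exact: fps_dvdX.
Qed.

Lemma fps_ev_is_zmod z : zmod_morphism (fps_ev z).
Proof.
move=> H K; apply: fpsP => n; rewrite fpsBE !fps_ev_coef -sumrB.
by apply: eq_bigr => i _; rewrite fpsBE mulrBl fpsBE.
Qed.
HB.instance Definition _ z := GRing.isZmodMorphism.Build _ _ (fps_ev z) (@fps_ev_is_zmod z).

Lemma fps_evD z H K : fps_ev z (H + K) = fps_ev z H + fps_ev z K.
Proof. exact: raddfD. Qed.

Lemma fps_ev_sum z I (r : seq I) (P : pred I) (H : I -> fps (fps R)) :
  fps_ev z (\sum_(i <- r | P i) H i) = \sum_(i <- r | P i) fps_ev z (H i).
Proof. exact: raddf_sum. Qed.

Lemma fps_evC z (c : fps R) : fps_ev z (fpsC c) = c.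
Proof.
apply: fpsP => n; rewrite fps_ev_coef big_ord_recl expr0 mulr1 big1 ?addr0 // => i _.
by rewrite fpsCE mul0r fps0E.
Qed.

Lemma fps_ev1 z : fps_ev z 1 = 1.
Proof. exact: fps_evC. Qed.

Lemma fps_ev_tM z H : z 0%N = 0 -> fps_ev z (fps_t (fps R) * H) = z * fps_ev z H.
Proof.
move=> z0; apply: fpsP => n; rewrite (fps_evE _ z0 (ltnSn n)) big_ord_recl fps_tM mul0r.
rewrite fps0E add0r.
transitivity ((z * \sum_(i < n) H i * z ^+ i) n).
  rewrite mulr_sumr fps_sumE; apply: eq_bigr => i _.
  by rewrite fps_tM exprS mulrCA.
rewrite !fpsME big_ord_recl [RHS]big_ord_recl z0 !mul0r !add0r; apply: eq_bigr => i _.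
congr (_ * _); rewrite fps_sumE -(fps_evE _ z0) //.
by rewrite lift0; have := ltn_ord i; lia.
Qed.

Lemma fps_ev_tXM z H k : z 0%N = 0 -> fps_ev z (fps_t (fps R) ^+ k * H) = z ^+ k * fps_ev z H.
Proof.
move=> z0; elim: k => [|k IH]; first by rewrite !mul1r.
by rewrite !exprS -!mulrA fps_ev_tM // IH.
Qed.

Lemma fps_ev_t z : z 0%N = 0 -> fps_ev z (fps_t (fps R)) = z.
Proof. by move=> z0; rewrite -[fps_t _]mulr1 fps_ev_tM // fps_ev1 mulr1. Qed.

Lemma fps_evCM z (c : fps R) H : z 0%N = 0 -> fps_ev z (fpsC c * H) = c * fps_ev z H.
Proof.
move=> z0; apply: fpsP => n.
transitivity ((c * \sum_(i < n.+1) H i * z ^+ i) n).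
  by rewrite mulr_sumr fps_sumE; apply: eq_bigr => i _; rewrite fpsCM mulrA.
apply: fps_agreeM => // i ilen; rewrite fps_sumE -fps_evE //.
Qed.

(** H is cut after its terms of degree n in y: the rest is a multiple of y^(n+1), whose value is a
    multiple of z^(n+1) and does not reach the coefficient n. On the remaining finite sum the claim
    is linear. *)
Lemma fps_evM z H K : z 0%N = 0 -> fps_ev z (H * K) = fps_ev z H * fps_ev z K.
Proof.
move=> z0; apply: fpsP => n; rewrite {1}(fps_split H n.+1) mulrDl fps_evD.
rewrite -[_ ^+ n.+1 * _ * K]mulrA fps_ev_tXM // mulr_suml fps_ev_sum fpsDE.
rewrite [X in _ + X](@fps_dvdM _ n.+1 0) ?addn0 //; last exact: fps_dvdX.
rewrite addr0.
under eq_bigr => i _ do rewrite -mulrA fps_evCM // fps_ev_tXM // mulrA.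
rewrite -mulr_suml; apply: fps_agreeM => // i ilen.
by rewrite fps_sumE -fps_evE.
Qed.

(** Division by y - z. The coefficient j of the quotient is the sum of the H_(j+i+1) z^i, as in
    Horner's scheme; [key] is the recursion between these sums. *)
Lemma fps_ev_sub z H : z 0%N = 0 -> exists Q,
  H = (fps_t (fps R) - fpsC z) * Q + fpsC (fps_ev z H).
Proof.
move=> z0.
exists (FPS (fun j => fps_ev z (FPS (fun i => H (j + i).+1)))).
have key j : fps_ev z (FPS (fun i => H (j + i)%N)) =
    H j + z * fps_ev z (FPS (fun i => H (j + i).+1)).
  rewrite -fps_ev_tM // -[H j in RHS](fps_evC z) -fps_evD; congr fps_ev.
  by apply: fpsP => -[|i]; rewrite fpsDE fps_tM fpsCE /= ?addn0 ?addr0 ?add0r ?addnS.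
apply: fpsP => j; rewrite fpsDE mulrBl fpsBE fpsCM fps_tM fpsCE.
case: j => [|j] /=.
  have -> : H = FPS (fun i => H (0 + i)%N) by apply: fpsP.
  by rewrite key sub0r addrC addrK.
rewrite addr0 -[X in X - _]/(fps_ev z (FPS (fun i => H (j + i).+1))).
have := key j.+1; rewrite -/(fps_ev _ _).
have -> : FPS (fun i => H (j.+1 + i)%N) = FPS (fun i => H (j + i).+1) by apply: fpsP.
by move=> ->; rewrite addrK.
Qed.

End FpsEval.

(** * Substitution, inflation and derivation *)

(** No continuity of [psi] is assumed: the tail beyond degree n in y contributes a multiple of
    psi(z)^(n+1), which does not reach the coefficient n. *)
Lemma fps_ev_morph (R S : comPzRingType) (psi : {rmorphism fps R -> fps S}) (z : fps R) H :
  z 0%N = 0 -> psi z 0%N = 0 -> psi (fps_ev z H) = fps_ev (psi z) (fps_map psi H).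
Proof.
move=> z0 pz0; apply: fpsP => n; rewrite {1}(fps_split H n.+1) fps_evD fps_ev_sum.
rewrite fps_ev_tXM // rmorphD rmorphM rmorphXn fpsDE.
rewrite [X in _ + X](@fps_dvdM _ n.+1 0) ?addn0 //; last exact: fps_dvdX.
rewrite addr0 rmorph_sum fps_sumE fps_ev_coef; apply: eq_bigr => i _.
by rewrite fps_evCM // -[fps_t _ ^+ i]mulr1 fps_ev_tXM // fps_ev1 mulr1 rmorphM rmorphXn.
Qed.

Section FpsComp.
Variable R : comPzRingType.
Implicit Types f g phi psi z : fps R.

Lemma fps_compE g phi : fps_comp g phi = fps_ev phi (fps_map (@fpsC R) g).
Proof.
by apply: fpsP => n; rewrite fps_ev_coef; apply: eq_bigr => i _; rewrite fps_mapE fpsCM.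
Qed.

Lemma fps_comp_coef0 g phi : fps_comp g phi 0%N = g 0%N.
Proof. by rewrite /= big_ord1 expr0 fps1E mulr1. Qed.

Lemma fps_comp_is_zmod phi : zmod_morphism ((@fps_comp R)^~ phi).
Proof.
move=> f g; rewrite !fps_compE -[RHS]raddfB -raddfB //.
Qed.

Lemma fps_comp_is_monoid phi : phi 0%N = 0 -> monoid_morphism ((@fps_comp R)^~ phi).
Proof.
move=> phi0; split=> [|f g]; rewrite !fps_compE; first by rewrite rmorph1 fps_ev1.
by rewrite rmorphM fps_evM.
Qed.

(* The ring morphism f(x) |-> f(phi(x)); phi must have no constant term. *)
Definition fps_comp_morph phi (phi0 : phi 0%N = 0) : {rmorphism fps R -> fps R} :=
  HB.pack ((@fps_comp R)^~ phi)
    (GRing.isZmodMorphism.Build _ _ ((@fps_comp R)^~ phi) (@fps_comp_is_zmod phi))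
    (GRing.isMonoidMorphism.Build _ _ ((@fps_comp R)^~ phi) (fps_comp_is_monoid phi0)).

Lemma fps_compM f g phi : phi 0%N = 0 ->
  fps_comp (f * g) phi = fps_comp f phi * fps_comp g phi.
Proof. by move=> /fps_comp_is_monoid[]. Qed.

Lemma fps_compXn f n phi : phi 0%N = 0 -> fps_comp (f ^+ n) phi = fps_comp f phi ^+ n.
Proof. by move=> phi0; exact: (rmorphXn (fps_comp_morph phi0)). Qed.

Lemma fps_comp_ev z H phi : z 0%N = 0 -> phi 0%N = 0 ->
  fps_comp (fps_ev z H) phi = fps_ev (fps_comp z phi) (fps_map ((@fps_comp R)^~ phi) H).
Proof.
move=> z0 phi0; apply: (@fps_ev_morph _ _ (fps_comp_morph phi0)) => //.
exact: etrans (fps_comp_coef0 _ _) _.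
Qed.

Lemma fps_compC c phi : fps_comp (fpsC c) phi = fpsC c.
Proof.
rewrite fps_compE -[RHS](fps_evC phi); congr fps_ev; apply: fpsP => n.
by rewrite fps_mapE !fpsCE; case: eqP; rewrite ?rmorph0.
Qed.

Lemma fps_comp_t phi : phi 0%N = 0 -> fps_comp (fps_t R) phi = phi.
Proof. by move=> p0; rewrite fps_compE fps_map_t fps_ev_t. Qed.

Lemma fps_compA f phi psi : phi 0%N = 0 -> psi 0%N = 0 ->
  fps_comp (fps_comp f phi) psi = fps_comp f (fps_comp phi psi).
Proof.
move=> p0 q0; rewrite (fps_compE f) fps_comp_ev // (fps_compE f); congr fps_ev.
by apply: fpsP => n; rewrite !fps_mapE fps_compC.
Qed.

End FpsComp.

(** The double sum becomes an iterated substitution, x(s) in the coefficients and then y(s), so that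
    the multiplicativity of [fps_ev] and its compatibility with morphisms apply to arcs. *)
Lemma arc_subst_ev (F : closedFieldType) (f : fps2 F) (g : plane_arc F) :
  arc_subst f g = fps_ev (arcy g) (fps_map ((@fps_comp F)^~ (arcx g)) f).
Proof.
apply: fpsP => n; rewrite fps_ev_coef; apply: eq_bigr => j _; rewrite fps_mapE.
transitivity ((\sum_(i < n.+1) fpsC (f j i) * arcx g ^+ i * arcy g ^+ j) n).
  by rewrite fps_sumE; apply: eq_bigr => i _; rewrite -mulrA fpsCM.
rewrite -mulr_suml; apply: fps_agreeM => // i ilen.
rewrite fps_sumE -[RHS]/(fps_comp (f j) (arcx g) i) fps_compE (@fps_evE _ _ _ _ n.+1) ?arcx0 //.
Qed.

Section FpsInfl.
Variable R : comPzRingType.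

(* f(x^N); for N = 0 this is the constant f(0). *)
Definition fps_infl N (f : fps R) : fps R :=
  FPS (fun n => if (N %| n)%N then f (n %/ N)%N else 0).

Lemma fps_inflE N f n : fps_infl N f n = if (N %| n)%N then f (n %/ N)%N else 0.
Proof. by []. Qed.

Lemma fps_infl_comp N f : (0 < N)%N -> fps_infl N f = fps_comp f (fps_t R ^+ N).
Proof.
move=> N0; apply: fpsP => n /=; under eq_bigr do rewrite -exprM fps_tXE mulr_natr.
case: ifP => [/dvdnP[q ->]|ndvd].
  rewrite mulnK // (bigD1 (inord q)) //= inordK ?ltnS ?leq_pmulr // mulnC eqxx.
  rewrite big1 ?addr0 // => i; rewrite -val_eqE /= inordK ?ltnS ?leq_pmull // => iq.
  by rewrite eqn_pmul2l // eq_sym (negbTE iq).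
rewrite big1 // => i _; case: eqP => // nE.
by rewrite nE dvdn_mulr in ndvd.
Qed.

Lemma fps_infl0 f : fps_infl 0 f = fpsC (f 0%N).
Proof. by apply: fpsP => -[|n] //=; rewrite fpsCE dvd0n. Qed.

Lemma fps_infl_is_zmod N : zmod_morphism (fps_infl N).
Proof.
by move=> f g; apply: fpsP => n; rewrite fpsBE /=; case: ifP; rewrite ?subr0.
Qed.

Lemma fps_infl_is_monoid N : monoid_morphism (fps_infl N).
Proof.
case: N => [|N].
  by split=> [|f g]; rewrite !fps_infl0 ?fps1E // fpsM0 rmorphM.
have t0 : (fps_t R ^+ N.+1) 0%N = 0 by rewrite fps_tXE.
by split=> [|f g]; rewrite !fps_infl_comp // (fps_comp_is_monoid t0).
Qed.

HB.instance Definition _ N := GRing.isZmodMorphism.Build _ _ (fps_infl N) (@fps_infl_is_zmod N).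
HB.instance Definition _ N := GRing.isMonoidMorphism.Build _ _ (fps_infl N) (@fps_infl_is_monoid N).

Lemma fps_infl_coef0 N f : fps_infl N f 0%N = f 0%N.
Proof. by rewrite /= dvdn0 div0n. Qed.

Lemma fps_infl_infl M N f : (0 < M)%N -> fps_infl M (fps_infl N f) = fps_infl (M * N) f.
Proof.
move=> M0; apply: fpsP => n /=; case: ifP => [/dvdnP[q ->]|Mn].
  by rewrite mulnK // [(M * N)%N]mulnC dvdn_pmul2r // divnMr.
case: ifP => // /dvdnP[q nE]; by rewrite nE mulnCA dvdn_mulr in Mn.
Qed.

Lemma fps_inflC N c : fps_infl N (fpsC c) = fpsC c.
Proof.
apply: fpsP => n; rewrite fps_inflE; case: ifP => Nn.
  rewrite !fpsCE; case: N Nn => [|N] Nn; first by rewrite dvd0n in Nn; rewrite divn0 Nn.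
  case: n Nn => [|n] Nn; first by rewrite div0n.
  by rewrite gtn_eqF // divn_gt0 // dvdn_leq.
by rewrite fpsCE; case: eqP => // n0; rewrite n0 dvdn0 in Nn.
Qed.

Lemma fps_infl_t N : (0 < N)%N -> fps_infl N (fps_t R) = fps_t R ^+ N.
Proof. by move=> N0; rewrite fps_infl_comp // fps_comp_t // fps_tXE eq_sym (gtn_eqF N0). Qed.

Lemma fps_infl_ord N f k : fps_ord f k -> (0 < N)%N -> fps_ord (fps_infl N f) (N * k).
Proof.
move=> [fk fk0] N0; split=> [|i ik] /=; first by rewrite dvdn_mulr // mulKn.
case: ifP => // /dvdnP[q iE]; rewrite iE mulnK //; apply: fk0.
by move: ik; rewrite iE mulnC ltn_pmul2l.
Qed.

Lemma fps_infl_inj N : (0 < N)%N -> injective (fps_infl N).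
Proof.
move=> N0 f g /fps_eqP fg; apply: fpsP => n.
by have := fg (N * n)%N; rewrite /= dvdn_mulr // mulKn.
Qed.

Definition fps_rot (c : R) (f : fps R) : fps R := FPS (fun n => c ^+ n * f n).

Lemma fps_rotE c f n : fps_rot c f n = c ^+ n * f n.
Proof. by []. Qed.

Lemma fps_rot_is_zmod c : zmod_morphism (fps_rot c).
Proof. by move=> f g; apply: fpsP => n; rewrite fpsBE /= mulrBr. Qed.

Lemma fps_rot_is_monoid c : monoid_morphism (fps_rot c).
Proof.
split=> [|f g]; apply: fpsP => n; first by rewrite fps_rotE fps1E mulr_natr mulrb; case: n.
rewrite fps_rotE mulr_sumr; apply: eq_bigr => i _; rewrite !fps_rotE.
by rewrite mulrACA -exprD subnKC // -ltnS.
Qed.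

HB.instance Definition _ c := GRing.isZmodMorphism.Build _ _ (fps_rot c) (@fps_rot_is_zmod c).
HB.instance Definition _ c := GRing.isMonoidMorphism.Build _ _ (fps_rot c) (@fps_rot_is_monoid c).

Lemma fps_rot_rot c d f : fps_rot c (fps_rot d f) = fps_rot (c * d) f.
Proof. by apply: fpsP => n /=; rewrite exprMn mulrA. Qed.

Lemma fps_rot1 f : fps_rot 1 f = f.
Proof. by apply: fpsP => n /=; rewrite expr1n mul1r. Qed.

Lemma fps_rot_coef0 c f : fps_rot c f 0%N = f 0%N.
Proof. by rewrite /= mul1r. Qed.

End FpsInfl.

Section FpsDeriv.
Variable R : comPzRingType.
Implicit Types (f g z : fps R) (H : fps (fps R)).
Local Notation D := (@fps_deriv R).

Lemma fps_deriv_is_zmod : zmod_morphism D.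
Proof. by move=> f g; apply: fpsP => n; rewrite fpsBE /= mulrnBl. Qed.
HB.instance Definition _ := GRing.isZmodMorphism.Build _ _ D fps_deriv_is_zmod.

Lemma fps_deriv_sum I (r : seq I) (P : pred I) (G : I -> fps R) :
  D (\sum_(i <- r | P i) G i) = \sum_(i <- r | P i) D (G i).
Proof. exact: raddf_sum. Qed.

Lemma fps_derivM f g : D (f * g) = D f * g + f * D g.
Proof.
apply: fpsP => n; rewrite fpsDE.
have -> : D (f * g) n = \sum_(i < n.+2) (f i *+ i) * g (n.+1 - i)%N +
    \sum_(i < n.+2) f i * (g (n.+1 - i)%N *+ (n.+1 - i)).
  rewrite -big_split [LHS]/= -sumrMnl; apply: eq_bigr => i _.
  by rewrite mulrnAl mulrnAr -[RHS]mulrnDr subnKC // -ltnS.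
rewrite big_ord_recl mulr0n mul0r add0r; congr (_ + _).
rewrite big_ord_recr /= subnn mulr0n mulr0 addr0.
apply: eq_bigr => i _ /=.
by rewrite -subSn // -ltnS.
Qed.

Lemma fps_derivX f n : D (f ^+ n) = (f ^+ n.-1 * D f) *+ n.
Proof.
elim: n => [|n IH]; first by apply: fpsP => i; rewrite mulr0n fps0E /= mul0rn.
rewrite exprS fps_derivM IH; case: n {IH} => [|n].
  by rewrite mulr0n mulr0 addr0 expr0 mulr1 mul1r mulr1n.
by rewrite mulrnAr mulrA -exprS [X in X + _]mulrC -mulrS.
Qed.

Lemma fps_deriv_ev z H : z 0%N = 0 ->
  D (fps_ev z H) = fps_ev z (fps_map D H) + D z * fps_ev z (fps_deriv H).
Proof.
move=> z0; apply: fpsP => n; rewrite fpsDE.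
transitivity (D (\sum_(i < n.+2) H i * z ^+ i) n).
  by rewrite /= fps_sumE.
rewrite fps_deriv_sum fps_sumE.
under eq_bigr => i _ do rewrite fps_derivM fps_derivX fpsDE.
rewrite big_split; congr (_ + _); first by rewrite (@fps_evE _ z _ n n.+2).
rewrite -fps_sumE big_ord_recl mulr0n mulr0 add0r.
transitivity ((D z * \sum_(i < n.+1) fps_deriv H i * z ^+ i) n).
  rewrite mulr_sumr; congr (fcoef _ n); apply: eq_bigr => i _.
  by rewrite lift0 /= mulrnAr -mulrnAl; ring.
apply: fps_agreeM => // i ilen.
by rewrite fps_sumE (@fps_evE _ z _ i n.+1) // ltnS.
Qed.

Lemma fps_deriv_infl N f :
  D (fps_infl N f) = (fps_t R ^+ N.-1 * fps_infl N (D f)) *+ N.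
Proof.
apply: fpsP => n; rewrite fpsMnE fps_tXM.
case: N => [|N]; first by rewrite mulr0n; exact: mul0rn.
rewrite /=; case: ltnP => nN; first by rewrite gtnNdvd // ?mul0rn.
have -> : (N.+1 %| n.+1)%N = (N.+1 %| n - N)%N.
  by rewrite -{1}(subnKC nN) -addSn dvdn_addr.
case: ifP => [/dvdnP[q nE]|_]; last by rewrite !mul0rn.
rewrite nE mulnK //.
have -> : n.+1 = (q.+1 * N.+1)%N by lia.
by rewrite mulnK // mulrnA.
Qed.

End FpsDeriv.

(** * Hensel's lemma and Puiseux series *)

(** The coefficient n+1 of P = G H is an equation G0 v + H0 u = r whose right-hand side involves
    only earlier coefficients. [U] and [V] confine the new coefficients of G and H, and [S] the
    right-hand sides; this covers both degree bounds on polynomials and the Weierstrass division. *)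
Lemma hensel (A : comPzRingType) (P : fps A) (G0 H0 : A) (U V S : A -> Prop) :
    S 0 -> (forall a b, S a -> S b -> S (a - b)) ->
    (forall u v, U u -> V v -> S (u * v)) ->
    (forall r, S r -> exists u v, [/\ U u, V v & G0 * v + H0 * u = r]) ->
    P 0%N = G0 * H0 -> (forall j, S (P j.+1)) ->
  exists G H : fps A, [/\ G 0%N = G0, H 0%N = H0, forall j, U (G j.+1),
    forall j, V (H j.+1) & P = G * H].
Proof.
move=> S0 SB SM Sex P0 PS.
have /choice[s sP] : forall r, exists uv : A * A,
    S r -> [/\ U uv.1, V uv.2 & G0 * uv.2 + H0 * uv.1 = r].
  move=> r; have [/Sex[u [v uvP]]|nS] := pselect (S r); first by exists (u, v).
  by exists (0, 0).
(* [rest l] is the right-hand side at rank [size l], when [l] lists the pairs found so far. *)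
pose rest (l : seq (A * A)) := P (size l) - \sum_(i < (size l).-1)
  (nth (0, 0) l i.+1).1 * (nth (0, 0) l (size l - i.+1)).2.
pose fix pre n := if n is m.+1 then rcons (pre m) (s (rest (pre m))) else [:: (G0, H0)].
have size_pre n : size (pre n) = n.+1 by elim: n => //= n IH; rewrite size_rcons IH.
pose w n := nth (0, 0) (pre n) n.
have nth_pre m n : (n <= m)%N -> nth (0, 0) (pre m) n = w n.
  elim: m => [|m IH]; first by rewrite leqn0 => /eqP ->.
  rewrite leq_eqVlt => /orP[/eqP -> //|]; rewrite ltnS => nm.
  by rewrite /= nth_rcons size_pre ltnS nm IH.
have wS n : w n.+1 = s (P n.+1 - \sum_(i < n) (w i.+1).1 * (w (n - i)%N).2).
  rewrite /w /= nth_rcons size_pre ltnn eqxx /rest size_pre; congr (s (_ - _)).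
  by apply: eq_bigr => i _; rewrite !nth_pre ?subSS ?leq_subr.
have SN a : S a -> S (- a) by move=> Sa; rewrite -sub0r; exact: SB.
have SD a b : S a -> S b -> S (a + b).
  by move=> Sa Sb; rewrite -[b]opprK; apply: SB => //; exact: SN.
have key n : [/\ U (w n.+1).1, V (w n.+1).2 & G0 * (w n.+1).2 + H0 * (w n.+1).1 =
    P n.+1 - \sum_(i < n) (w i.+1).1 * (w (n - i)%N).2].
  elim/ltn_ind: n => n IH; rewrite wS; apply: sP; apply: SB => //.
  elim/big_ind: _ => // i _; apply: SM; first by have [] := IH _ (ltn_ord i).
  have [|_ + _] := IH (n - i.+1)%N; first by have := ltn_ord i; lia.
  by rewrite subnSK.
exists (FPS (fun n => (w n).1)), (FPS (fun n => (w n).2)).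
split=> // [j|j|]; try by have [] := key j.
apply: fpsP => -[|n]; rewrite fpsME /=; first by rewrite big_ord1.
rewrite big_ord_recl big_ord_recr /= subnn.
have [_ _] := key n; set sm := \sum_(i < n) _ => e.
rewrite [X in _ = _ + (X + _)](_ : _ = \sum_(i < n) (w i.+1).1 * (w (n - i)%N).2).
  rewrite /bump /= add1n subn0 addrCA [_ * (w 0%N).2]mulrC e addrC subrK //.
by [].
Qed.

Lemma fps_coef0_is_zmod (R : comPzRingType) : zmod_morphism (fun f : fps R => f 0%N).
Proof. by move=> f g; rewrite fpsBE. Qed.
Lemma fps_coef0_is_monoid (R : comPzRingType) : monoid_morphism (fun f : fps R => f 0%N).
Proof. by split=> [|f g]; rewrite ?fps1E ?fpsM0. Qed.
Definition fps_coef0 (R : comPzRingType) (f : fps R) := f 0%N.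
HB.instance Definition _ (R : comPzRingType) :=
  GRing.isZmodMorphism.Build _ _ (@fps_coef0 R) (@fps_coef0_is_zmod R).
HB.instance Definition _ (R : comPzRingType) :=
  GRing.isMonoidMorphism.Build _ _ (@fps_coef0 R) (@fps_coef0_is_monoid R).

Lemma hensel_poly (F : fieldType) (Q : {poly fps F}) (G0 H0 : {poly F}) :
    Q \is monic -> G0 \is monic -> H0 \is monic -> coprimep G0 H0 ->
    map_poly (@fps_coef0 F) Q = G0 * H0 ->
  exists G H, [/\ G \is monic, H \is monic, size G = size G0, size H = size H0
    & Q = G * H].
Proof.
move=> Qm Gm Hm cop Q0.
have G0n0 := monic_neq0 Gm; have H0n0 := monic_neq0 Hm.
set a := (size G0).-1; set b := (size H0).-1.
have sG : size G0 = a.+1 by rewrite /a prednK // size_poly_gt0.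
have sH : size H0 = b.+1 by rewrite /b prednK // size_poly_gt0.
have sQ : size Q = (a + b).+1.
  have -> : size Q = size (map_poly (@fps_coef0 F) Q).
    rewrite size_map_poly_id0 // (eqP Qm) //; exact: oner_neq0.
  by rewrite Q0 size_Mmonic // sG sH addnS.
pose P := FPS (fun j => \poly_(i < (a + b).+1) (Q`_i j)).
have PE j i : (P j)`_i = Q`_i j.
  by rewrite coef_poly; case: ltnP => // ai; rewrite nth_default ?fps0E // sQ.
have [||||||G [H [GE HE GU HV PGH]]] := @hensel _ P G0 H0
    (fun u => size u <= a)%N (fun v => size v <= b)%N (fun r => size r <= a + b)%N.
- by rewrite size_poly0.
- move=> u v su sv; rewrite (leq_trans (size_polyD _ _)) // size_polyN geq_max su sv //.
- move=> u v su sv; apply: leq_trans (size_polyMleq _ _) _; lia.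
- move=> r sr; have /Bezout_coprimepP[[v u]] := cop.
  rewrite -size_poly_eq1 => /size_poly1P[c c0] /= uv.
  pose v1 := c^-1 *: (r * v); pose u1 := c^-1 *: (r * u).
  have e1 : G0 * v1 + H0 * u1 = r.
    rewrite /v1 /u1 -!scalerAr -scalerDr.
    have -> : G0 * (r * v) + H0 * (r * u) = r * (v * G0 + u * H0) by ring.
    by rewrite uv mulrC mul_polyC scalerA mulVf // scale1r.
  (* Reducing u modulo G0 bounds its degree; the bound for v then follows from G0 v = r - H0 u. *)
  pose u2 := u1 %% G0; pose v2 := v1 + H0 * (u1 %/ G0).
  have e2 : G0 * v2 + H0 * u2 = r.
    rewrite -e1 [in RHS](divp_eq u1 G0) /v2 -/u2; ring.
  have su : (size u2 <= a)%N by rewrite -ltnS -sG ltn_modp.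
  exists u2, v2; split=> //; have [->|v0] := eqVneq v2 0; first by rewrite size_poly0.
  have : (size (G0 * v2)%R <= a + b)%N.
    have -> : G0 * v2 = r - H0 * u2 by rewrite -e2 addrK.
    rewrite (leq_trans (size_polyD _ _)) // size_polyN geq_max sr /=.
    by apply: leq_trans (size_polyMleq _ _) _; rewrite sH addSn /= addnC leq_add2r.
  by rewrite size_mul // sG addSn /= leq_add2l.
- apply/polyP => i; rewrite PE -Q0 coef_map //.
- move=> j; apply/leq_sizeP => i abi; rewrite PE.
  move: abi; rewrite leq_eqVlt => /orP[/eqP <-|abi]; last by rewrite nth_default ?fps0E // sQ.
  by have := eqP Qm; rewrite /lead_coef sQ => ->; rewrite fps1E.
have Gs j : (size (G j) <= a.+1)%N by case: j => [|j]; rewrite ?GE ?sG // (leq_trans (GU j)).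
have Hs j : (size (H j) <= b.+1)%N by case: j => [|j]; rewrite ?HE ?sH // (leq_trans (HV j)).
(* Transposition: a series in x of polynomials of bounded degree becomes a polynomial with
   coefficients in F[[x]]. *)
pose toP c (K : fps {poly F}) : {poly fps F} := \poly_(i < c.+1) FPS (fun j => (K j)`_i).
have toPE c (K : fps {poly F}) : (forall j, size (K j) <= c.+1)%N -> forall i j, (toP c K)`_i j = (K j)`_i.
  move=> sK i j; rewrite coef_poly; case: ltnP => // ci.
  by rewrite fps0E nth_default // (leq_trans (sK j)).
have lead c (K : fps {poly F}) K0 : K 0%N = K0 -> K0 \is monic -> size K0 = c.+1 ->
    (forall j, size (K j.+1) <= c)%N -> (toP c K) \is monic /\ size (toP c K) = c.+1.
  move=> KE K0m sK sKj.
  have cc : FPS (fun j => (K j)`_c) = 1.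
    apply: fpsP => -[|j] /=; last by rewrite nth_default.
    by rewrite KE; have := eqP K0m; rewrite /lead_coef sK.
  have sz : size (toP c K) = c.+1.
    rewrite size_poly_eq // cc; exact: oner_neq0.
  by split=> //; apply/eqP; rewrite /lead_coef sz coef_poly ltnSn.
have [Gmon sGG] := lead _ _ _ GE Gm sG GU; have [Hmon sHH] := lead _ _ _ HE Hm sH HV.
exists (toP a G), (toP b H); split; rewrite ?sG ?sH //.
apply/polyP => i; apply: fpsP => j; rewrite -PE PGH coefM fps_sumE fpsME coef_sum.
under eq_bigr do rewrite coefM; rewrite exchange_big; apply: eq_bigr => l _.
by rewrite fpsME; apply: eq_bigr => c _; rewrite !toPE.
Qed.

Section Puiseux.
Variable F : numClosedFieldType.
Implicit Types P Q : {poly fps F}.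

(** Splitting over F[[x^(1/N)]]; fractional powers are avoided by replacing x by x^N. *)
Definition fps_splits N P :=
  exists zs : seq (fps F), map_poly (@fps_infl F N) P = \prod_(z <- zs) ('X - z%:P).

Lemma fps_splits_infl M N P : (0 < M)%N -> fps_splits N P -> fps_splits (M * N) P.
Proof.
move=> M0 [zs zsE]; exists [seq fps_infl M z | z <- zs].
transitivity (map_poly (@fps_infl F M) (map_poly (@fps_infl F N) P)).
  by apply/polyP => i; rewrite !coef_map /= fps_infl_infl.
rewrite zsE rmorph_prod big_map; apply: eq_bigr => z _.
by rewrite rmorphB /= map_polyX map_polyC.
Qed.

Lemma fps_splitsM N P Q : fps_splits N P -> fps_splits N Q -> fps_splits N (P * Q).
Proof. by move=> [zs zE] [ws wE]; exists (zs ++ ws); rewrite rmorphM /= zE wE big_cat. Qed.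

Lemma coef_XaddC_exp (R : comNzRingType) (c : R) n :
  (('X + c%:P) ^+ n)`_n.-1 = if n is 0 then 1 else c *+ n.
Proof.
have mon m : (('X + c%:P) ^+ m)`_m = 1.
  have mm : ('X + c%:P) ^+ m \is monic by rewrite monic_exp // -[c]opprK polyCN monicXsubC.
  have := eqP mm; rewrite /lead_coef.
  by rewrite -[c]opprK polyCN size_exp_XsubC.
case: n => [|n]; first by rewrite expr0 coef1.
elim: n => [|n IH]; first by rewrite expr1 coefD coefX coefC add0r mulr1n.
rewrite exprS mulrDl coefD coefXM coefCM /= mon mulr1.
by move: IH => /= ->; rewrite -mulrSr.
Qed.

Lemma coef_comp_scaleX (R : comNzRingType) (P : {poly R}) (x : R) j :
  (P \Po (x *: 'X))`_j = P`_j * x ^+ j.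
Proof.
have -> : P \Po (x *: 'X) = \poly_(i < size P) (P`_i * x ^+ i).
  by rewrite comp_polyE poly_def; apply: eq_bigr => i _; rewrite exprZn scalerA.
by rewrite coef_poly; case: ltnP => // Pj; rewrite nth_default ?mul0r.
Qed.

Lemma tschirnhaus (R : comNzRingType) (P : {poly R}) (c : R) n : P \is monic -> size P = n.+2 ->
  (P \Po ('X + c%:P))`_n = P`_n + c *+ n.+1.
Proof.
move=> Pm sP.
have Pn : P`_n.+1 = 1 by have := eqP Pm; rewrite /lead_coef sP.
rewrite comp_polyE sP coef_sum big_ord_recr big_ord_recr /= !coefZ Pn mul1r.
rewrite (coef_XaddC_exp c n.+1) big1 ?add0r => [|i _].
  congr (_ + _).
  have -> : (('X + c%:P) ^+ n)`_n = 1; last by rewrite mulr1.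
  have mm : ('X + c%:P) ^+ n \is monic by rewrite monic_exp // -[c]opprK polyCN monicXsubC.
  by have := eqP mm; rewrite /lead_coef -[c]opprK polyCN size_exp_XsubC.
by rewrite coefZ [X in _ * X]nth_default ?mulr0 // -[c]opprK polyCN size_exp_XsubC.
Qed.

Lemma fps_dvd_infl N f k : fps_dvd k f -> (0 < N)%N -> fps_dvd (N * k) (@fps_infl F N f).
Proof.
move=> fk N0 i ik; rewrite fps_inflE; case: ifP => // /dvdnP[q iE].
by rewrite iE mulnK //; apply: fk; move: ik; rewrite iE mulnC ltn_pmul2l.
Qed.

(* Newton polygon step: after the substitutions x -> x^q and T -> x^d T the
   reduction modulo x is no longer a power of T. *)
Lemma newton_step n (A : {poly fps F}) : A \is monic -> size A = n.+1 -> A != 'X^n ->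
  exists q d Q i, [/\ (0 < q)%N, Q \is monic, size Q = n.+1, (i < n)%N /\ Q`_i 0%N != 0 &
    forall j, (j <= n)%N -> fps_infl q A`_j = fps_t F ^+ (d * (n - j)) * Q`_j].
Proof.
move=> Am sA AX.
have An : A`_n = 1 by have := eqP Am; rewrite /lead_coef sA.
have [i0 Ai0] : exists i : 'I_n, A`_i != 0.
  apply: contrapT => nex; case/eqP: AX; apply/polyP => i; rewrite coefXn.
  case: (ltngtP i n) => [ilt|igt|->] //; last by rewrite nth_default ?sA.
  by apply/eqP; apply: contrapT => /negP Ai; apply: nex; exists (Ordinal ilt).
have /choice[o oP] : forall i : nat, exists k, A`_i != 0 -> fps_ord A`_i k.
  by move=> i; have [Ai|/fps_ord_ex[k kP]] := eqVneq A`_i 0; [by exists 0%N => /eqP|by exists k].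
(* The slope o_i / (n - i) of the Newton polygon, multiplied by n! to become an integer. *)
pose v (i : 'I_n) := (o i * (n`! %/ (n - i)))%N.
have [i Ai imin] := @arg_minnP _ i0 (fun i : 'I_n => A`_i != 0) v Ai0.
have slope j : (j < n)%N -> A`_j != 0 -> (o i * (n - j) <= o j * (n - i))%N.
  move=> jn Aj; have := imin (Ordinal jn) Aj; rewrite /v /=.
  have di : (n - i %| n`!)%N by rewrite dvdn_fact // subn_gt0 ltn_ord leq_subr.
  have dj : (n - j %| n`!)%N by rewrite dvdn_fact // subn_gt0 jn leq_subr.
  have f0 := fact_gt0 n.
  move: (dvdnP di) (dvdnP dj) => [u uE] [w wE].
  have ni : (0 < n - i)%N by rewrite subn_gt0.
  have nj : (0 < n - j)%N by rewrite subn_gt0.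
  rewrite {1}uE wE !mulnK // => le1.
  have w0 : (0 < w)%N by move: f0; rewrite wE; case: (w).
  rewrite -(leq_pmul2l w0).
  have -> : (w * (o i * (n - j)) = o i * u * (n - i))%N by rewrite mulnCA -wE uE mulnA.
  by rewrite mulnA (leq_mul _ (leqnn _)) // [leqRHS]mulnC.
(* With q = n - i, the minimality of the slope reads q o_j >= o_i (n - j): after x -> x^q the
   coefficient j is divisible by x^(o_i (n - j)), and exactly by this power at j = i. *)
pose q := (n - i)%N; have q0 : (0 < q)%N by rewrite subn_gt0.
have /choice[Qf QfP] : forall j : nat, exists g, (j <= n)%N ->
    fps_infl q A`_j = fps_t F ^+ (o i * (n - j)) * g.
  move=> j; have [jn|jn] := leqP j n; last by exists 0.
  have [g gE] : exists g, fps_infl q A`_j = fps_t F ^+ (o i * (n - j)) * g.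
    apply/fps_dvdtP; have [->|Aj] := eqVneq A`_j 0.
      by rewrite raddf0 => ? _; rewrite fps0E.
    move: jn; rewrite leq_eqVlt => /orP[/eqP ->|jn]; first by rewrite subnn muln0.
    have [_ ojP] := oP j Aj.
    by apply: fps_dvdW (fps_dvd_infl ojP q0); rewrite [leqRHS]mulnC slope.
  by exists g.
exists q, (o i), (\poly_(j < n.+1) Qf j), i.
have Qn : Qf n = 1.
  have := QfP n (leqnn n); rewrite An subnn muln0 expr0 mul1r => <-; exact: rmorph1.
have sQ : size (\poly_(j < n.+1) Qf j) = n.+1 by rewrite size_poly_eq // Qn oner_neq0.
split=> //.
- by apply/eqP; rewrite /lead_coef sQ coef_poly ltnSn.
- split=> //; rewrite coef_poly ltnS ltnW //.
  have [+ _] := fps_infl_ord (oP i Ai) q0.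
  by rewrite QfP 1?ltnW // fps_tXM mulnC ltnn subnn.
- by move=> j jn; rewrite coef_poly ltnS jn QfP.
Qed.

(** Induction on the degree. The coefficient below the leading one is made 0, so that after a Newton
    step the reduction modulo x is neither a power of T nor, in characteristic 0, a power of another
    T - r. It then has coprime factors of smaller degree, which Hensel's lemma lifts. *)
Theorem puiseux P : P \is monic -> exists2 N, (0 < N)%N & fps_splits N P.
Proof.
have [n] := ubnP (size P); elim: n P => // n IH P sP Pm.
have [n0|[m sPm]] : size P = 1%N \/ exists m, size P = m.+2.
  by case: (size P) (size_poly_gt0 P) => [|[|m]]; rewrite ?(monic_neq0 Pm) //; [left|right; exists m].
  exists 1%N => //; exists [::]; rewrite big_nil.
  by move: Pm; rewrite monicE /lead_coef n0 => /eqP P0; rewrite [P]size1_polyC ?n0 // P0 rmorph1.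
pose c : fps F := - (fpsC (m.+1%:R^-1) * P`_m).
pose A := P \Po ('X + c%:P).
have Am : A \is monic.
  apply/eqP; rewrite lead_coef_comp.
    by rewrite (eqP Pm) mul1r -[c]opprK polyCN lead_coefXsubC expr1n.
  by rewrite -[c]opprK polyCN size_XsubC.
have sA : size A = m.+2.
  by rewrite size_comp_poly2 // -[c]opprK polyCN size_XsubC.
have Am0 : A`_m = 0.
  rewrite (tschirnhaus c Pm sPm) /c mulNrn -[X in _ - X]mulr_natr.
  have -> : (m.+1%:R : fps F) = fpsC m.+1%:R by rewrite rmorph_nat.
  by rewrite mulrAC -rmorphM mulVf ?pnatr_eq0 // rmorph1 mul1r subrr.
suff [N N0 [zs zsE]] : exists2 N, (0 < N)%N & fps_splits N A.
  exists N => //; exists [seq z + fps_infl N c | z <- zs].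
  have -> : P = A \Po ('X - c%:P).
    by rewrite /A -comp_polyA comp_polyD comp_polyX comp_polyC subrK comp_polyXr.
  rewrite map_comp_poly rmorphB /= map_polyX map_polyC /= zsE big_map.
  rewrite rmorph_prod; apply: eq_bigr => z _.
  by rewrite rmorphB /= comp_polyX comp_polyC polyCD opprD [- _ - _]addrC addrA.
have [AX|AX] := eqVneq A 'X^(m.+1).
  exists 1%N => //; exists (nseq m.+1 0); rewrite big_nseq subr0 iter_mulr_1 AX.
  by rewrite rmorphXn /= map_polyX.
have [q [d [Q [i [q0 Qm sQ [im Qi] QE]]]]] := newton_step Am sA AX.
have Qm0 : Q`_m = 0.
  have := QE m (leqnSn m); rewrite Am0 raddf0 => /esym/eqP.
  by rewrite mulf_eq0 expf_eq0 (negbTE (fps_t_neq0 F)) andbF => /eqP.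
pose Q0 := map_poly (@fps_coef0 F) Q.
have sQ0 : size Q0 = m.+2 by rewrite size_map_poly_id0 // (eqP Qm) oner_neq0.
have Q0m : Q0 \is monic by rewrite monic_map.
have /closed_rootP[r rQ0] : size Q0 != 1%N by rewrite sQ0.
have [e [H0 /implyP H0r Q0E]] := multiplicity_XsubC Q0 r.
have {}H0r := H0r (monic_neq0 Q0m).
have XM : ('X - r%:P) ^+ e \is monic by rewrite monic_exp // monicXsubC.
have H0m : H0 \is monic by move: Q0m; rewrite Q0E monicMr.
have sH0 : (size H0 + e = m.+2)%N.
  rewrite -sQ0 Q0E size_Mmonic ?monic_neq0 // size_exp_XsubC addnS //.
have e0 : (0 < e)%N.
  by case: e Q0E {XM sH0} => // Q0E; move: H0r; rewrite -[H0]mulr1 -(expr0 ('X - r%:P)) -Q0E rQ0.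
(* If r were the only root, the vanishing coefficient -(m+1) r would force r = 0, and then Q_i(0) =
   0. *)
have sH1 : (1 < size H0)%N.
  rewrite ltn_neqAle eq_sym size_poly_gt0 (monic_neq0 H0m) andbT; apply/negP => /eqP H1.
  have H01 : H0 = 1.
    by move: H0m; rewrite monicE /lead_coef H1 => /eqP P0; rewrite [H0]size1_polyC ?H1 // P0.
  have eE : e = m.+1 by move: sH0; rewrite H1 => -[].
  have : Q0`_m = 0 by rewrite coef_map /= Qm0.
  rewrite Q0E H01 mul1r eE -[r]opprK polyCN opprK (coef_XaddC_exp (- r) m.+1).
  move/eqP; rewrite -mulr_natr mulf_eq0 pnatr_eq0 orbF oppr_eq0 => /eqP r0.
  have : Q0`_i = 0 by rewrite Q0E H01 mul1r r0 polyC0 subr0 eE coefXn ltn_eqF.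
  by rewrite coef_map => /eqP; rewrite (negbTE Qi).
have [G [H [Gm Hm sG sH QGH]]] : exists G H, [/\ G \is monic, H \is monic,
    size G = size (('X - r%:P) ^+ e), size H = size H0 & Q = G * H].
  apply: hensel_poly => //; last by rewrite -/Q0 Q0E mulrC.
  by rewrite coprimep_expl // coprimep_sym coprimep_XsubC.
rewrite size_exp_XsubC in sG.
have [||N1 N10 GS] := IH G => //; first by move: sP sH0 sH1; rewrite sPm sG; clear; lia.
have [||N2 N20 HS] := IH H => //; first by move: sP sH0 e0; rewrite sPm sH; clear; lia.
have [zs zsE] : fps_splits (N1 * N2) Q.
  rewrite QGH; apply: fps_splitsM; last exact: fps_splits_infl.
  by rewrite mulnC; exact: fps_splits_infl.
pose N := (N1 * N2)%N; have N0 : (0 < N)%N by rewrite muln_gt0 N10.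
exists (N * q)%N; first by rewrite muln_gt0 N0.
pose x := fps_t F ^+ (N * d); have x0 : x != 0 by rewrite expf_neq0 // fps_t_neq0.
exists [seq x * z | z <- zs]; rewrite big_map.
have szs : size zs = m.+1.
  have : size (map_poly (@fps_infl F N) Q) = m.+2.
    by rewrite size_map_poly_id0 // (eqP Qm) rmorph1 oner_neq0.
  by rewrite zsE size_prod_XsubC => -[].
(* Both sides are compared after T -> x T, with the power x of t just introduced; this undoes the
   scaling of the Newton step. *)
have compI (B C : {poly fps F}) : B \Po (x *: 'X) = C \Po (x *: 'X) -> B = C.
  move=> /polyP BC; apply/polyP => j; have := BC j.
  by rewrite !coef_comp_scaleX => /mulIf; apply; rewrite expf_neq0.
apply: compI; transitivity (x ^+ m.+1 *: map_poly (@fps_infl F N) Q).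
  apply/polyP => j; rewrite coef_comp_scaleX coefZ !coef_map /=.
  rewrite -fps_infl_infl //; have [jm|jm] := leqP j m.+1; last first.
    by rewrite !nth_default ?sA ?sQ // !raddf0 mul0r mulr0.
  rewrite QE // rmorphM rmorphXn /= fps_infl_t // /x -!exprM mulrAC -exprD.
  by have -> : (N * (d * (m.+1 - j)) + N * d * j = N * d * m.+1)%N by rewrite -!mulnA -!mulnDr subnK.
have sc (s : seq (fps F)) (K : fps F -> {poly fps F}) :
    x ^+ size s *: \prod_(z <- s) K z = \prod_(z <- s) (x *: K z).
  elim: s => [|z s IHs]; first by rewrite !big_nil scale1r.
  by rewrite !big_cons -IHs exprS -scalerAl -scalerAr scalerA.
rewrite zsE -szs sc rmorph_prod /=.
apply: eq_bigr => z _; rewrite rmorphB /= comp_polyX comp_polyC.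
by rewrite polyCM mul_polyC scalerBr.
Qed.

End Puiseux.

(** * Weierstrass preparation and the codimension of an ideal with two generators *)

Section FpsSwap.
Variable R : comPzRingType.

Definition fps_swap (f : fps (fps R)) : fps (fps R) := FPS (fun i => FPS (fun j => f j i)).

Lemma fps_swapM f g : fps_swap (f * g) = fps_swap f * fps_swap g.
Proof.
apply: fpsP => i; apply: fpsP => j.
rewrite [RHS](_ : _ = \sum_(b < i.+1) \sum_(a < j.+1) f a b * g (j - a)%N (i - b)%N).
  rewrite exchange_big [LHS](_ : _ = (f * g) j i) // fpsME fps_sumE.
  by apply: eq_bigr => a _; rewrite fpsME.
by rewrite fpsME fps_sumE; apply: eq_bigr => b _; rewrite fpsME.
Qed.

Lemma fps_swapK : involutive fps_swap.
Proof. by move=> f; apply: fpsP => i; apply: fpsP => j. Qed.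

End FpsSwap.

Section FpsOfPoly.
Variable R : comNzRingType.

Definition fps_of_poly (p : {poly R}) : fps R := FPS (fun i => p`_i).

Lemma fps_of_poly_is_zmod : zmod_morphism fps_of_poly.
Proof. by move=> p q; apply: fpsP => i; rewrite fpsBE /= coefB. Qed.

Lemma fps_of_poly_is_monoid : monoid_morphism fps_of_poly.
Proof.
split=> [|p q]; apply: fpsP => i; first by rewrite fps1E /= coef1.
by rewrite fpsME /= coefM.
Qed.

HB.instance Definition _ := GRing.isZmodMorphism.Build _ _ fps_of_poly fps_of_poly_is_zmod.
HB.instance Definition _ := GRing.isMonoidMorphism.Build _ _ fps_of_poly fps_of_poly_is_monoid.

Lemma fps_of_poly_XsubC z : fps_of_poly ('X - z%:P) = fps_t R - fpsC z.
Proof.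
apply: fpsP => i; rewrite fpsBE [LHS]/= coefB coefX coefC fpsCE.
by congr (_ - _); case: i => [|[|i]].
Qed.

End FpsOfPoly.

Section Weierstrass.
Variable F : numClosedFieldType.

(** Hensel's lemma in the other variable: f is read as a series in x over F[[y]], and f(0, y) = y^n
    h0 with h0 a unit. The corrections to y^n are confined to degree below n, so the first factor is
    a monic polynomial in y. *)
Lemma weierstrass_preparation (f : fps2 F) n : fps_ord (fps_map (@fps_coef0 F) f) n ->
  exists (W : {poly fps F}) (u : fps2 F), [/\ W \is monic, size W = n.+1,
    forall i, (i < n)%N -> W`_i 0%N = 0, u 0%N 0%N != 0 & f = fps_of_poly W * u].
Proof.
move=> /fps_ordP[h0 h00 f0E].
have h0u : h0 \is a GRing.unit by rewrite fps_unitE unitfE.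
have [||||||G [H [GE HE GU _ fE]]] := @hensel _ (fps_swap f) (fps_t F ^+ n) h0
    (fun u => forall i, (n <= i)%N -> u i = 0) (fun=> True) (fun=> True) => //.
(* Solves y^n v + h0 u = r with u of degree below n: r is divided by h0 and the quotient is cut at
   degree n. *)
- move=> r _; pose q := r / h0; pose w := FPS (fun i => q (n + i)%N).
  pose u := FPS (fun i => if (i < n)%N then q i else 0).
  have qE : q = u + fps_t F ^+ n * w.
    apply: fpsP => i; rewrite fpsDE fps_tXM /=; case: ltnP => ni; first by rewrite addr0.
    by rewrite add0r subnKC.
  exists u, (h0 * w); split=> //; first by move=> i /=; rewrite leqNgt => /negbTE ->.
  by rewrite mulrCA -mulrDr addrC -qE mulrC /q mulrVK.
pose W : {poly fps F} := \poly_(i < n.+1) FPS (fun j => G j i).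
have WE i j : W`_i j = G j i.
  rewrite coef_poly; case: ltnP => // ni; rewrite fps0E.
  by case: j => [|j]; rewrite ?GU 1?ltnW // GE fps_tXE gtn_eqF.
have Wn : W`_n = 1.
  apply: fpsP => -[|j]; rewrite WE fps1E; first by rewrite GE fps_tXE eqxx.
  by rewrite GU.
have sW : size W = n.+1.
  by rewrite size_poly_eq //; have := Wn; rewrite coef_poly ltnSn => ->; exact: oner_neq0.
exists W, (fps_swap H); split=> //.
- by apply/eqP; rewrite /lead_coef sW.
- by move=> i ni; rewrite WE GE fps_tXE ltn_eqF.
- by rewrite [X in X != 0](_ : _ = H 0%N 0%N) // HE.
rewrite -[LHS]fps_swapK fE fps_swapM; congr (_ * _).
by apply: fpsP => i; apply: fpsP => j; rewrite [RHS]WE.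
Qed.

Theorem regular_series_roots (f : fps2 F) n : fps_ord (fps_map (@fps_coef0 F) f) n ->
  exists N (zs : seq (fps F)) (u : fps2 F), [/\ (0 < N)%N, size zs = n,
    forall z, z \in zs -> z 0%N = 0, u 0%N 0%N != 0 &
    fps_map (@fps_infl F N) f = u * \prod_(z <- zs) (fps_t _ - fpsC z)].
Proof.
move=> /weierstrass_preparation[W [u [Wm sW W0 u0 ->]]].
have [N N0 [zs zsE]] := puiseux Wm.
have szs : size zs = n.
  have : size (map_poly (@fps_infl F N) W) = n.+1.
    by rewrite size_map_poly_id0 // (eqP Wm) rmorph1 oner_neq0.
  by rewrite zsE size_prod_XsubC => -[].
exists N, zs, (fps_map (@fps_infl F N) u); split=> //.
(* At x = 0 the polynomial reduces to T^n, so its roots have no constant term. *)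
- move=> z zzs; have : map_poly (@fps_coef0 F) (map_poly (@fps_infl F N) W) = 'X^n.
    apply/polyP => i; rewrite !coef_map coefXn.
    rewrite [LHS](_ : _ = fps_infl N W`_i 0%N) // fps_infl_coef0.
    case: (ltngtP i n) => [/W0 //|ni|->]; first by rewrite nth_default ?fps0E // sW.
    by have := eqP Wm; rewrite /lead_coef sW => ->; rewrite fps1E.
  rewrite zsE rmorph_prod => /(congr1 (fun p => p.[z 0%N])).
  rewrite hornerXn (big_rem z) //= rmorphB /= map_polyX map_polyC hornerM !hornerE /=.
  rewrite [fps_coef0 z](erefl : _ = z 0%N) subrr mul0r => /esym/eqP.
  by rewrite expf_eq0 => /andP[_ /eqP].
- by rewrite fps_mapE fps_infl_coef0.
rewrite rmorphM mulrC; congr (_ * _).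
transitivity (fps_of_poly (map_poly (@fps_infl F N) W)).
  by apply: fpsP => i; rewrite fps_mapE /= coef_map.
by rewrite zsE rmorph_prod; apply: eq_bigr => z _; rewrite /= fps_of_poly_XsubC.
Qed.

End Weierstrass.

Section Codim.
Variable F : numClosedFieldType.
Implicit Types (a b g h u v w : fps2 F).
Local Notation sc c := (fpsC (fpsC c) : fps2 F).

Definition in_ideal2 a b h := exists u v, h = u * a + v * b.

Lemma in_ideal2_0 a b : in_ideal2 a b 0.
Proof. by exists 0, 0; rewrite !mul0r addr0. Qed.

Lemma in_ideal2D a b h h' : in_ideal2 a b h -> in_ideal2 a b h' -> in_ideal2 a b (h + h').
Proof. by move=> [u [v ->]] [u' [v' ->]]; exists (u + u'), (v + v'); ring. Qed.

Lemma in_ideal2M a b w h : in_ideal2 a b h -> in_ideal2 a b (w * h).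
Proof. by move=> [u [v ->]]; exists (w * u), (w * v); ring. Qed.

Lemma in_ideal2_sum a b (I : finType) (G : I -> fps2 F) :
  (forall i, in_ideal2 a b (G i)) -> in_ideal2 a b (\sum_i G i).
Proof.
by move=> Gi; elim/big_ind: _ => //; [exact: in_ideal2_0|exact: in_ideal2D].
Qed.

Definition quo_span a b (I : finType) (e : I -> fps2 F) :=
  forall h, exists c : I -> F, in_ideal2 a b (h - \sum_i sc (c i) * e i).
Definition quo_free a b (I : finType) (e : I -> fps2 F) :=
  forall c : I -> F, in_ideal2 a b (\sum_i sc (c i) * e i) -> forall i, c i = 0.

Lemma ideal2_codim_quo a b n : ideal2_codim a b n ->
  exists e : 'I_n -> fps2 F, quo_span a b e /\ quo_free a b e.
Proof.
move=> [e eP]; exists e; split=> [h|c ch i].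
  have [c [[u [v hE]] _]] := eP h; exists (fun i => c 0 i); exists u, v.
  by rewrite hE addrC addKr.
have [c0 [_ c0u]] := eP 0.
have e1 := c0u (\row_i 0); have e2 := c0u (\row_i - c i).
have : \row_i 0 = \row_i - c i :> 'rV_n.
  rewrite -e1 ?e2 //.
    have [u [v E]] := ch; exists u, v; rewrite -E -big_split /= big1 // => j _.
    by rewrite mxE !rmorphN mulNr addNr.
  exists 0, 0; rewrite !mul0r addr0 addr0 big1 // => j _.
  by rewrite mxE !rmorph0 mul0r.
by move=> /rowP/(_ i); rewrite !mxE => /esym/eqP; rewrite oppr_eq0 => /eqP.
Qed.

Lemma quo_ideal2_codim a b (I : finType) (e : I -> fps2 F) :
  quo_span a b e -> quo_free a b e -> ideal2_codim a b #|I|.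
Proof.
move=> sp fr; exists (fun i => e (enum_val i)) => h.
have sumE (c : I -> F) : \sum_i sc (c i) * e i =
    \sum_(i < #|I|) sc (c (enum_val i)) * e (enum_val i).
  by rewrite (reindex (@enum_val I predT)) //; apply: onW_bij; exact: enum_val_bij.
have [c [u [v E]]] := sp h; exists (\row_i c (enum_val i)); split.
  exists u, v; rewrite -E sumE addrC.
  under [X in _ - _ + X]eq_bigr do rewrite mxE.
  by rewrite subrK.
move=> c' [u' [v' E']]; apply/rowP => i; rewrite mxE; apply/eqP; rewrite -subr_eq0; apply/eqP.
rewrite -(enum_valK i) in E' *.
pose d j := c j - c' 0 (enum_rank j).
suff /(_ (enum_val i)) : forall j, d j = 0 by rewrite /d !enum_valK.
apply: fr; exists (u' - u), (v' - v).
transitivity (\sum_i sc (c i) * e i - \sum_i sc (c' 0 (enum_rank i)) * e i).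
  by rewrite -sumrB; apply: eq_bigr => j _; rewrite /d !rmorphB mulrBl.
rewrite [X in _ - X]sumE; under [X in _ - X]eq_bigr do rewrite enum_valK.
have -> : \sum_i sc (c i) * e i = h - (u * a + v * b) by rewrite -E subKr.
rewrite {1}E'; ring.
Qed.

Lemma ideal2_codim_ext a b a' b' n :
  (forall h, in_ideal2 a b h <-> in_ideal2 a' b' h) -> ideal2_codim a b n -> ideal2_codim a' b' n.
Proof.
move=> eqI /ideal2_codim_quo[e [sp fr]]; rewrite -[n]card_ord.
apply: (@quo_ideal2_codim _ _ _ e) => [h|c /eqI]; last exact: fr.
by have [c /eqI] := sp h; exists c.
Qed.

Lemma ideal2_codimC a b n : ideal2_codim a b n -> ideal2_codim b a n.
Proof.
apply: ideal2_codim_ext => h.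
by split=> -[u [v ->]]; exists v, u; rewrite addrC.
Qed.

(** Steinitz: a kernel vector of the matrix expressing [e] through [e'] would be a relation among
    the members of [e]. *)
Lemma quo_free_le a b n m (e : 'I_n -> fps2 F) (e' : 'I_m -> fps2 F) :
  quo_free a b e -> quo_span a b e' -> (n <= m)%N.
Proof.
move=> fr sp; have /choice[A AP] : forall i, exists c : 'I_m -> F,
    in_ideal2 a b (e i - \sum_j sc (c j) * e' j) by move=> i; exact: sp.
pose M := \matrix_(i, j) A i j; have ME i j : M i j = A i j by rewrite mxE.
suff : row_free M by rewrite /row_free => /eqP <-; exact: rank_leq_col.
rewrite -kermx_eq0; apply/eqP/row_matrixP => i; rewrite row0.
set r := row i _; have rM : r *m M = 0 by apply/sub_kermxP; exact: row_sub.
apply/rowP => j; rewrite [RHS]mxE; apply: fr (fun j => r 0 j) _ j.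
have -> : \sum_j sc (r 0 j) * e j =
    \sum_j sc (r 0 j) * (e j - \sum_l sc (A j l) * e' l).
  under [RHS]eq_bigr do rewrite mulrBr; rewrite sumrB.
  suff -> : \sum_j sc (r 0 j) * (\sum_l sc (A j l) * e' l) = 0 by rewrite subr0.
  under eq_bigr do rewrite mulr_sumr; rewrite exchange_big big1 // => l _.
  under eq_bigr do rewrite mulrA -!rmorphM; rewrite -mulr_suml -!rmorph_sum /=.
  have := congr1 (fun x : 'rV_m => x 0 l) rM; rewrite !mxE.
  rewrite [LHS](eq_bigr (fun j => r 0 j * A j l)) => [->|j _]; last by rewrite ME.
  by rewrite !rmorph0 mul0r.
by apply: in_ideal2_sum => j'; apply: in_ideal2M.
Qed.

Lemma ideal2_codim_uniq a b n m : ideal2_codim a b n -> ideal2_codim a b m -> n = m.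
Proof.
move=> /ideal2_codim_quo[e [sp fr]] /ideal2_codim_quo[e' [sp' fr']].
by apply/eqP; rewrite eqn_leq (quo_free_le fr sp') (quo_free_le fr' sp).
Qed.

(** Exact sequence 0 -> A/(g2, h) -> A/(g1 g2, h) -> A/(g1, h) -> 0 with A = F[[x, y]], whose first
    map is multiplication by g1; it is injective as g1 is not a zero divisor modulo h. *)
Lemma ideal2_codimM g1 g2 h n1 n2 :
    (forall w v, g1 * w = v * h -> exists w', w = w' * h) ->
  ideal2_codim g1 h n1 -> ideal2_codim g2 h n2 -> ideal2_codim (g1 * g2) h (n1 + n2).
Proof.
move=> nzd /ideal2_codim_quo[e1 [sp1 fr1]] /ideal2_codim_quo[e2 [sp2 fr2]].
have -> : (n1 + n2)%N = #|{: 'I_n1 + 'I_n2}| by rewrite card_sum !card_ord.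
pose e (i : 'I_n1 + 'I_n2) := match i with inl i => e1 i | inr i => g1 * e2 i end.
apply: (@quo_ideal2_codim _ _ _ e) => [k|c]; last first.
  rewrite big_sumType /= => -[u [v E]].
  have c1 : forall i, c (inl i) = 0.
    apply: (fr1 (fun i => c (inl i))).
    exists (u * g2 - \sum_i sc (c (inr i)) * e2 i), v.
    rewrite mulrBl mulr_suml; under [X in _ - X]eq_bigr do rewrite -mulrA [e2 _ * _]mulrC.
    rewrite addrAC; apply/(canRL (addrK _)); rewrite E; ring.
  rewrite big1 ?add0r in E; last by move=> i _; rewrite c1 !rmorph0 mul0r.
  case=> [//|]; apply: (fr2 (fun i => c (inr i))).
  have [w' wE] : exists w', \sum_i sc (c (inr i)) * e2 i - u * g2 = w' * h.
    apply: (nzd _ v); rewrite mulrBr mulr_sumr.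
    under eq_bigr do rewrite mulrCA.
    by rewrite E; ring.
  by exists u, w'; rewrite -wE addrC subrK.
have [c1 [u [v E1]]] := sp1 k; have [c2 [u' [v' E2]]] := sp2 u.
exists (fun i => match i with inl i => c1 i | inr i => c2 i end).
exists u', (v + g1 * v'); rewrite big_sumType /= opprD addrA E1.
have -> : \sum_i sc (c2 i) * (g1 * e2 i) = g1 * (\sum_i sc (c2 i) * e2 i).
  by rewrite mulr_sumr; apply: eq_bigr => i _; rewrite mulrCA.
move/eqP: E2; rewrite subr_eq => /eqP ->; ring.
Qed.

Lemma ideal2_codim1 u h : u 0%N 0%N != 0 -> ideal2_codim u h 0.
Proof.
move=> u0; have uu : u \is a GRing.unit by rewrite !fps_unitE unitfE.
have -> : 0%N = #|'I_0| by rewrite card_ord.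
apply: (@quo_ideal2_codim _ _ _ (fun=> 0)) => [k|c _ []//].
exists (fun=> 0); rewrite big_ord0 subr0; exists (k / u), 0.
by rewrite mulrVK // mul0r addr0.
Qed.

(** Evaluation at y = z identifies the quotient by y - z with F[[x]], where h becomes x^n times a
    unit. *)
Lemma ideal2_codim_linear (z : fps F) h n : z 0%N = 0 -> fps_ord (fps_ev z h) n ->
  ideal2_codim (fps_t _ - fpsC z) h n.
Proof.
move=> z0 [hn hn0]; rewrite -[n]card_ord.
have evL w : fps_ev z (w * (fps_t _ - fpsC z)) = 0.
  by rewrite fps_evM // raddfB /= fps_ev_t // fps_evC subrr mulr0.
have /fps_ordP[k k0 hE] : fps_ord (fps_ev z h) n by split.
apply: (@quo_ideal2_codim _ _ _ (fun i : 'I_n => fpsC (fps_t F ^+ i))) => [w|c [u [v E]] i].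
  pose r := fps_ev z w; exists (fun i : 'I_n => r i).
  have [Q wE] := fps_ev_sub w z0; have [Q' hE'] := fps_ev_sub h z0.
  pose s : fps F := FPS (fun i => r (n + i)%N) / k.
  exists (Q - Q' * fpsC s), (fpsC s).
  have rE : r = \sum_(i < n) fpsC (r i) * fps_t _ ^+ i + fps_t _ ^+ n * (s * k).
    rewrite /s mulrVK; last by rewrite fps_unitE unitfE.
    exact: fps_split.
  rewrite [X in _ = _ + _ * X]hE' {1}wE -/r {1}rE.
  rewrite rmorphD rmorph_sum rmorphM /=.
  under [X in _ - X]eq_bigr do rewrite -rmorphM /=.
  by rewrite hE !rmorphM /= !rmorphXn /=; ring.
have := congr1 (fps_ev z) E; rewrite fps_evD evL add0r fps_evM // hE.
rewrite fps_ev_sum => /(congr1 (fun f : fps F => f i)).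
rewrite mulrCA fps_tXM ltn_ord fps_sumE => <-.
have evE (j : 'I_n) : fps_ev z (sc (c j) * fpsC (fps_t F ^+ j)) i = c j * (i == j)%:R.
  by rewrite -(rmorphM (@fpsC _)) fps_evC fpsCM fps_tXE.
rewrite (bigD1 i) // [X in _ = _ + X]big1; last first.
  by move=> j ji; rewrite evE eq_sym (negbTE ji) mulr0.
by rewrite addr0 evE eqxx mulr1.
Qed.

(** Halphen's formula for intersection multiplicities. Since h does not vanish at z, y - z is not a
    zero divisor modulo h and [ideal2_codimM] applies. *)
Lemma ideal2_codim_prod u (zs : seq (fps F)) (p : fps F -> nat) h : u 0%N 0%N != 0 ->
    (forall z, z \in zs -> z 0%N = 0 /\ fps_ord (fps_ev z h) (p z)) ->
  ideal2_codim (u * \prod_(z <- zs) (fps_t _ - fpsC z)) h (\sum_(z <- zs) p z)%N.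
Proof.
move=> u0; elim: zs => [|z zs IH] zsP; first by rewrite !big_nil mulr1; exact: ideal2_codim1.
have [z0 pz] := zsP z (mem_head _ _).
rewrite !big_cons mulrCA; apply: ideal2_codimM.
- move=> w v E.
  have : fps_ev z v * fps_ev z h = 0.
    rewrite -fps_evM // -E fps_evM // raddfB /= fps_ev_t // fps_evC subrr mul0r //.
  move/eqP; rewrite mulf_eq0 (negbTE (fps_ord_neq0 pz)) orbF => /eqP v0.
  have [Q vE] := fps_ev_sub v z0; exists Q.
  have tz : fps_t (fps F) - fpsC z != 0.
    apply/eqP => /(congr1 (fun f : fps2 F => f 1%N)); rewrite fpsBE fpsCE fps0E subr0 /=.
    by apply/eqP; exact: oner_neq0.
  by apply: (mulfI tz); rewrite E vE v0 rmorph0 addr0 mulrA.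
- exact: ideal2_codim_linear.
- by apply: IH => w wz; apply: zsP; rewrite inE wz orbT.
Qed.

End Codim.

(** * Freeness of F[[x, y]] over F[[x^N, y]] *)

Section FpsSect.
Variable R : comPzRingType.
Variable N : nat.
Hypothesis N0 : (0 < N)%N.

(** The component at x^j in the basis 1, x, ..., x^(N-1) over the series in x^N. *)
Definition fps_sect j (f : fps R) : fps R := FPS (fun n => f (N * n + j)%N).

Lemma fps_sum_infl (G : nat -> fps R) m :
  (\sum_(l < N) fps_t R ^+ l * fps_infl N (G l)) m = G (m %% N)%N (m %/ N)%N.
Proof.
have mN : (m %% N < N)%N by rewrite ltn_mod.
rewrite fps_sumE (bigD1 (Ordinal mN)) // big1 => [|l lm]; rewrite fps_tXM.
  have e : (m - m %% N)%N = (m %/ N * N)%N by rewrite {1}(divn_eq m N) addnK.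
  by rewrite fps_inflE ltnNge leq_mod /= e dvdn_mull // mulnK // addr0.
case: ltnP => // ml; rewrite fps_inflE; case: ifP => // dv; case/eqP: lm.
apply/val_inj; rewrite /= -[LHS](modn_small (ltn_ord l)).
by apply/eqP; rewrite eq_sym eqn_mod_dvd.
Qed.

Lemma fps_sect_sum j (G : nat -> fps R) : (j < N)%N ->
  fps_sect j (\sum_(l < N) fps_t R ^+ l * fps_infl N (G l)) = G j.
Proof.
move=> jN; apply: fpsP => n; rewrite [LHS]fps_sum_infl mulnC.
by rewrite modnMDl modn_small // divnMDl // divn_small // addn0.
Qed.

Lemma fps_sectK f : f = \sum_(l < N) fps_t R ^+ l * fps_infl N (fps_sect l f).
Proof.
by apply: fpsP => m; rewrite (fps_sum_infl (fps_sect^~ f)) /= mulnC -divn_eq.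
Qed.

Lemma fps_sectM j g f : (j < N)%N ->
  fps_sect j (fps_infl N g * f) = g * fps_sect j f.
Proof.
move=> jN; rewrite {1}(fps_sectK f) mulr_sumr.
under eq_bigr do rewrite mulrCA -rmorphM.
by rewrite (fps_sect_sum (fun l => g * fps_sect l f)).
Qed.

Lemma fps_sect_is_zmod j : zmod_morphism (fps_sect j).
Proof. by move=> f g; apply: fpsP => n. Qed.

Definition fps2_sect j (w : fps (fps R)) := fps_map (fps_sect j) w.

Lemma fps2_sectD j w w' : fps2_sect j (w + w') = fps2_sect j w + fps2_sect j w'.
Proof. by apply: fpsP => i; apply: fpsP => n. Qed.

Lemma fps2_sectM j g w : (j < N)%N ->
  fps2_sect j (fps_map (@fps_infl R N) g * w) = g * fps2_sect j w.
Proof.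
move=> jN; apply: fpsP => n; rewrite fps_mapE !fpsME.
pose sj := HB.pack_for {additive fps R -> fps R} (fps_sect j)
  (GRing.isZmodMorphism.Build _ _ _ (@fps_sect_is_zmod j)).
rewrite -[LHS]/(sj _) raddf_sum; apply: eq_bigr => i _.
exact: fps_sectM.
Qed.

Lemma fps2_sectK w :
  w = \sum_(l < N) fpsC (fps_t R ^+ l) * fps_map (@fps_infl R N) (fps2_sect l w).
Proof.
apply: fpsP => n; rewrite fps_sumE; under eq_bigr do rewrite fpsCM.
exact: fps_sectK.
Qed.

Lemma fps2_sect_sum j (G : nat -> fps (fps R)) : (j < N)%N ->
  fps2_sect j (\sum_(l < N) fpsC (fps_t R ^+ l) * fps_map (@fps_infl R N) (G l)) = G j.
Proof.
move=> jN; apply: fpsP => n; rewrite fps_mapE fps_sumE.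
under eq_bigr do rewrite fpsCM fps_mapE.
exact: (fps_sect_sum (fun l => G l n)).
Qed.

End FpsSect.

Section Descent.
Variable F : numClosedFieldType.
Variable N : nat.
Hypothesis N0 : (0 < N)%N.
Implicit Types a b h w : fps2 F.
Local Notation sc c := (fpsC (fpsC c) : fps2 F).
Local Notation infl := (fps_map (@fps_infl F N)).

Lemma in_ideal2_sect a b w j : (j < N)%N ->
  in_ideal2 (infl a) (infl b) w -> in_ideal2 a b (fps2_sect N j w).
Proof.
move=> jN [u [v ->]]; exists (fps2_sect N j u), (fps2_sect N j v).
by rewrite fps2_sectD [u * _]mulrC [v * _]mulrC !fps2_sectM // [a * _]mulrC [b * _]mulrC.
Qed.

Lemma in_ideal2_infl a b h : in_ideal2 a b h -> in_ideal2 (infl a) (infl b) (infl h).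
Proof. by move=> [u [v ->]]; exists (infl u), (infl v); rewrite rmorphD !rmorphM. Qed.

Lemma fps2_sect0_infl h : fps2_sect N 0 (infl h) = h.
Proof.
apply: fpsP => i; apply: fpsP => n; rewrite /= addn0 dvdn_mulr // mulKn //.
Qed.

Lemma infl_sc c : infl (sc c) = sc c.
Proof.
by apply: fpsP => i; rewrite fps_mapE !fpsCE; case: eqP; rewrite ?fps_inflC ?rmorph0.
Qed.

Lemma quo_free_infl a b n (e : 'I_n -> fps2 F) : quo_free a b e ->
  quo_free (infl a) (infl b) (fun i => infl (e i)).
Proof.
move=> fr c /(in_ideal2_sect N0); apply: contraPP => nc.
have -> : \sum_i sc (c i) * infl (e i) = infl (\sum_i sc (c i) * e i).
  by rewrite rmorph_sum; apply: eq_bigr => i _; rewrite rmorphM /= infl_sc.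
by rewrite fps2_sect0_infl => /fr.
Qed.

(** A free family of maximal length spans: adjoining h gives a relation, in which h must occur with
    a nonzero coefficient. *)
Lemma max_free_span a b D : (forall n (e : 'I_n -> fps2 F), quo_free a b e -> (n <= D)%N) ->
  exists n (e : 'I_n -> fps2 F), quo_free a b e /\ quo_span a b e.
Proof.
move=> bnd; pose Q n := `[< exists e : 'I_n -> fps2 F, quo_free a b e >].
have Q0 : exists n, Q n by exists 0%N; apply/asboolP; exists (fun=> 0) => c _ [].
have Qb n : Q n -> (n <= D)%N by move=> /asboolP[e]; exact: bnd.
case: (ex_maxnP Q0 Qb) => n /asboolP[e fr] nmax; exists n, e; split=> // h.
pose e' (i : 'I_n.+1) := if unlift ord_max i is Some j then e j else h.
have nfr : ~ quo_free a b e'.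
  by move=> fr'; have /nmax : Q n.+1 by [apply/asboolP; exists e']; rewrite ltnn.
have [c [cI [i ci]]] : exists c : 'I_n.+1 -> F,
    in_ideal2 a b (\sum_i sc (c i) * e' i) /\ exists i, c i != 0.
  apply: contrapT => nc; apply: nfr => c cI i; apply/eqP; apply: contrapT => /negP ci.
  by apply: nc; exists c; split=> //; exists i.
pose d (j : 'I_n) := c (lift ord_max j).
have sumE : \sum_i sc (c i) * e' i = \sum_j sc (d j) * e j + sc (c ord_max) * h.
  rewrite (bigD1_ord ord_max) //= addrC /e' unlift_none; congr (_ + _).
  by apply: eq_bigr => j _; rewrite liftK.
rewrite sumE in cI; have [c0|c0] := eqVneq (c ord_max) 0.
  rewrite c0 !rmorph0 mul0r addr0 in cI; case/eqP: ci.
  by case: (unliftP ord_max i) => [j ->|->] //; exact: fr cI j.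
exists (fun j => - (d j / c ord_max)).
have /(in_ideal2M (sc (c ord_max)^-1)) := cI; congr in_ideal2.
rewrite mulrDr mulrA -!rmorphM mulVf // !rmorph1 mul1r addrC; congr (_ + _).
rewrite mulr_sumr -sumrN; apply: eq_bigr => j _.
by rewrite !rmorphN mulNr opprK mulrA -!rmorphM [_^-1 * _]mulrC.
Qed.

(** For a basis e downstairs, the x^l e_i with l < N form a basis upstairs. Finiteness downstairs
    holds because free families stay free upstairs and so have at most D elements. *)
Lemma ideal2_codim_infl a b D : ideal2_codim (infl a) (infl b) D ->
  exists2 n, ideal2_codim a b n & D = (N * n)%N.
Proof.
move=> DP; have [E [Esp Efr]] := ideal2_codim_quo DP.
have [n [e [fr sp]]] : exists n (e : 'I_n -> fps2 F), quo_free a b e /\ quo_span a b e.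
  by apply: (@max_free_span a b D) => n e /quo_free_infl/quo_free_le; exact.
exists n; first by rewrite -[n]card_ord; exact: quo_ideal2_codim sp fr.
apply: (ideal2_codim_uniq DP).
have -> : (N * n)%N = #|{: 'I_N * 'I_n}| by rewrite card_prod !card_ord.
pose E' (p : 'I_N * 'I_n) := fpsC (fps_t F ^+ p.1) * infl (e p.2).
have sumE (c : 'I_N * 'I_n -> F) : \sum_p sc (c p) * E' p =
    \sum_(l < N) fpsC (fps_t F ^+ l) * infl (\sum_i sc (c (l, i)) * e i).
  transitivity (\sum_l \sum_i sc (c (l, i)) * E' (l, i)).
    by rewrite pair_bigA; apply: eq_bigr => -[].
  apply: eq_bigr => l _; rewrite rmorph_sum mulr_sumr; apply: eq_bigr => i _.
  by rewrite rmorphM /= infl_sc mulrCA.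
apply: (@quo_ideal2_codim _ _ _ _ E') => [w|c cI [j i]].
  have /choice[c cP] : forall l : 'I_N, exists c : 'I_n -> F,
      in_ideal2 a b (fps2_sect N l w - \sum_i sc (c i) * e i) by move=> l; exact: sp.
  exists (fun p => c p.1 p.2); rewrite sumE {1}(fps2_sectK N0 w) -sumrB.
  apply: in_ideal2_sum => l; rewrite -mulrBr -rmorphB.
  by apply/in_ideal2M/in_ideal2_infl.
move: cI; rewrite sumE => /(in_ideal2_sect (ltn_ord j)).
pose G l := if insub l is Some l' then \sum_i sc (c (l' : 'I_N, i)) * e i else 0.
have -> : \sum_(l < N) fpsC (fps_t F ^+ l) * infl (\sum_i sc (c (l, i)) * e i) =
    \sum_(l < N) fpsC (fps_t F ^+ l) * infl (G l).
  by apply: eq_bigr => l _; rewrite /G valK.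
by rewrite fps2_sect_sum // /G valK => /fr/(_ i).
Qed.

End Descent.

(** * Characteristic exponents of an arc *)

Section FpsRoot.
Variable F : fieldType.
Implicit Types (a u y tau : fps F).
Local Notation t := (fps_t F).

(** Adding c s^(m+1) to a series with constant term 1 changes the coefficient m+1 of its k-th power
    by k c. The coefficients obtained are polynomials in those of u, which is what [rat_fps_root]
    relies on. *)
Fixpoint fps_root_approx k u n : fps F :=
  if n is m.+1 then
    let a := fps_root_approx k u m in
    a + fpsC ((u m.+1 - (a ^+ k) m.+1) / k%:R) * t ^+ m.+1
  else 1.

Definition fps_root k u : fps F := FPS (fun n => fps_root_approx k u n n).

Lemma fps_root_approxS k u n : fps_root_approx k u n.+1 = fps_root_approx k u n +
  fpsC ((u n.+1 - (fps_root_approx k u n ^+ k) n.+1) / k%:R) * t ^+ n.+1.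
Proof. by []. Qed.

Lemma fps_root_approx0 k u n : fps_root_approx k u n 0%N = 1.
Proof.
by elim: n => [|n IH]; rewrite ?fps1E // fps_root_approxS fpsDE IH fpsCM fps_tXE mulr0 addr0.
Qed.

Lemma fps_root_approx_stable k u m n : (n <= m)%N ->
  fps_root_approx k u m n = fps_root_approx k u n n.
Proof.
elim: m => [|m IH]; first by rewrite leqn0 => /eqP ->.
rewrite leq_eqVlt => /orP[/eqP -> //|]; rewrite ltnS => nm.
by rewrite fps_root_approxS fpsDE fpsCM fps_tXE ltn_eqF ?mulr0 ?addr0 ?IH // ltnS.
Qed.

Lemma fps_add_monom_exp a c m k : exists b : fps F, b 0%N = c * a 0%N ^+ k.-1 *+ k /\
  (a + fpsC c * t ^+ m.+1) ^+ k = a ^+ k + t ^+ m.+1 * b.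
Proof.
elim: k => [|k [b [b0 IH]]]; first by exists 0; rewrite mulr0 addr0 fps0E mulr0n.
exists (b * (a + fpsC c * t ^+ m.+1) + fpsC c * a ^+ k); split; last first.
  by rewrite [LHS]exprSr IH [a ^+ k.+1]exprSr; ring.
rewrite fpsDE !fpsM0 fpsDE fpsM0 fps_tXE mulr0 addr0 b0 fpsCE eqxx fpsX0.
case: k {IH b0} => [|k]; first by rewrite mulr0n mul0r add0r mulr1n.
by rewrite mulrnAl -mulrA -exprSr -mulrSr.
Qed.

Lemma fps_root_approxP k u n i : k%:R != 0 :> F -> u 0%N = 1 -> (i <= n)%N ->
  (fps_root_approx k u n ^+ k) i = u i.
Proof.
move=> k0 u0; elim: n => [|n IH] in i *.
  by rewrite leqn0 => /eqP ->; rewrite expr1n fps1E u0.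
rewrite fps_root_approxS; set a := fps_root_approx k u n; set c := (_ / _).
have [b [b0 ->]] := fps_add_monom_exp a c n k.
rewrite leq_eqVlt fpsDE fps_tXM => /orP[/eqP ->|iln]; last first.
  by rewrite iln addr0 IH.
rewrite ltnn subnn b0 fps_root_approx0 expr1n mulr1 -mulr_natr /c mulfVK //.
by rewrite addrC subrK.
Qed.

Lemma fps_agreeX k (f g : fps F) n : (forall i, (i <= n)%N -> f i = g i) ->
  forall i, (i <= n)%N -> (f ^+ k) i = (g ^+ k) i.
Proof.
move=> fg; elim: k => [|k IH] i ilen //; rewrite !exprS; apply: fps_agreeM => j ji.
  by apply: fg; exact: leq_trans ilen.
by apply: IH; exact: leq_trans ilen.
Qed.

Lemma fps_rootP k u : k%:R != 0 :> F -> u 0%N = 1 -> fps_root k u ^+ k = u.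
Proof.
move=> k0 u0; apply: fpsP => n; rewrite -(fps_root_approxP k0 u0 (leqnn n)).
by apply: (@fps_agreeX k _ _ n) => // i ilen; rewrite (fps_root_approx_stable _ _ ilen).
Qed.

Lemma fps_root0 k u : fps_root k u 0%N = 1.
Proof. exact: fps_root_approx0. Qed.

(* The remainder of y after subtracting its expansion along 1, tau, ..., tau^(n-1). *)
Fixpoint fps_expand_rem tau y n : fps F :=
  if n is m.+1 then
    fps_expand_rem tau y m - fpsC (fps_expand_rem tau y m m) * tau ^+ m
  else y.

Lemma fps_expand_remS tau y n : fps_expand_rem tau y n.+1 =
  fps_expand_rem tau y n - fpsC (fps_expand_rem tau y n n) * tau ^+ n.
Proof. by []. Qed.

Definition fps_expand tau y : fps F := FPS (fun n => fps_expand_rem tau y n n).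

Lemma fps_lead_exp tau n : tau 0%N = 0 -> (tau ^+ n) n = tau 1%N ^+ n.
Proof.
move=> t0; have /fps_dvdtP[u uE] : fps_dvd 1 tau by case.
by rewrite uE expr1 exprMn fps_tM fps_tXM ltnn subnn fpsX0.
Qed.

Lemma fps_expand_remE tau y n :
  fps_expand_rem tau y n = y - \sum_(i < n) fpsC (fps_expand tau y i) * tau ^+ i.
Proof.
elim: n => [|n IH]; first by rewrite big_ord0 subr0.
by rewrite big_ord_recr opprD addrA -IH.
Qed.

Lemma fps_expand_rem_dvd tau y n : tau 0%N = 0 -> tau 1%N = 1 ->
  fps_dvd n (fps_expand_rem tau y n).
Proof.
move=> t0 t1; elim: n => [|n IH] // i; rewrite ltnS leq_eqVlt fps_expand_remS fpsBE fpsCM.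
case/orP => [/eqP ->|iln]; first by rewrite fps_lead_exp // t1 expr1n mulr1 subrr.
by rewrite IH // (fps_dvdX t0) // mulr0 subr0.
Qed.

Lemma fps_expandK tau y : tau 0%N = 0 -> tau 1%N = 1 -> fps_comp (fps_expand tau y) tau = y.
Proof.
move=> t0 t1; apply: fpsP => n; apply/esym/eqP; rewrite -subr_eq0; apply/eqP.
rewrite -[RHS](fps_expand_rem_dvd y t0 t1 (ltnSn n)) fps_expand_remE fpsBE fps_sumE.
by congr (_ - _); apply: eq_bigr => i _; rewrite fpsCM.
Qed.

End FpsRoot.

(* tau with x = x_k tau^k, for x of order k. *)
Definition fps_unif (F : fieldType) k (x : fps F) : fps F :=
  fps_t F * fps_root k (FPS (fun i => x (k + i)%N / x k)).

Lemma fps_unif0 (F : fieldType) k (x : fps F) : fps_unif k x 0%N = 0.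
Proof. by rewrite fps_tM. Qed.

Lemma fps_unif1 (F : fieldType) k (x : fps F) : fps_unif k x 1%N = 1.
Proof. by rewrite fps_tM fps_root0. Qed.

Lemma fps_unifP (F : fieldType) k (x : fps F) : k%:R != 0 :> F -> fps_ord x k ->
  x = fpsC (x k) * fps_unif k x ^+ k.
Proof.
move=> k0 [xk xi]; rewrite /fps_unif exprMn fps_rootP //; last by rewrite /= addn0 mulfV.
apply: fpsP => i; rewrite fpsCM fps_tXM; case: ltnP => [/xi ->|ki]; first by rewrite mulr0.
by rewrite /= subnKC // mulrC mulfVK.
Qed.

(** The coefficients b_i of y along tau. For x of order k they are c^i Y_i with c^k = x_k, in the
    notation of [arc_normal_form]. *)
Definition arc_coef (F : closedFieldType) k (g : plane_arc F) : nat -> F :=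
  fps_expand (fps_unif k (arcx g)) (arcy g).

Lemma prim_root_exists (F : numClosedFieldType) k : (0 < k)%N ->
  exists z : F, k.-primitive_root z.
Proof.
move=> k0; have [rs rsE] := closed_field_poly_normal ('X^k - 1 : {poly F}).
have m1 : ('X^k - 1 : {poly F}) \is monic by rewrite monicXnsubC.
rewrite (eqP m1) scale1r in rsE.
have : has k.-primitive_root rs; last by move=> /hasP[z _ zP]; exists z.
apply: has_prim_root => //.
- apply/allP => z zrs; rewrite unity_rootE.
  have : root ('X^k - 1) z by rewrite rsE root_prod_XsubC.
  by rewrite /root !hornerE subr_eq0.
- rewrite -separable_prod_XsubC -rsE separable_Xn_sub_1 // pnatr_eq0 -lt0n //.
- by rewrite -ltnS -(size_prod_XsubC rs id) -rsE size_XnsubC.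
Qed.

(* Every arc with x of order k is (rho^k, Y(rho)) for a series rho of order 1. *)
Lemma arc_normal_form (F : numClosedFieldType) k (g : plane_arc F) :
    (0 < k)%N -> fps_ord (arcx g) k ->
  exists rho Y : fps F, [/\ rho 0%N = 0, rho 1%N != 0, arcx g = rho ^+ k,
    arcy g = fps_comp Y rho & forall i, (Y i != 0) = (arc_coef k g i != 0)].
Proof.
move=> k0 xk; have kn0 : k%:R != 0 :> F by rewrite pnatr_eq0 -lt0n.
pose c := k.-root (arcx g k); have ck : c ^+ k = arcx g k by rewrite rootCK.
have c0 : c != 0 by apply: contraTneq (proj1 xk) => cc; rewrite -ck cc expr0n gtn_eqF // eqxx.
pose tau := fps_unif k (arcx g).
have t0 : tau 0%N = 0 by exact: fps_unif0.
have t1 : tau 1%N = 1 by exact: fps_unif1.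
exists (fpsC c * tau), (FPS (fun i => arc_coef k g i / c ^+ i)); split.
- by rewrite fpsCM t0 mulr0.
- by rewrite fpsCM t1 mulr1.
- by rewrite exprMn -(rmorphXn (@fpsC F)) ck; exact: fps_unifP.
- rewrite -(fps_expandK (arcy g) t0 t1); apply: fpsP => n; apply: eq_bigr => i _.
  by rewrite [(fpsC c * tau) ^+ i]exprMn -(rmorphXn (@fpsC F)) fpsCM /= mulrA mulfVK // expf_neq0.
- by move=> i; rewrite /= mulf_eq0 invr_eq0 expf_eq0 (negbTE c0) andbF orbF.
Qed.

Section CharGcd.
Variables (k : nat) (nz : nat -> bool).

Fixpoint char_gcd l :=
  if l is l'.+1 then if nz l then gcdn (char_gcd l') l else char_gcd l' else k.

(** The index is shifted: the drop from e_i to e_(i+1) happens at the exponent i+1 and has weight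
    i. *)
Definition char_mu l := (\sum_(i < l) i * (char_gcd i - char_gcd i.+1))%N.

Lemma char_gcd_dvd l m : (l <= m)%N -> (char_gcd m %| char_gcd l)%N.
Proof.
elim: m => [|m IH]; first by rewrite leqn0 => /eqP ->.
rewrite leq_eqVlt => /orP[/eqP -> //|]; rewrite ltnS => /IH lm.
by rewrite /=; case: ifP => // _; exact: dvdn_trans (dvdn_gcdl _ _) lm.
Qed.

Lemma char_gcd_dvdk l : (char_gcd l %| k)%N.
Proof. exact: (char_gcd_dvd (leq0n l)). Qed.

Lemma char_gcd_gt0 l : (0 < k)%N -> (0 < char_gcd l)%N.
Proof. by move=> k0; apply: dvdn_gt0 (char_gcd_dvdk l). Qed.

Lemma char_gcd_le l m : (0 < k)%N -> (l <= m)%N -> (char_gcd m <= char_gcd l)%N.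
Proof. by move=> k0 lm; rewrite dvdn_leq ?char_gcd_gt0 ?char_gcd_dvd. Qed.

Lemma char_gcd_nz l i : (0 < i <= l)%N -> nz i -> (char_gcd l %| i)%N.
Proof.
case: i => // i /= il ni; apply: dvdn_trans (char_gcd_dvd il) _.
by rewrite /= ni dvdn_gcdr.
Qed.

(** For a primitive k-th root of unity zeta, both sides say that the rotation by zeta^d fixes the
    terms of degree 1 to l. As k divides d k anyway, it divides all the d i if and only if it
    divides d times the gcd of k and the i. *)
Lemma dvdn_char_gcd l d : (forall i, (0 < i <= l)%N -> nz i -> k %| d * i)%N <->
  (k %| d * char_gcd l)%N.
Proof.
split=> [|kd i il ni]; last first.
  by apply: dvdn_trans kd _; rewrite dvdn_mul // char_gcd_nz.
elim: l => [|l IH] H /=; first by rewrite dvdn_mull.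
have {}IH : (k %| d * char_gcd l)%N.
  by apply: IH => i /andP[i0 il]; apply: H; rewrite i0 (leq_trans il).
by case: ifP => // nl; rewrite muln_gcdr dvdn_gcd IH H // ltnS leqnn.
Qed.

(** Abel summation. It turns the sums of the e_i, which count coincidences between conjugates, into
    the weighted drops of [char_mu]. *)
Lemma char_mu_sum l : (0 < k)%N ->
  (char_mu l + (k - char_gcd l) + l * char_gcd l = \sum_(i < l) char_gcd i)%N.
Proof.
move=> k0; elim: l => [|l IH]; first by rewrite /char_mu !big_ord0 subnn.
have E : char_mu l.+1 = (char_mu l + l * (char_gcd l - char_gcd l.+1))%N.
  by rewrite /char_mu big_ord_recr.
have := char_gcd_le k0 (leqnSn l); have : (char_gcd l <= k)%N by apply: (@char_gcd_le 0).
rewrite big_ord_recr -IH E mulnBr mulSn.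
set a := char_gcd l; set b := char_gcd l.+1 => ak ba.
have : (l * b <= l * a)%N by rewrite leq_mul.
move: (char_mu l) (l * a)%N (l * b)%N ak ba; rewrite /=; clear; lia.
Qed.

End CharGcd.

Lemma count_dvdn q e : (0 < q)%N -> (\sum_(d < e * q) (q %| d) = e)%N.
Proof.
move=> q0; elim: e => [|e IH]; first by rewrite mul0n big_ord0.
rewrite mulSn addnC big_split_ord /= IH -(addn1 e); congr addn.
case: q q0 {IH} => // q _.
rewrite big_ord_recl addn0 dvdn_mull //= big1 // => i _.
by rewrite dvdn_addr ?dvdn_mull // gtnNdvd //; exact: ltn_ord i.
Qed.

(** Counts the k-th roots of unity zeta^d with zeta^(d e) = 1. *)
Lemma count_dvdn_mul k e : (0 < k)%N -> (e %| k)%N -> (\sum_(d < k) (k %| d * e) = e)%N.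
Proof.
move=> k0 /dvdnP[q kE]; rewrite mulnC in kE; subst k.
move: k0; rewrite muln_gt0 => /andP[e0 q0].
rewrite -[RHS](count_dvdn e q0); apply: eq_bigr => d _.
by rewrite [(d * e)%N]mulnC dvdn_pmul2l.
Qed.

Section Lin.
Variable F : numClosedFieldType.
Implicit Types (z w : fps F) (H K : fps2 F).

Definition fps2_lin z : fps2 F := fps_t (fps F) - fpsC z.

Lemma fps_ev_lin w z : w 0%N = 0 -> fps_ev w (fps2_lin z) = w - z.
Proof. by move=> w0; rewrite raddfB /= fps_ev_t // fps_evC. Qed.

Lemma fps_deriv_lin z : fps_deriv (fps2_lin z) = 1.
Proof.
apply: fpsP => -[|n]; rewrite fps1E [LHS]/=.
  by rewrite -[_ - _]/(fps2_lin z 1%N) fpsBE fpsCE subr0 mulr1n.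
by rewrite -[X in X *+ _]/(fps2_lin z n.+2) fpsBE fpsCE subr0 /= mul0rn.
Qed.

Lemma fps_map_lin (phi : {rmorphism fps F -> fps F}) z :
  fps_map phi (fps2_lin z) = fps2_lin (phi z).
Proof. by rewrite rmorphB /= fps_map_t fps_mapC. Qed.

Lemma fps_ev_coef00 z H : fps_ev z H 0%N = H 0%N 0%N.
Proof. by rewrite fps_ev_coef big_ord1 expr0 mulr1. Qed.

(** Linear factors are split off one at a time: F[[x]] is a domain, so the remaining quotient still
    vanishes at the other roots. *)
Lemma dvd_prod_lin (zs : seq (fps F)) H : uniq zs -> (forall z, z \in zs -> z 0%N = 0) ->
    (forall z, z \in zs -> fps_ev z H = 0) ->
  exists Q, H = \prod_(z <- zs) fps2_lin z * Q.
Proof.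
elim: zs H => [|z zs IH] H; first by exists H; rewrite big_nil mul1r.
move=> /= /andP[zzs uzs] z0 ev0.
have [Q HE] := fps_ev_sub H (z0 z (mem_head _ _)).
rewrite (ev0 z (mem_head _ _)) rmorph0 addr0 in HE.
have [||Q' QE] := IH Q uzs.
- by move=> w wzs; apply: z0; rewrite inE wzs orbT.
- move=> w wzs; have winz : w \in z :: zs by rewrite inE wzs orbT.
  have := ev0 w winz; rewrite HE fps_evM ?z0 // [fps_ev w (_ - _)]fps_ev_lin ?z0 //.
  move/eqP; rewrite mulf_eq0 subr_eq0 => /orP[/eqP wz|/eqP //].
  by rewrite -wz wzs in zzs.
by exists Q'; rewrite big_cons -mulrA -QE.
Qed.

Lemma fps_comp_ord (f rho : fps F) n p : (0 < p)%N -> fps_ord f n -> fps_ord rho p ->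
  fps_ord (fps_comp f rho) (n * p).
Proof.
move=> p0 /fps_ordP[u u0 ->] rp; have r0 : rho 0%N = 0 by exact: (proj2 rp).
rewrite fps_compM // fps_compXn // fps_comp_t // -[(n * p)%N]addn0.
apply: fps_ordM; last by split=> //; rewrite fps_comp_coef0.
elim: n => [|n IH]; first exact: fps_ord1.
by rewrite exprS mulSn; exact: fps_ordM.
Qed.

Lemma fps_comp_eq0 (f rho : fps F) : rho 0%N = 0 -> rho != 0 -> fps_comp f rho = 0 -> f = 0.
Proof.
move=> r0 /fps_ord_ex[p pP] fr; apply/eqP; apply: contrapT => /negP /fps_ord_ex[n nP].
have p0 : (0 < p)%N by case: p pP => // -[]; rewrite r0 eqxx.
by have := fps_ord_neq0 (fps_comp_ord p0 nP pP); rewrite fr eqxx.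
Qed.

Lemma fps_ord_deriv (f : fps F) q : fps_ord f q.+1 -> fps_ord (fps_deriv f) q.
Proof.
move=> [fq fq0]; split=> [|i iq] /=; last by rewrite fq0 ?mul0rn.
by rewrite -mulr_natr mulf_neq0 // pnatr_eq0.
Qed.

Lemma fps_ord_rot (f : fps F) c n : c != 0 -> fps_ord f n -> fps_ord (fps_rot c f) n.
Proof.
move=> c0 [fn fn0]; split=> [|i im]; rewrite fps_rotE; last by rewrite fn0 ?mulr0.
by rewrite mulf_neq0 // expf_neq0.
Qed.

End Lin.

(** * The polar curve *)

Section Polar.
Variable F : numClosedFieldType.
Implicit Types (f : fps2 F) (z : fps F).
Local Notation infl N := (fps_map (@fps_infl F N)).

Lemma fps2_dy_infl N f : infl N (fps2_dy f) = fps_deriv (infl N f).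
Proof. by apply: fpsP => n; rewrite fps_mapE raddfMn. Qed.

Lemma fps_deriv_ev_infl N f z : z 0%N = 0 ->
  fps_deriv (fps_ev z (infl N f)) =
  fps_t F ^+ N.-1 * fps_ev z (infl N (fps2_dx f)) *+ N +
  fps_deriv z * fps_ev z (infl N (fps2_dy f)).
Proof.
move=> z0; rewrite fps_deriv_ev // -fps2_dy_infl; congr (_ + _).
rewrite -mulrnAl -fps_evCM //; congr fps_ev; apply: fpsP => j.
by rewrite fpsCM !fps_mapE fps_deriv_infl mulrnAl.
Qed.

(* Teissier's lemma: along a branch of the polar curve f_y = 0 the chain rule
   gives ord f = ord f_x + ord x. *)
Lemma polar_codim f k p : (0 < k)%N -> fps_ord (fps_map (@fps_coef0 F) f) k ->
    (forall N z, (0 < N)%N -> z 0%N = 0 ->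
       fps_ev z (infl N (fps2_dy f)) = 0 -> fps_ev z (infl N f) != 0) ->
    ideal2_codim f (fps2_dy f) p ->
  exists2 n, ideal2_codim (fps2_dx f) (fps2_dy f) n & p = (n + k.-1)%N.
Proof.
case: k => // k _ fk nv fp.
(* From here on k is the former k minus 1: f_y(0, y) has order k, so f_y has k Puiseux roots. *)
have fyk : fps_ord (fps_map (@fps_coef0 F) (fps2_dy f)) k.
  rewrite (_ : fps_map _ _ = fps_deriv (fps_map (@fps_coef0 F) f)); first exact: fps_ord_deriv.
  by apply: fpsP => n; rewrite fps_mapE raddfMn.
have [N [zs [v [N0 szs zs0 v0 fyE]]]] := regular_series_roots fyk.
have fyz z : z \in zs -> fps_ev z (infl N (fps2_dy f)) = 0.
  move=> zzs; rewrite fyE (big_rem z) //= mulrCA fps_evM ?zs0 //.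
  by rewrite [fps_ev z (_ - _)]fps_ev_lin ?zs0 // subrr mul0r.
have f00 : f 0%N 0%N = 0 by exact: (proj2 fk).
(* With f_y = 0 along z, the derivative of f(s^N, z(s)) is N s^(N-1) f_x. Its order is N - 1 + r,
   hence f has order N + r. *)
have /choice[r rP] : forall z, exists r, z \in zs ->
    fps_ord (fps_ev z (infl N f)) (N + r) /\ fps_ord (fps_ev z (infl N (fps2_dx f))) r.
  move=> z; have [zzs|] := boolP (z \in zs); last by exists 0%N.
  have /fps_ord_ex[q qP] := nv N z N0 (zs0 z zzs) (fyz z zzs).
  case: q qP => [[]|q qP].
    by rewrite fps_ev_coef00 fps_mapE fps_infl_coef0 f00 eqxx.
  have := fps_ord_deriv qP; rewrite fps_deriv_ev_infl ?zs0 // fyz // mulr0 addr0 => Dq.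
  set b := fps_ev _ _ in Dq *.
  have b0 : b != 0.
    by apply: contraTneq (fps_ord_neq0 Dq) => ->; rewrite mulr0 mul0rn eqxx.
  have [r rP] := fps_ord_ex b0; exists r => _; split=> //.
  suff -> : (N + r)%N = q.+1 by [].
  have tN : fps_ord (fps_t F ^+ N.-1 * b *+ N) (N.-1 + r).
    rewrite -mulr_natr -[(_ + r)%N]addn0; apply: fps_ordM; last first.
      split=> //; rewrite -[N]mul1n natrM mul1r -(rmorph_nat (@fpsC F)) fpsCE eqxx.
      by rewrite pnatr_eq0 -lt0n.
    by apply: fps_ordM => //; split=> [|i iN]; rewrite fps_tXE ?eqxx ?oner_neq0 // ltn_eqF.
  by rewrite (fps_ord_uniq Dq tN) -addSn prednK.
have c1 : ideal2_codim (infl N (fps2_dy f)) (infl N f) (\sum_(z <- zs) (N + r z))%N.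
  by rewrite fyE; apply: ideal2_codim_prod => // z zzs; split; [exact: zs0|case: (rP z zzs)].
have c2 : ideal2_codim (infl N (fps2_dy f)) (infl N (fps2_dx f)) (\sum_(z <- zs) r z)%N.
  by rewrite fyE; apply: ideal2_codim_prod => // z zzs; split; [exact: zs0|case: (rP z zzs)].
have [n1 n1P n1E] := ideal2_codim_infl N0 c1.
have [n2 n2P n2E] := ideal2_codim_infl N0 c2.
exists n2; first exact: ideal2_codimC.
rewrite (ideal2_codim_uniq fp (ideal2_codimC n1P)).
(* Each of the k roots contributes an extra N, and the descent divides the total by N. *)
apply/eqP; rewrite -(eqn_pmul2l N0) -n1E big_split /= n2E mulnDr.
by rewrite big_const_seq count_predT szs iter_addn_0 addnC.
Qed.

End Polar.

(** * Conjugate parametrisations *)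

Section Conjugates.
Variable F : numClosedFieldType.
Variables (k : nat) (zeta : F).
Hypotheses (k0 : (0 < k)%N) (zP : k.-primitive_root zeta).
Variable Y : fps F.
Hypothesis Y0 : Y 0%N = 0.
Local Notation infl N := (fps_map (@fps_infl F N)).

Definition fps_conj j := fps_rot (zeta ^+ j) Y.

Lemma zeta_neq0 : zeta != 0.
Proof.
apply/eqP => z0; have := prim_expr_order zP; rewrite z0 expr0n gtn_eqF // => /eqP.
by rewrite eq_sym oner_eq0.
Qed.

Lemma fps_conj0 j : fps_conj j 0%N = 0.
Proof. by rewrite fps_rot_coef0. Qed.

Lemma fps_rot_infl h j : fps_rot (zeta ^+ j) (fps_infl k h) = fps_infl k h.
Proof.
apply: fpsP => n; rewrite fps_rotE fps_inflE; case: ifP => [/dvdnP[q ->]|_]; last by rewrite mulr0.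
by rewrite -exprM mulnA mulnC exprM (prim_expr_order zP) expr1n mul1r.
Qed.

Lemma fps_rot_fixed h : fps_rot zeta h = h -> h = fps_infl k (fps_sect k 0 h).
Proof.
move=> /fps_eqP hz; apply: fpsP => n; rewrite fps_inflE; case: ifP => [/dvdnP[q ->]|kn].
  by rewrite mulnK //= addn0 mulnC.
have := hz n; rewrite fps_rotE => /eqP; rewrite -subr_eq0 -{2}[h n]mul1r -mulrBl mulf_eq0.
by rewrite subr_eq0 -(prim_order_dvd zP) kn => /eqP.
Qed.

(** The norm of y - Y(s): rotation by zeta permutes the factors cyclically, so the product contains
    only powers of s^k. *)
Lemma conj_poly_ex : exists f0, infl k f0 = \prod_(j < k) fps2_lin (fps_conj j).
Proof.
set P := \prod_(j < k) _.
have Pfix : fps_map (fps_rot zeta) P = P.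
  pose G j := fps2_lin (fps_conj j).
  transitivity (\prod_(j < k) G j.+1).
    rewrite rmorph_prod; apply: eq_bigr => j _.
    by rewrite [LHS]fps_map_lin /G /fps_conj /= fps_rot_rot exprS.
  have Gk : G k = G 0%N by rewrite /G /fps_conj (prim_expr_order zP) expr0.
  rewrite /P; case: (k) k0 Gk => // k' _ Gk.
  by rewrite big_ord_recr [RHS]big_ord_recl /= Gk mulrC.
exists (FPS (fun i => fps_sect k 0 (P i))); apply: fpsP => i; rewrite fps_mapE.
by apply/esym/fps_rot_fixed; have /fps_eqP/(_ i) := Pfix.
Qed.

(** Rotation by zeta^j fixes the series in s^k, so it carries roots of h(s^k, y) to roots. *)
Lemma fps_ev_conj h j : fps_ev Y (infl k h) = 0 -> fps_ev (fps_conj j) (infl k h) = 0.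
Proof.
move=> evY; have := fps_ev_morph (psi := fps_rot (zeta ^+ j)) (infl k h) Y0 (fps_conj0 j).
rewrite evY rmorph0 => ->; congr fps_ev; apply: fpsP => i.
by rewrite !fps_mapE /= fps_rot_infl.
Qed.

Variable l : nat.
Local Notation e := (char_gcd k (fun i => Y i != 0)).
Hypothesis el : e l = 1%N.

Lemma sum_ltn n m : (n <= m)%N -> (\sum_(i < m) (i < n)%N = n)%N.
Proof.
move=> nm; rewrite -{2}(card_ord n) -sum1_card (big_ord_widen m (fun=> 1%N)) //.
by rewrite [RHS]big_mkcond.
Qed.

(** The order n is the least exponent i of Y with k not dividing d i, and i < n holds if and only if
    k divides d e_i. Writing n as the number of such i < l lets the orders be summed over d. *)
Lemma fps_conj_ord d : ~~ (k %| d)%N ->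
  fps_ord (Y - fps_conj d) (\sum_(i < l) (k %| d * e i)%N).
Proof.
move=> kd.
have coefE i : (Y - fps_conj d) i = (1 - zeta ^+ (d * i)) * Y i.
  by rewrite fpsBE fps_rotE -exprM mulrBl mul1r.
have coef0 i : ((Y - fps_conj d) i != 0) = ~~ (k %| d * i)%N && (Y i != 0).
  by rewrite coefE mulf_eq0 negb_or subr_eq0 eq_sym -(prim_order_dvd zP).
have ex : exists n, (Y - fps_conj d) n != 0.
  apply: contrapT => nex; move/negP: kd; apply.
  rewrite -[d]muln1 -el; apply/dvdn_char_gcd => i il Yi.
  by apply: contrapT => /negP ki; apply: nex; exists i; rewrite coef0 ki.
case: (ex_minnP ex) => n nP nmin.
have nlt i : (i < n)%N = (k %| d * e i)%N.
  apply/idP/idP => [iltn|].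
    apply/dvdn_char_gcd => j /andP[_ ji] Yj; apply: contrapT => /negP kj.
    by have := nmin j; rewrite coef0 kj Yj => /(_ isT); rewrite leqNgt (leq_ltn_trans ji).
  move=> /dvdn_char_gcd H; rewrite ltnNge; apply/negP => ni.
  move: nP; rewrite coef0 => /andP[/negP kn Yn]; apply: kn; apply: H => //.
  by rewrite ni andbT lt0n; apply: contraNneq Yn => ->; rewrite Y0.
have nl : (n <= l)%N by rewrite leqNgt nlt el muln1.
under eq_bigr do rewrite -nlt; rewrite sum_ltn //; split=> // i iltn.
by apply/eqP; apply: contrapT => /negP /nmin; rewrite leqNgt iltn.
Qed.

(** Rotation by zeta^i reduces to the difference of Y and a conjugate; j + (k - i) represents j - i
    modulo k without negative numbers. *)
Lemma fps_conj_subord i j : (i < k)%N -> (j < k)%N -> i != j ->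
  fps_ord (fps_conj i - fps_conj j) (\sum_(n < l) (k %| (j + (k - i)) * e n)%N).
Proof.
move=> ik jk ij; have kd : ~~ (k %| j + (k - i))%N.
  apply: contra ij => kd; move: (dvdnP kd) => [q qE]; case: q qE => [|[|q]]; rewrite ?mul0n ?mul1n.
  - by lia.
  - by move=> ?; apply/eqP; lia.
  - by rewrite !mulSn; lia.
have := fps_ord_rot (expf_neq0 i zeta_neq0) (fps_conj_ord kd).
rewrite rmorphB /= /fps_conj fps_rot_rot -exprD addnCA subnKC 1?ltnW // exprD.
by rewrite (prim_expr_order zP) mulr1.
Qed.

(** Summed over all j, each n < l contributes e_n. The term j = i, which contributes l, is taken
    away, and [char_mu_sum] evaluates the rest. *)
Lemma sum_conj_ord i : (i < k)%N ->
  (\sum_(j < k | j != i :> nat) \sum_(n < l) (k %| (j + (k - i)) * e n)%N =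
   char_mu k (fun i => Y i != 0)%R l + k.-1)%N.
Proof.
move=> ik; have shift c n : (\sum_(j < k) (k %| (j + c) * e n) = e n)%N.
  rewrite -[RHS](count_dvdn_mul k0 (char_gcd_dvdk k (fun i => Y i != 0) n)).
  elim: c => [|c IH]; first by under eq_bigr do rewrite addn0.
  rewrite -IH; case: (k) k0 => // k' _.
  rewrite big_ord_recr [RHS]big_ord_recl /= add0n [RHS]addnC; congr addn.
    by apply: eq_bigr => j _; rewrite /bump add1n addSnnS.
  by rewrite -addSnnS mulnDl dvdn_addr // dvdn_mulr.
have := char_mu_sum (fun i => Y i != 0) l k0; rewrite el muln1 => mu.
have tot : (\sum_(j < k) \sum_(n < l) (k %| (j + (k - i)) * e n) = \sum_(n < l) e n)%N.
  by rewrite exchange_big; apply: eq_bigr => n _; exact: shift.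
move: tot; rewrite (bigD1 (Ordinal ik)) //= subnKC 1?ltnW //.
rewrite (eq_bigr (fun=> 1%N)) => [|n _]; last by rewrite dvdn_mulr.
rewrite sum1_card card_ord -mu subn1 addnC => /eqP; rewrite eqn_add2r => /eqP <-.
by apply: eq_bigl => j; rewrite -val_eqE.
Qed.

Lemma fps_conj_uniq : uniq [seq fps_conj j | j <- iota 0 k].
Proof.
rewrite map_inj_in_uniq ?iota_uniq // => i j; rewrite !mem_iota !add0n /= => ik jk cij.
apply/eqP; apply: contrapT => /negP ij.
by have := fps_ord_neq0 (fps_conj_subord ik jk ij); rewrite cij subrr eqxx.
Qed.

End Conjugates.

(** * The Milnor number in terms of the characteristic exponents *)

Section Milnor.
Variable F : numClosedFieldType.
Implicit Types (g d : plane_arc F) (h f : fps2 F) (phi rho Y z : fps F).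
Local Notation infl N := (fps_map (@fps_infl F N)).

Lemma arc_subst_comp g d phi h : phi 0%N = 0 ->
    arcx g = fps_comp (arcx d) phi -> arcy g = fps_comp (arcy d) phi ->
  arc_subst h g = fps_comp (arc_subst h d) phi.
Proof.
move=> p0 gx gy; rewrite !arc_subst_ev (fps_comp_ev _ (arcy0 d) p0) -gy; congr fps_ev.
by apply: fpsP => j; rewrite !fps_mapE gx (fps_compA _ (arcx0 d) p0).
Qed.

Lemma arc_subst_normal g k rho Y h : (0 < k)%N -> rho 0%N = 0 -> Y 0%N = 0 ->
    arcx g = rho ^+ k -> arcy g = fps_comp Y rho ->
  arc_subst h g = fps_comp (fps_ev Y (infl k h)) rho.
Proof.
move=> k0 r0 Y0 gx gy; rewrite arc_subst_ev (fps_comp_ev _ Y0 r0) -gy; congr fps_ev.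
have tk0 : (fps_t F ^+ k) 0%N = 0 by rewrite fps_tXE eq_sym gtn_eqF.
apply: fpsP => j; rewrite !fps_mapE gx (fps_infl_comp _ k0) (fps_compA _ tk0 r0).
by rewrite (fps_compXn _ _ r0) (fps_comp_t r0).
Qed.

Lemma infl_infl M N h : (0 < M)%N -> infl M (infl N h) = infl (M * N) h.
Proof. by move=> M0; apply: fpsP => i; rewrite !fps_mapE fps_infl_infl. Qed.

Lemma coef0_infl N h : fps_map (@fps_coef0 F) (infl N h) = fps_map (@fps_coef0 F) h.
Proof. by apply: fpsP => i; exact: fps_infl_coef0. Qed.

Lemma coef0_prod_lin (I : Type) (r : seq I) (z : I -> fps F) : (forall i, z i 0%N = 0) ->
  fps_map (@fps_coef0 F) (\prod_(i <- r) fps2_lin (z i)) = fps_t F ^+ size r.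
Proof.
move=> z0; elim: r => [|i r IH]; first by rewrite big_nil rmorph1.
rewrite big_cons rmorphM /= IH exprS; congr (_ * _).
apply: fpsP => n; rewrite fps_mapE /fps_coef0 !fpsBE fpsCE.
case: n => [|[|n]]; rewrite /= ?subrr ?z0 ?subr0 // -[LHS]/((0 : fps F) 0%N) fps0E //.
Qed.

(* The product of y - Y(zeta^j s) over the k-th roots of unity is a series in
   x = s^k; it is the equation of the image of the arc. *)
Lemma arc_equation d q : (0 < q)%N -> fps_ord (arcx d) q ->
  exists f, arc_subst f d = 0 /\ fps_ord (fps_map (@fps_coef0 F) f) q.
Proof.
move=> q0 dq; have [rho [Y [r0 r1 dx dy _]]] := arc_normal_form q0 dq.
have Y0 : Y 0%N = 0 by have := arcy0 d; rewrite dy fps_comp_coef0.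
have [zeta zP] := prim_root_exists F q0.
have [f fE] := conj_poly_ex q0 zP Y; exists f; split.
  rewrite (arc_subst_normal f q0 r0 Y0 dx dy) fE.
  case: q q0 zP {dq dx fE} => // q _ zP.
  rewrite big_ord_recl fps_evM // fps_ev_lin // /fps_conj expr0 fps_rot1 subrr mul0r.
  by rewrite [LHS](rmorph0 (fps_comp_morph r0)).
rewrite -(coef0_infl q) fE coef0_prod_lin; last by move=> j; exact: fps_conj0.
have -> : size (index_enum 'I_q) = q by rewrite -[RHS]card_ord cardE enumT.
by split=> [|i iq]; rewrite fps_tXE ?eqxx ?oner_neq0 // ltn_eqF.
Qed.

Section Primitive.
Variables (g : plane_arc F) (k : nat) (rho Y : fps F) (zeta : F) (f0 : fps2 F) (l : nat).
Hypotheses (k0 : (0 < k)%N) (r0 : rho 0%N = 0) (r1 : rho 1%N != 0) (Y0 : Y 0%N = 0).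
Hypotheses (gx : arcx g = rho ^+ k) (gy : arcy g = fps_comp Y rho).
Hypothesis zP : k.-primitive_root zeta.
Hypothesis f0E : infl k f0 = \prod_(j < k) fps2_lin (fps_conj zeta Y j).
Hypothesis el : char_gcd k (fun i => Y i != 0) l = 1%N.
Local Notation conj := (fps_conj zeta Y).
Local Notation mu := (char_mu k (fun i => Y i != 0) l).

Let zs := [seq conj j | j <- iota 0 k].

Lemma prod_conj (G : fps F -> fps2 F) : \prod_(z <- zs) G z = \prod_(j < k) G (conj j).
Proof. by rewrite big_map -{1}[k]subn0 -/(index_iota 0 k) big_mkord. Qed.

Lemma mem_conj z : z \in zs -> exists2 i, (i < k)%N & z = conj i.
Proof. by case/mapP => i; rewrite mem_iota => /andP[_ ik] ->; exists i. Qed.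

Lemma arc_kernel_dvd h : arc_subst h g = 0 ->
  exists Q, infl k h = \prod_(j < k) fps2_lin (conj j) * Q.
Proof.
have rn0 : rho != 0 by apply: contraNneq r1 => ->; rewrite fps0E.
rewrite (arc_subst_normal h k0 r0 Y0 gx gy) => /(fps_comp_eq0 r0 rn0) evY.
rewrite -prod_conj; apply: dvd_prod_lin.
- exact: (fps_conj_uniq k0 zP Y0 el).
- by move=> _ /mapP[j _ ->]; exact: fps_conj0.
- by move=> _ /mapP[j _ ->]; exact: (fps_ev_conj zP Y0).
Qed.

Lemma f0_reduced : reduced_equation g f0.
Proof.
move=> h; split=> [/arc_kernel_dvd[Q hE]|[u ->]].
  (* The component of the exponents divisible by k turns a quotient over F[[s]] into one over
     F[[x]]. *)
  exists (fps2_sect k 0 Q); rewrite -(fps2_sect0_infl k0 h) hE -f0E.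
  by rewrite fps2_sectM // mulrC.
rewrite (arc_subst_normal _ k0 r0 Y0 gx gy) rmorphM fps_evM //= f0E.
have c0 : conj 0 = Y by rewrite /fps_conj expr0 fps_rot1.
rewrite (bigD1 (Ordinal k0)) //= c0 fps_evM // fps_ev_lin //.
by rewrite subrr mul0r mulr0 [LHS](rmorph0 (fps_comp_morph r0)).
Qed.

Lemma g_ord : fps_ord (arcx g) k.
Proof.
have r1P : fps_ord rho 1 by split=> // -[].
have tk : fps_ord (fps_t F ^+ k) k.
  by split=> [|i ik]; rewrite fps_tXE ?eqxx ?oner_neq0 // ltn_eqF.
by have := fps_comp_ord (ltn0Sn 0) tk r1P; rewrite fps_compXn // fps_comp_t // -gx muln1.
Qed.

(** If the arc is d(phi) with phi of order p >= 2, then x(d) has order q = k/p, and d has an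
    equation of order q in y at x = 0. It vanishes on g too, hence is divisible by the k linear
    factors, which forces an order of at least k. *)
Lemma g_primitive : primitive_arc g.
Proof.
move=> [d [phi [p0 p1 dx dy]]].
have gk := g_ord.
have dn0 : arcx d != 0.
  apply: contraTneq (fps_ord_neq0 gk) => d0; rewrite dx d0.
  by rewrite [fps_comp _ _](rmorph0 (fps_comp_morph p0)) eqxx.
have [q dq] := fps_ord_ex dn0.
have q0 : (0 < q)%N by case: q dq => // -[]; rewrite arcx0 eqxx.
have pn0 : phi != 0.
  apply: contraTneq (fps_ord_neq0 gk) => ph0; rewrite dx ph0 fps_compE negbK.
  have [u uE] : exists u : fps F, arcx d = fps_t F * u.
    have /fps_dvdtP[u uE] : fps_dvd 1 (arcx d) by case=> // _; exact: arcx0.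
    by exists u.
  by rewrite -fps_compE uE fps_compM ?fps0E // fps_comp_t ?fps0E // mul0r.
have [p pP] := fps_ord_ex pn0.
have p2 : (1 < p)%N.
  by case: p pP => [[]|[[]|p]] //; rewrite ?p0 ?p1 eqxx.
have kE : k = (q * p)%N.
  by apply: fps_ord_uniq gk _; rewrite dx; apply: fps_comp_ord => //; exact: ltnW.
have [fd [fd0 fdq]] := arc_equation q0 dq.
have /arc_kernel_dvd[Q QE] : arc_subst fd g = 0.
  by rewrite (arc_subst_comp _ p0 dx dy) fd0 [LHS](rmorph0 (fps_comp_morph p0)).
have := fdq; rewrite -(coef0_infl k) QE rmorphM /= coef0_prod_lin; last first.
  by move=> j; exact: fps_conj0.
have -> : size (index_enum 'I_k) = k by rewrite -[RHS]card_ord cardE enumT.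
by case; rewrite fps_tXM kE ltn_Pmulr // eqxx.
Qed.

Section Reduced.
Variables (u f : fps2 F).
Hypotheses (u0 : u 0%N 0%N != 0) (fE : f = u * f0).

Lemma infl_fE : infl k f = infl k u * \prod_(j < k) fps2_lin (conj j).
Proof. by rewrite fE rmorphM /= f0E. Qed.

Lemma ev_unit_ord N z (w : fps2 F) : w 0%N 0%N != 0 -> fps_ord (fps_ev z (infl N w)) 0.
Proof. by move=> w0; split=> //; rewrite fps_ev_coef00 fps_mapE fps_infl_coef0. Qed.

(** At the conjugate number i only the derivative of its own factor survives, leaving a unit times
    the product of the differences to the other conjugates. *)
Lemma fy_conj_ord i : (i < k)%N ->
  fps_ord (fps_ev (conj i) (infl k (fps2_dy f))) (mu + k.-1).
Proof.
move=> ik; rewrite -(sum_conj_ord k0 el ik) fps2_dy_infl infl_fE.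
rewrite (bigD1 (Ordinal ik)) //= mulrCA fps_derivM fps_deriv_lin mul1r.
have ci0 := fps_conj0 zeta Y0 i.
rewrite fps_evD [X in _ + X]fps_evM // fps_ev_lin // subrr mul0r addr0 fps_evM //.
rewrite -[X in fps_ord _ X]add0n; apply: fps_ordM; first exact: ev_unit_ord.
rewrite (_ : fps_ev _ _ = \prod_(j < k | j != i :> nat) (conj i - conj j)); last first.
  rewrite (eq_bigl (fun j : 'I_k => j != Ordinal ik)) => [|j]; last by rewrite -val_eqE.
  elim/big_rec2: _ => [|j x y _ <-]; first exact: fps_ev1.
  by rewrite fps_evM // fps_ev_lin.
by apply: fps_ord_prod => j ji; apply: (fps_conj_subord k0 zP Y0 el) => //; rewrite eq_sym.
Qed.

(** Each of the k roots contributes mu + k - 1, and the descent from s to x = s^k divides by k. *)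
Lemma f_codim : ideal2_codim f (fps2_dy f) (mu + k.-1).
Proof.
have c1 : ideal2_codim (infl k f) (infl k (fps2_dy f)) (\sum_(z <- zs) (mu + k.-1))%N.
  rewrite {1}infl_fE -(prod_conj (@fps2_lin F)); apply: ideal2_codim_prod.
    by rewrite fps_mapE fps_infl_coef0.
  move=> z /mem_conj[i ik ->]; split; first exact: fps_conj0.
  exact: fy_conj_ord.
have [n nP] := ideal2_codim_infl k0 c1.
rewrite big_const_seq count_predT size_map size_iota iter_addn_0 mulnC.
by move/eqP; rewrite eqn_pmul2l // => /eqP ->.
Qed.

Lemma f_coef0_ord : fps_ord (fps_map (@fps_coef0 F) f) k.
Proof.
rewrite -(coef0_infl k) infl_fE rmorphM /= coef0_prod_lin; last first.
  by move=> j; exact: fps_conj0.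
have -> : size (index_enum 'I_k) = k by rewrite -[RHS]card_ord cardE enumT.
rewrite mulrC; apply/fps_ordP; exists (fps_map (@fps_coef0 F) (infl k u)) => //.
by rewrite !fps_mapE [fps_coef0 _]fps_infl_coef0.
Qed.

(** A common root in F[[x^(1/N)]] and the conjugates in F[[x^(1/k)]] are compared at the level N k.
    The root would be a conjugate, where f_y has finite order. *)
Lemma f_fy_no_common N z : (0 < N)%N -> z 0%N = 0 ->
  fps_ev z (infl N (fps2_dy f)) = 0 -> fps_ev z (infl N f) != 0.
Proof.
move=> N0 z0 fy0; apply/eqP => fz0.
pose z' := fps_infl k z; have z'0 : z' 0%N = 0 by rewrite fps_infl_coef0.
have evz' h : fps_ev z (infl N h) = 0 -> fps_ev z' (infl N (infl k h)) = 0.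
  move=> hz; rewrite (infl_infl _ _ N0) mulnC -(infl_infl _ _ k0).
  by rewrite -(@fps_ev_morph _ _ (@fps_infl F k)) // hz raddf0.
have := evz' _ fz0; rewrite infl_fE rmorphM fps_evM //= => /eqP; rewrite mulf_eq0.
rewrite (infl_infl _ _ N0) (negbTE (fps_ord_neq0 (ev_unit_ord _ _ u0))) /=.
have -> : fps_ev z' (infl N (\prod_(j < k) fps2_lin (conj j))) =
    \prod_(j < k) (z' - fps_infl N (conj j)).
  rewrite rmorph_prod; elim/big_rec2: _ => [|j x y _ <-]; first exact: fps_ev1.
  by rewrite fps_evM //= fps_map_lin fps_ev_lin.
move=> /prodf_eq0[j _]; rewrite subr_eq0 => /eqP zj.
have := evz' _ fy0; rewrite zj -fps_ev_morph ?fps_infl_coef0 ?fps_conj0 //=.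
move/eqP; rewrite -(raddf0 (@fps_infl F N)) (inj_eq (@fps_infl_inj _ _ N0)) => /eqP e0.
by have := fps_ord_neq0 (fy_conj_ord (ltn_ord j)); rewrite e0 eqxx.
Qed.

Lemma milnor_codim : ideal2_codim (fps2_dx f) (fps2_dy f) mu.
Proof.
have [n nP /eqP] := polar_codim k0 f_coef0_ord f_fy_no_common f_codim.
by rewrite eqn_add2r => /eqP ->.
Qed.

End Reduced.

(** f and f0 divide each other, so the quotient is a unit; this makes [milnor] independent of the
    reduced equation. *)
Lemma reduced_unit f : reduced_equation g f -> exists2 u : fps2 F, u 0%N 0%N != 0 & f = u * f0.
Proof.
move=> fr; have [u fE] : exists u, f = u * f0.
  by apply/f0_reduced/fr; exists 1; rewrite mul1r.
have [v f0E'] : exists v, f0 = v * f by apply/fr/f0_reduced; exists 1; rewrite mul1r.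
exists u => //; have f0n0 : f0 != 0.
  apply/eqP => f00; move: f0E; rewrite f00 rmorph0 => /esym/eqP.
  apply/negP/prodf_neq0 => j _; apply/eqP => /(congr1 (fun h : fps2 F => h 1%N)).
  by rewrite fpsBE fpsCE fps0E subr0 /=; apply/eqP; exact: oner_neq0.
have : v * u = 1 by apply: (mulIf f0n0); rewrite -mulrA -fE -f0E' mul1r.
move=> /(congr1 (fun h : fps2 F => h 0%N 0%N)); rewrite !fpsM0 !fps1E /= => vu.
by apply/eqP => u0; move: vu; rewrite u0 mulr0 => /eqP; rewrite eq_sym oner_eq0.
Qed.

Lemma milnor_primitive_normal : milnor g = Some mu.
Proof.
apply: xget_unique.
  exists mu, f0; split=> //; [exact: g_primitive|exact: f0_reduced|].
  by apply: (@milnor_codim 1); rewrite ?mul1r // !fps1E oner_neq0.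
move=> o [n [f [-> _ fr fn]]]; have [u u0 fE] := reduced_unit fr.
by rewrite (ideal2_codim_uniq fn (milnor_codim u0 fE)).
Qed.

End Primitive.

Lemma milnor_primitive g k l : (0 < k)%N -> fps_ord (arcx g) k ->
    char_gcd k (fun i => arc_coef k g i != 0) l = 1%N ->
  milnor g = Some (char_mu k (fun i => arc_coef k g i != 0) l).
Proof.
move=> k0 gk; have [rho [Y [r0 r1 gx gy YE]]] := arc_normal_form k0 gk.
have -> : (fun i => arc_coef k g i != 0) = (fun i => Y i != 0) by apply/funext => i; rewrite YE.
move=> el; have Y0 : Y 0%N = 0 by have := arcy0 g; rewrite gy fps_comp_coef0.
have [zeta zP] := prim_root_exists F k0.
have [f0 f0E] := conj_poly_ex k0 zP Y.
exact: milnor_primitive_normal gx gy zP f0E el.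
Qed.

(** The gcds decrease to a limit e > 1, which divides k and every exponent of Y. Both coordinates
    are then series in rho^e, so the arc is not primitive and [milnor] takes its default value. *)
Lemma milnor_nonprimitive g k : (0 < k)%N -> fps_ord (arcx g) k ->
    (forall l, char_gcd k (fun i => arc_coef k g i != 0) l != 1%N) ->
  milnor g = None.
Proof.
move=> k0 gk; have [rho [Y [r0 r1 gx gy YE]]] := arc_normal_form k0 gk.
have -> : (fun i => arc_coef k g i != 0) = (fun i => Y i != 0) by apply/funext => i; rewrite YE.
move=> e1; have Y0 : Y 0%N = 0 by have := arcy0 g; rewrite gy fps_comp_coef0.
suff [e [e2 ek eY]] : exists e, [/\ (1 < e)%N, (e %| k)%N & forall i, Y i != 0 -> (e %| i)%N].
  apply: xgetPN => o [n [f [_ gp _ _]]]; apply: gp.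
  have e0 : (0 < e)%N by exact: ltnW.
  have t0 : (fps_t F ^+ (k %/ e)) 0%N = 0.
    by rewrite fps_tXE eq_sym gtn_eqF // divn_gt0 // dvdn_leq.
  have Y'0 : fps_sect e 0 Y 0%N = 0 by rewrite /= muln0.
  have re0 : (rho ^+ e) 0%N = 0 by rewrite fpsX0 r0 expr0n gtn_eqF.
  exists (PlaneArc t0 Y'0), (rho ^+ e); split=> //=.
  - by apply: (fps_dvdX r0).
  - by rewrite gx fps_compXn // fps_comp_t // -exprM mulnC divnK.
  have YE' : Y = fps_infl e (fps_sect e 0 Y).
    apply: fpsP => i; rewrite fps_inflE; case: ifP => [/dvdnP[q ->]|ei].
      by rewrite mulnK //= addn0 mulnC.
    by apply/eqP; apply: contrapT => /negP /eY; rewrite ei.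
  have te0 : (fps_t F ^+ e) 0%N = 0 by rewrite fps_tXE eq_sym gtn_eqF.
  rewrite gy {1}YE' (fps_infl_comp _ e0) (fps_compA _ te0 r0).
  by rewrite (fps_compXn _ _ r0) (fps_comp_t r0).
set nz := fun i => Y i != 0 in e1.
(* The limit of the gcds is found as the least value attained. *)
have exv : exists v, `[< exists l, char_gcd k nz l = v >].
  by exists k; apply/asboolP; exists 0%N.
case: (ex_minnP exv) => e /asboolP[l le] emin; exists e; split.
- by rewrite ltn_neqAle eq_sym -{1}le e1 -le char_gcd_gt0.
- by rewrite -le char_gcd_dvdk.
move=> i Yi; have i0 : (0 < i)%N by rewrite lt0n; apply: contraNneq Yi => ->; rewrite Y0.
have : char_gcd k nz (maxn l i) = e.
  apply/eqP; rewrite eqn_leq -{1}le char_gcd_le ?leq_maxl // emin //.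
  by apply/asboolP; exists (maxn l i).
by move=> <-; apply: char_gcd_nz => //; rewrite i0 leq_maxr.
Qed.

End Milnor.

(** * Generating functions of chains of divisors *)

Lemma moebius_mul_prime p c : prime p -> (0 < c)%N -> ~~ (p %| c)%N ->
  moebius (p * c) = - moebius c.
Proof.
move=> pp c0 pc; have p0 := prime_gt0 pp.
have perm : perm_eq (primes (p * c)) (p :: primes c).
  apply: uniq_perm; rewrite /= ?primes_uniq ?andbT ?mem_primes ?pp ?c0 //.
  by move=> q; rewrite primesM // primes_prime // !inE.
have lp q : logn q (p * c) = ((q == p) + logn q c)%N.
  by rewrite lognM // (logn_prime q pp) eq_sym.
rewrite /moebius (perm_all _ perm) (perm_size perm) /= lp eqxx lognE (negbTE pc) !andbF /=.
rewrite (eq_in_all (a2 := fun q => logn q c == 1%N)) => [|q qc].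
  by case: ifP; rewrite ?oppr0 // exprS mulN1r.
rewrite lp; suff -> : (q == p) = false by [].
by apply: contraNF pc => /eqP <-; move: qc; rewrite mem_primes => /and3P[].
Qed.

Lemma moebius_mul_prime0 p c : prime p -> (0 < c)%N -> (p %| c)%N -> moebius (p * c) = 0.
Proof.
move=> pp c0 pc; have p0 := prime_gt0 pp.
have lc : (0 < logn p c)%N by rewrite logn_gt0 mem_primes pp c0 pc.
have lpc : logn p (p * c) = (logn p c).+1 by rewrite lognM // (logn_prime p pp) eqxx.
rewrite /moebius; case: ifP => // /allP /(_ p).
rewrite mem_primes pp muln_gt0 p0 c0 dvdn_mulr // lpc => /(_ isT).
by case: (logn p c) lc.
Qed.

Lemma perm_divisors_mul d h : (0 < d)%N -> (0 < h)%N ->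
  perm_eq [seq b <- divisors (d * h) | (d %| b)%N] [seq (d * c)%N | c <- divisors h].
Proof.
move=> d0 h0; apply: uniq_perm; first by rewrite filter_uniq // divisors_uniq.
  rewrite map_inj_in_uniq ?divisors_uniq // => x y _ _ /eqP.
  by rewrite eqn_pmul2l // => /eqP.
move=> b; rewrite mem_filter -dvdn_divisors ?muln_gt0 ?d0 //.
apply/andP/mapP => [[/dvdnP[c ->]]|[c]].
  by rewrite mulnC dvdn_pmul2l // => ch; exists c; rewrite -?dvdn_divisors.
by rewrite -dvdn_divisors // => ch ->; rewrite dvdn_mulr // dvdn_pmul2l.
Qed.

(** For a prime p and n = p h, the divisors that are multiples of p are the p c with c | h. The term
    of p c cancels that of c when p does not divide c, and is 0 otherwise. *)
Lemma moebius_sum n : (0 < n)%N -> \sum_(c <- divisors n) moebius c = (n == 1%N)%:R.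
Proof.
move=> n0; have [->|n1] := eqVneq n 1%N.
  by rewrite (_ : divisors 1 = [:: 1%N]) // big_seq1.
have n2 : (1 < n)%N by rewrite ltn_neqAle eq_sym n1.
have pp := pdiv_prime n2; set p := pdiv n in pp; have p0 := prime_gt0 pp.
have /dvdnP[h nE] : (p %| n)%N := pdiv_dvd n.
rewrite mulnC in nE; have h0 : (0 < h)%N by move: n0; rewrite nE muln_gt0 => /andP[].
rewrite (bigID (dvdn p)) /= -big_filter nE (perm_big _ (perm_divisors_mul p0 h0)) big_map /=.
rewrite (bigID (dvdn p)) /= big_seq_cond big1 ?add0r => [|c]; last first.
  rewrite -dvdn_divisors // => /andP[ch pc]; rewrite moebius_mul_prime0 //.
  exact: dvdn_gt0 ch.
rewrite -[X in _ + X]big_filter -[X in X + _]big_filter.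
rewrite [X in _ + X](perm_big [seq c <- divisors h | ~~ (p %| c)%N]) /=; last first.
  apply: uniq_perm; rewrite ?filter_uniq ?divisors_uniq // => c.
  rewrite !mem_filter -!dvdn_divisors ?muln_gt0 ?p0 //; case pc: (p %| c)%N => //=.
  by rewrite Gauss_dvdr // coprime_sym prime_coprime // pc.
rewrite -big_split big_seq big1 // => c.
rewrite mem_filter -dvdn_divisors // => /andP[pc ch].
by rewrite /= moebius_mul_prime // ?addNr //; exact: dvdn_gt0 ch.
Qed.

Lemma moebius_sum_between d g : (0 < d)%N -> (0 < g)%N ->
  \sum_(b <- divisors g | (d %| b)%N) moebius (b %/ d) = (d == g)%:R.
Proof.
move=> d0 g0; case dg: (d %| g)%N; last first.
  rewrite big_seq_cond big1 => [|b]; last first.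
    rewrite -dvdn_divisors // => /andP[bg db]; by rewrite (dvdn_trans db bg) in dg.
  by case: eqP => // e; rewrite e dvdnn in dg.
have /dvdnP[h gE] := dg; rewrite mulnC in gE.
have h0 : (0 < h)%N by move: g0; rewrite gE muln_gt0 => /andP[].
rewrite -big_filter gE (perm_big _ (perm_divisors_mul d0 h0)) big_map.
under eq_bigr do rewrite mulKn //.
by rewrite moebius_sum // -{1}[d]muln1 eqn_pmul2l // eq_sym.
Qed.

Section GcdSums.
Variable S : comPzRingType.
Implicit Types (z w : S) (C : nat -> S).

(** The indicator of gcd(e, r) = d is the sum of moebius(b/d) over the b with d | b | gcd(e, r).
    Exchanging the sums leaves, for each b, a sum over its multiples r. *)
Lemma sum_gcd_moebius C z e : (0 < e)%N ->
  \sum_(1 <= r < e) z ^+ r * C (gcdn e r) =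
  \sum_(d <- divisors e) \sum_(b <- divisors e | (d %| b)%N)
    (moebius (b %/ d))%:~R * C d * (\sum_(1 <= r < e | (b %| r)%N) z ^+ r).
Proof.
move=> e0.
transitivity (\sum_(1 <= r < e) \sum_(d <- divisors e) \sum_(b <- divisors e | (d %| b)%N)
    if (b %| r)%N then (moebius (b %/ d))%:~R * (C d * z ^+ r) else 0); last first.
  rewrite exchange_big; apply: eq_bigr => d _; rewrite exchange_big; apply: eq_bigr => b _.
  by rewrite mulr_sumr [RHS]big_mkcond; apply: eq_bigr => r _; rewrite mulrA.
rewrite big_seq [RHS]big_seq; apply: eq_bigr => r; rewrite mem_index_iota => /andP[r0 re].
have g0 : (0 < gcdn e r)%N by rewrite gcdn_gt0 e0.
rewrite mulrC.
transitivity (\sum_(d <- divisors e) (if d == gcdn e r then C d * z ^+ r else 0)).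
  rewrite (bigD1_seq (gcdn e r)) ?divisors_uniq //=; last by rewrite -dvdn_divisors // dvdn_gcdl.
  by rewrite eqxx big1 ?addr0 // => d /negbTE ->.
rewrite big_seq [RHS]big_seq; apply: eq_bigr => d; rewrite -dvdn_divisors // => de.
have d0 : (0 < d)%N by exact: dvdn_gt0 de.
transitivity ((\sum_(b <- divisors (gcdn e r) | (d %| b)%N) moebius (b %/ d))%:~R * (C d * z ^+ r)).
  by rewrite moebius_sum_between //; case: eqP; rewrite ?mul1r ?mul0r.
pose G b : S := (moebius (b %/ d))%:~R * (C d * z ^+ r).
transitivity (\sum_(b <- divisors (gcdn e r) | (d %| b)%N) G b).
  by rewrite (rmorph_sum (intmul (1 : S))) mulr_suml.
transitivity (\sum_(b <- divisors e | (d %| b)%N && (b %| r)%N) G b); last by rewrite big_mkcondr.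
rewrite -big_filter -[RHS]big_filter; apply: perm_big; apply: uniq_perm;
  rewrite ?filter_uniq ?divisors_uniq // => b.
by rewrite !mem_filter -!dvdn_divisors // dvdn_gcd -andbA [(b %| r)%N && _]andbC.
Qed.

(** The finite geometric sum z^b + ... + z^(b(q-1)), multiplied by 1 - z^b to avoid a division. *)
Lemma sum_multiples z b q : (0 < b)%N -> (0 < q)%N ->
  (1 - z ^+ b) * (\sum_(1 <= r < b * q | (b %| r)%N) z ^+ r) = z ^+ b * (1 - z ^+ (b * q - b)).
Proof.
move=> b0; elim: q => // -[|q] IH _.
  rewrite muln1 subnn expr0 subrr mulr0 big_nat_cond big1 ?mulr0 // => r.
  by move=> /andP[/andP[r0 rb]]; rewrite gtnNdvd.
have -> : (b * q.+2 = b * q.+1 + b)%N by rewrite mulnS addnC.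
rewrite (@big_cat_nat _ _ _ (b * q.+1)) ?leq_addr ?muln_gt0 ?b0 //=.
rewrite mulrDr IH // addnK.
rewrite (@big_ltn_cond _ _ _ (b * q.+1)); last by rewrite -addn1 leq_add2l.
rewrite dvdn_mulr // big_nat_cond big1 ?addr0 => [|r]; last first.
  move=> /andP[/andP[r1 r2]] /dvdnP[s rE]; move: r1 r2.
  rewrite rE [(s * b)%N]mulnC addnC -mulnS ltn_pmul2l // ltn_pmul2l //.
  by rewrite ltnS => qs; rewrite leqNgt qs.
have -> : (b * q.+1 - b = b * q)%N by rewrite mulnS addKn.
rewrite [z ^+ (b * q.+1)](_ : _ = z ^+ b * z ^+ (b * q)); last by rewrite -exprD mulnS.
by ring.
Qed.

End GcdSums.

Section LevelGf.
Variable R : comPzRingType.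
Variable lam : R.
Local Notation t := (fps_t R).
Local Notation Lam := (fpsC lam).
Local Notation W := (fpsC (1 - lam)).

(* The generating function of the Milnor number over the next M coefficients
   b_i, b_(i+1), ..., once the gcd of the exponents met so far is e. *)
Fixpoint level_gf M e i : fps R :=
  if M is M'.+1 then
    Lam * level_gf M' e i.+1 + W * t ^+ (i.-1 * (e - gcdn e i)) * level_gf M' (gcdn e i) i.+1
  else if e == 1%N then 1 else 0.

Lemma level_gf0 e i : level_gf 0 e i = if e == 1%N then 1 else 0.
Proof. by []. Qed.

Lemma level_gfS M e i : level_gf M.+1 e i =
  Lam * level_gf M e i.+1 + W * t ^+ (i.-1 * (e - gcdn e i)) * level_gf M (gcdn e i) i.+1.
Proof. by []. Qed.

Lemma LamW : Lam + W = 1.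
Proof. by rewrite -rmorphD addrC subrK rmorph1. Qed.

Lemma level_gf1 M i : level_gf M 1 i = 1.
Proof.
elim: M i => [|M IH] i //; rewrite level_gfS gcd1n subnn muln0 expr0 mulr1 !IH !mulr1.
exact: LamW.
Qed.

(** A drop of the gcd at an index j costs at least t^(j-1), so the indices from i + M on cannot
    affect the coefficients below i - 1 + M. *)
Lemma level_gf_stable M e i n : (0 < e)%N -> (0 < i)%N -> (n < i.-1 + M)%N ->
  level_gf M.+1 e i n = level_gf M e i n.
Proof.
elim: M e i n => [|M IH] e i n e0 i0 niM.
  have [->|e1] := eqVneq e 1%N; first by rewrite !level_gf1.
  rewrite level_gfS !level_gf0 (negbTE e1) mulr0 add0r; case: eqP => g1; last by rewrite mulr0.
  rewrite mulr1 g1 fpsCM fps_tXE fps0E ltn_eqF ?mulr0 //.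
  rewrite addn0 in niM; apply: leq_trans niM _; rewrite -{1}[i.-1]muln1 leq_mul2l.
  by rewrite subn_gt0 ltn_neqAle (eq_sym 1%N) e1 e0 orbT.
have g0 : (0 < gcdn e i)%N by rewrite gcdn_gt0 e0.
rewrite level_gfS [in RHS]level_gfS !fpsDE !fpsCM -!mulrA !fpsCM.
rewrite IH //; last by rewrite /= -addSnnS prednK in niM *.
congr (_ + _ * _); apply: fps_agreeM => // j jn; apply: IH => //.
by rewrite /=; apply: leq_ltn_trans jn _; rewrite -addSnnS prednK in niM.
Qed.

Lemma level_gf_stableW M M' e i n : (0 < e)%N -> (0 < i)%N -> (n < i.-1 + M)%N -> (M <= M')%N ->
  level_gf M' e i n = level_gf M e i n.
Proof.
move=> e0 i0 niM; elim: M' => [|M' IH]; first by rewrite leqn0 => /eqP ->.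
rewrite leq_eqVlt => /orP[/eqP -> //|]; rewrite ltnS => MM'.
by rewrite level_gf_stable ?IH // (leq_trans niM) // leq_add2l.
Qed.

(** The coefficientwise limit for large M: by [level_gf_stable], level n + 1 settles the coefficient
    n for all e, i >= 1. *)
Definition limit_gf e i : fps R := FPS (fun n => level_gf n.+1 e i n).

Lemma limit_gf_coef e i n : limit_gf e i n = level_gf n.+1 e i n.
Proof. by []. Qed.

Lemma limit_gfE M e i n : (0 < e)%N -> (0 < i)%N -> (n < i.-1 + M)%N ->
  limit_gf e i n = level_gf M e i n.
Proof.
move=> e0 i0 niM; rewrite limit_gf_coef.
have [nM|/ltnW Mn] := leqP n.+1 M; last exact: level_gf_stableW.
by apply/esym/level_gf_stableW; rewrite // addnS ltnS leq_addl.
Qed.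

Lemma limit_gf1 i : limit_gf 1 i = 1.
Proof. by apply: fpsP => n; rewrite [LHS]/(level_gf n.+1 1 i n) level_gf1. Qed.

Lemma limit_gf_rec e i : (0 < e)%N -> (0 < i)%N -> limit_gf e i =
  Lam * limit_gf e i.+1 + W * t ^+ (i.-1 * (e - gcdn e i)) * limit_gf (gcdn e i) i.+1.
Proof.
move=> e0 i0; apply: fpsP => n.
have g0 : (0 < gcdn e i)%N by rewrite gcdn_gt0 e0.
rewrite (@limit_gfE n.+2) //; last by rewrite addnS ltnS ltnW // addnS ltnS leq_addl.
rewrite level_gfS !fpsDE; congr (_ + _); apply: fps_agreeM => // j jn; apply/esym/limit_gfE => //.
  by rewrite addnS ltnS (leq_trans jn) // leq_addl.
by rewrite addnS ltnS (leq_trans jn) // leq_addl.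
Qed.

(** A shift by a multiple d of e changes no gcd and adds d (e' - e'') to the exponent at each drop
    from e' to e''. All walks that count end at 1, so the total is d (e - 1). *)
Lemma level_gf_shift M e i d : (0 < e)%N -> (0 < i)%N -> (e %| d)%N ->
  level_gf M e (i + d) = t ^+ (d * e.-1) * level_gf M e i.
Proof.
elim: M e i => [|M IH] e i e0 i0 ed.
  by rewrite !level_gf0; case: eqP => [->|_]; rewrite ?muln0 ?mulr1 // mulr0.
have gE : gcdn e (i + d) = gcdn e i.
  apply/eqP; rewrite eqn_dvd !dvdn_gcd !dvdn_gcdl /=.
  rewrite dvdn_add ?dvdn_gcdr ?(dvdn_trans (dvdn_gcdl _ _) ed) // andbT.
  by rewrite -(dvdn_addl (n := d)) ?dvdn_gcdr // (dvdn_trans (dvdn_gcdl _ _) ed).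
have g0 : (0 < gcdn e i)%N by rewrite gcdn_gt0 e0.
have ge : (gcdn e i <= e)%N by rewrite dvdn_leq // dvdn_gcdl.
rewrite !level_gfS gE -!addSn !IH //; last exact: dvdn_trans (dvdn_gcdl _ _) ed.
have E : ((i + d).-1 * (e - gcdn e i) + d * (gcdn e i).-1 =
    d * e.-1 + i.-1 * (e - gcdn e i))%N.
  have -> : ((i + d).-1 = i.-1 + d)%N by move: i0; clear; case: i.
  rewrite mulnDl -addnA [RHS]addnC; congr addn; rewrite -mulnDr; congr muln.
  by move: g0 ge; clear; lia.
rewrite mulrDr; congr (_ + _); first by rewrite mulrCA.
by rewrite -!mulrA [in LHS](mulrA (t ^+ _)) -exprD E exprD; ring.
Qed.

Lemma limit_gf_shift e i d : (0 < e)%N -> (0 < i)%N -> (e %| d)%N ->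
  limit_gf e (i + d) = t ^+ (d * e.-1) * limit_gf e i.
Proof.
move=> e0 i0 ed; apply: fpsP => n; rewrite limit_gf_coef level_gf_shift //; apply: fps_agreeM => // j jn; apply/esym/limit_gfE => //.
by rewrite addnS ltnS (leq_trans jn) // leq_addl.
Qed.

Lemma limit_gf_unroll e j : (0 < e)%N -> limit_gf e 1 =
  \sum_(1 <= r < j.+1) Lam ^+ r.-1 * W * t ^+ (r.-1 * (e - gcdn e r)) * limit_gf (gcdn e r) r.+1
  + Lam ^+ j * limit_gf e j.+1.
Proof.
move=> e0; elim: j => [|j IH]; first by rewrite big_geq // add0r mul1r.
rewrite IH [X in _ = X + _]big_nat_recr // -[RHS]addrA; congr (_ + _).
by rewrite (limit_gf_rec e0 (ltn0Sn j)) mulrDr addrC exprSr /= !mulrA.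
Qed.

(* The generating function of all continuations, normalised so that it obeys
   a recursion over the possible next gcds. *)
Definition chain_gf e : fps R := t ^+ e.-1 * limit_gf e 1.

Lemma chain_gf1 : chain_gf 1 = 1.
Proof. by rewrite /chain_gf limit_gf1 mulr1. Qed.

Lemma chain_gf_rec e : (0 < e)%N ->
  (1 - t ^+ (e * e.-1) * Lam ^+ e.-1) * chain_gf e =
  \sum_(1 <= r < e) Lam ^+ r.-1 * W * t ^+ (r * e.-1) * chain_gf (gcdn e r).
Proof.
move=> e0; rewrite mulrBl mul1r {1}/chain_gf (limit_gf_unroll e.-1 e0) prednK //.
(* At index e the gcd is still e, so both branches coincide and their weights add up to 1; what
   remains is a shift by e. *)
have -> : limit_gf e e = t ^+ (e * e.-1) * limit_gf e 1.
  rewrite (limit_gf_rec e0 e0) gcdnn subnn muln0 expr0 mulr1 -mulrDl LamW mul1r.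
  by rewrite -add1n limit_gf_shift.
rewrite mulrDr /chain_gf.
have -> : t ^+ e.-1 * (Lam ^+ e.-1 * (t ^+ (e * e.-1) * limit_gf e 1)) =
    t ^+ (e * e.-1) * Lam ^+ e.-1 * (t ^+ e.-1 * limit_gf e 1) by ring.
rewrite addrK mulr_sumr big_seq [RHS]big_seq; apply: eq_bigr => r.
rewrite mem_index_iota => /andP[r0 re].
have g0 : (0 < gcdn e r)%N by rewrite gcdn_gt0 e0.
have ge : (gcdn e r <= e)%N by rewrite dvdn_leq // dvdn_gcdl.
rewrite -add1n limit_gf_shift ?dvdn_gcdr //.
(* The reason for the factor t^(e-1) in [chain_gf]: once it is included, the power of t in front of
   the next [chain_gf] does not depend on the gcd. *)
have E : (e.-1 + (r.-1 * (e - gcdn e r) + r * (gcdn e r).-1) = r * e.-1 + (gcdn e r).-1)%N.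
  have [g gE] : exists g, gcdn e r = g.+1 by exists (gcdn e r).-1; rewrite prednK.
  have [s sE] : exists s, r = s.+1 by exists r.-1; rewrite prednK.
  have [f fE] : exists f, e = (g + f).+1 by exists (e - gcdn e r)%N; rewrite gE; move: ge; rewrite gE; clear; lia.
  by rewrite gE {}fE {}sE /= subSS addKn; clear; nia.
transitivity (Lam ^+ r.-1 * W * t ^+ (e.-1 + (r.-1 * (e - gcdn e r) + r * (gcdn e r).-1)) *
    limit_gf (gcdn e r) 1); first by rewrite !exprD; ring.
by rewrite E exprD; ring.
Qed.

(** With a = gcd(k, m), the identity (m-1)(k-a) + m(a-1) = (k-1)(m-1) + (a-1) produces the prefactor
    t^((k-1)(m-1)) of the theorem. Level n suffices for the coefficient n because the indices start
    at m + 1. *)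
Lemma level_gf_chain m k n : (0 < m)%N -> (0 < k)%N ->
  (t ^+ (m.-1 * (k - gcdn k m)) * level_gf n (gcdn k m) m.+1) n =
  (t ^+ (k.-1 * m.-1) * chain_gf (gcdn k m)) n.
Proof.
move=> m0 k0; have a0 : (0 < gcdn k m)%N by rewrite gcdn_gt0 k0.
have ak : (gcdn k m <= k)%N by rewrite dvdn_leq // dvdn_gcdl.
transitivity ((t ^+ (m.-1 * (k - gcdn k m)) * limit_gf (gcdn k m) m.+1) n).
  apply: fps_agreeM => // j jn; apply/esym/limit_gfE => //=.
  by rewrite -{1}[j]add0n -addSn leq_add.
rewrite -add1n limit_gf_shift ?dvdn_gcdr // /chain_gf !mulrA -!exprD.
congr (fcoef (_ ^+ _ * _) n).
have [g gE] : exists g, gcdn k m = g.+1 by exists (gcdn k m).-1; rewrite prednK.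
have [s sE] : exists s, m = s.+1 by exists m.-1; rewrite prednK.
have [f fE] : exists f, k = (g + f).+1.
  by exists (k - gcdn k m)%N; rewrite gE; move: ak; rewrite gE; clear; lia.
by rewrite gE fE sE /= subSS addKn; clear; nia.
Qed.

End LevelGf.

Section ChainStep.
Variable R : comPzRingType.
Variables lam ell : R.
Hypothesis ell_lam : ell * lam = 1.
Local Notation t := (fps_t R).
Local Notation Lam := (fpsC lam).

(** The factor of the theorem at (a_(j-1), a_j, b_j), with [lam] for L^-1, [ell] for L and only
    natural exponents. *)
Definition chain_factor (a0 a1 b : nat) : fps R :=
  (moebius (b %/ a0))%:~R *
  ((fpsC ell - 1) * t ^+ ((a1 - 1) * b) * Lam ^+ b *
   (1 - t ^+ ((a1 - 1) * (a1 - b)) * Lam ^+ (a1 - b))) *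
  fps_geom (t ^+ (a1 * (a1 - 1)) * Lam ^+ (a1 - 1)) *
  fps_geom (t ^+ ((a1 - 1) * b) * Lam ^+ b).

(** Lets the sums run over all b dividing e: the case b = e, excluded by b_j < a_j in the theorem,
    adds nothing. *)
Lemma chain_factor_diag d e : chain_factor d e e = 0.
Proof.
rewrite /chain_factor subnn muln0.
by move: (_%:~R : fps R) (fps_geom _) (fps_geom _) (fpsC ell) => *; ring.
Qed.

Lemma fps_geom_tX n c : (0 < n)%N -> (1 - t ^+ n * c) * fps_geom (t ^+ n * c) = 1.
Proof. by move=> n0; apply: fps_geomP; rewrite fps_tXM n0. Qed.

Lemma chain_gf_step e : (1 < e)%N -> chain_gf lam e =
  \sum_(d <- divisors e) \sum_(b <- divisors e | (d %| b)%N)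
    chain_factor d e b * chain_gf lam d.
Proof.
move=> e1; have e0 := ltnW e1; have e10 : (0 < e - 1)%N by rewrite subn_gt0.
pose g := fps_geom (t ^+ (e * (e - 1)) * Lam ^+ (e - 1)).
have gP : (1 - t ^+ (e * (e - 1)) * Lam ^+ (e - 1)) * g = 1.
  by apply: fps_geom_tX; rewrite muln_gt0 e0.
rewrite -[LHS]mul1r -gP mulrAC !subn1 chain_gf_rec // mulrC.
(* As 1 - L^-1 = (L - 1) L^-1, the weight L^-(r-1) (1 - L^-1) t^(r(e-1)) of the index r is (L - 1)
   z^r. *)
pose z := t ^+ e.-1 * Lam.
transitivity (g * (fpsC ell - 1) * \sum_(1 <= r < e) z ^+ r * chain_gf lam (gcdn e r)).
  rewrite -mulrA; congr (_ * _); rewrite mulr_sumr big_seq [RHS]big_seq.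
  apply: eq_bigr => -[|r]; rewrite mem_index_iota // => _.
  rewrite /z exprMn -exprM mulnC.
  have -> : fpsC (1 - lam) = (fpsC ell - 1) * Lam.
    rewrite mulrBl -rmorphM ell_lam rmorph1 mul1r; exact: (rmorphB (@fpsC R)).
  by rewrite [r.+1.-1]/= exprSr; ring.
rewrite sum_gcd_moebius // mulr_sumr big_seq [RHS]big_seq; apply: eq_bigr => d.
rewrite -dvdn_divisors // => de; rewrite mulr_sumr big_seq_cond [RHS]big_seq_cond.
apply: eq_bigr => b /andP[]; rewrite -dvdn_divisors // => be db.
have b0 : (0 < b)%N by exact: dvdn_gt0 be.
have [q eq] := dvdnP be; have q0 : (0 < q)%N by move: e0; rewrite eq; case: q {eq}.
have := sum_multiples z b0 q0; rewrite mulnC -eq => smz.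
have zE n : z ^+ n = t ^+ ((e - 1) * n) * Lam ^+ n by rewrite /z exprMn -exprM subn1.
have hP : (1 - z ^+ b) * fps_geom (z ^+ b) = 1.
  by rewrite zE; apply: fps_geom_tX; rewrite muln_gt0 e10.
have {}smz : \sum_(1 <= r < e | (b %| r)%N) z ^+ r =
    fps_geom (z ^+ b) * (z ^+ b * (1 - z ^+ (e - b))).
  by rewrite -smz mulrA [X in _ = X * _]mulrC hP mul1r.
rewrite smz /chain_factor -/g -!(mulrA _ (t ^+ _)) -!zE.
move: (_%:~R : fps R) (fpsC ell) (fps_geom _) (chain_gf lam d) => u1 u2 u3 u4; ring.
Qed.

End ChainStep.

(** * Unrolling the recursion into sums over tuples *)

Section ChainSums.
Variables (S : comPzRingType) (M : nat) (fac : nat -> nat -> nat -> S).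

Definition chain_step (d b x : nat) : bool :=
  [&& (d <= b)%N, (b < x)%N, (d %| b)%N & (b %| x)%N].

Definition chain_kernel (d x : nat) : S := \sum_(b < M.+1 | chain_step d b x) fac d x b.

Fixpoint chain_sum (r x : nat) : S :=
  if r is r'.+1 then \sum_(d < M.+1) chain_sum r' d * chain_kernel d x else (x == 1%N)%:R.

Lemma sum_divisors (P : pred nat) (G : nat -> S) e : (0 < e <= M)%N ->
  \sum_(d <- divisors e | P d) G d = \sum_(d < M.+1 | (d %| e)%N && P d) G d.
Proof.
move=> /andP[e0 eM]; rewrite -(big_mkord (fun d => (d %| e)%N && P d)).
rewrite -[LHS]big_filter -[RHS]big_filter; apply: perm_big.
apply: uniq_perm; rewrite ?filter_uniq ?divisors_uniq ?iota_uniq // => d.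
rewrite !mem_filter -dvdn_divisors // mem_index_iota andbC -andbA.
case: (boolP (d %| e)%N) => //= de; case: (P d) => //=.
by rewrite ltnS (leq_trans (dvdn_leq e0 de)).
Qed.

Lemma chain_sumE (C : nat -> S) : C 1%N = 1 ->
  (forall e, (1 < e)%N -> C e =
    \sum_(d <- divisors e) \sum_(b <- divisors e | (d %| b)%N) fac d e b * C d) ->
  (forall d e, fac d e e = 0) ->
  forall N x, (0 < x <= N)%N -> (x <= M)%N -> \sum_(r < N) chain_sum r x = C x.
Proof.
move=> C1 CE fac0; elim=> [|N IH] x /andP[x0 xN] xM; first by case: x x0 xN {xM}.
rewrite big_ord_recl [chain_sum _ _]/=.
have [-> {x x0 xN xM}|x1] := eqVneq x 1%N.
  rewrite C1 big1 ?addr0 // => r _; rewrite [chain_sum _ _]/= big1 // => d _.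
  rewrite /chain_kernel big1 ?mulr0 // => b /and4P[_ + _]; rewrite dvdn1 => + /eqP bE.
  by rewrite bE.
have {}x1 : (1 < x)%N by rewrite ltn_neqAle eq_sym x1.
transitivity (\sum_(d < M.+1) (\sum_(r < N) chain_sum r d) * chain_kernel d x).
  by rewrite add0r exchange_big; apply: eq_bigr => d _; rewrite mulr_suml.
rewrite CE // sum_divisors ?x0 // [RHS]big_mkcond; apply: eq_bigr => d _.
rewrite andbT; case: (boolP (d %| x)%N) => dx; last first.
  rewrite [chain_kernel d x]big1 ?mulr0 // => b /and4P[_ _ db bx].
  by rewrite (dvdn_trans db bx) in dx.
have d0 : (0 < d)%N := dvdn_gt0 x0 dx.
rewrite sum_divisors ?x0 // (bigID (fun b : 'I_M.+1 => b == x :> nat)).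
rewrite [X in _ = X + _]big1 => [|b /andP[_ /eqP ->]]; last by rewrite fac0 mul0r.
rewrite add0r /chain_kernel mulr_sumr; apply: eq_big => [b|b /and4P[db bx _ _]].
  rewrite /chain_step; case: (boolP (d %| b)%N); rewrite ?andbF // => db.
  case: (boolP (b %| x)%N); rewrite ?andbF ?andbT //= => bx.
  by rewrite (dvdn_leq (dvdn_gt0 x0 bx) db) ltn_neqAle (dvdn_leq x0 bx) andbT.
have dN : (d <= N)%N by rewrite -ltnS (leq_trans _ xN) // (leq_ltn_trans db).
by rewrite mulrC IH ?d0 ?dN // -ltnS ltn_ord.
Qed.

Section Rcons.
Variables (X : finType) (n : nat).

Definition ffun_rcons (A : {ffun 'I_n -> X}) (x : X) : {ffun 'I_n.+1 -> X} :=
  [ffun i => if unlift ord_max i is Some j then A j else x].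

Lemma ffun_rcons_lt A x (i : 'I_n.+1) (j : 'I_n) : i = j :> nat -> ffun_rcons A x i = A j.
Proof.
move=> ij; have -> : i = lift ord_max j by apply: val_inj; rewrite /= ij /bump leqNgt ltn_ord.
by rewrite ffunE liftK.
Qed.

Lemma ffun_rcons_max A x : ffun_rcons A x ord_max = x.
Proof. by rewrite ffunE unlift_none. Qed.

Lemma big_ffun_rcons (G : {ffun 'I_n.+1 -> X} -> S) :
  \sum_A G A = \sum_(A : {ffun 'I_n -> X}) \sum_x G (ffun_rcons A x).
Proof.
rewrite pair_big; apply: (reindex (fun p => ffun_rcons p.1 p.2)).
exists (fun A : {ffun 'I_n.+1 -> X} => ([ffun j : 'I_n => A (lift ord_max j)], A ord_max)) => [[A x] _|A _] /=.
  congr pair; last exact: ffun_rcons_max.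
  by apply/ffunP => j; rewrite ffunE (@ffun_rcons_lt _ _ _ j) //= /bump leqNgt ltn_ord.
apply/ffunP => i; rewrite ffunE; case: unliftP => [j ->|-> //]; by rewrite ffunE.
Qed.

End Rcons.

(** An arbitrary weight [Phi] of the end point makes the induction on the length possible: the last
    step is absorbed into the weight. *)
Lemma chain_sum_paths r (Phi : 'I_M.+1 -> S) :
  \sum_(A : {ffun 'I_r.+1 -> 'I_M.+1} | A ord0 == 1%N :> nat)
    (\prod_(j < r) chain_kernel (A (widen_ord (leqnSn r) j)) (A (lift ord0 j))) * Phi (A ord_max) =
  \sum_(x < M.+1) chain_sum r x * Phi x.
Proof.
elim: r Phi => [|r IH] Phi.
  rewrite big_mkcond (reindex (fun x => [ffun=> x])) /=.
    apply: eq_bigr => x _; rewrite !ffunE big_ord0 mul1r.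
    by case: (_ == _); rewrite ?mul1r ?mul0r.
  exists (fun A : {ffun 'I_1 -> 'I_M.+1} => A ord0) => [x _|A _]; first by rewrite ffunE.
  by apply/ffunP => i; rewrite ffunE (ord1 i) (ord1 ord0).
rewrite big_mkcond big_ffun_rcons.
transitivity (\sum_(x < M.+1) (\sum_(d < M.+1) chain_sum r d * chain_kernel d x) * Phi x) => //.
under [RHS]eq_bigr do rewrite mulr_suml.
rewrite [RHS]exchange_big.
transitivity (\sum_(d < M.+1) chain_sum r d * (\sum_(x < M.+1) chain_kernel d x * Phi x)); last first.
  by apply: eq_bigr => d _; rewrite mulr_sumr; apply: eq_bigr => x _; rewrite mulrA.
rewrite -(IH (fun d => \sum_(x < M.+1) chain_kernel d x * Phi x)) [RHS]big_mkcond.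
apply: eq_bigr => A _.
transitivity (\sum_(x < M.+1) if A ord0 == 1%N :> nat then
   (\prod_(j < r) chain_kernel (A (widen_ord (leqnSn r) j)) (A (lift ord0 j))) *
   (chain_kernel (A ord_max) x * Phi x) else 0); last first.
  by case: ifP => _; [rewrite mulr_sumr|rewrite big1].
apply: eq_bigr => x _; rewrite (@ffun_rcons_lt _ _ _ _ _ ord0) //; case: ifP => // _.
rewrite big_ord_recr ffun_rcons_max mulrA; congr (_ * _); congr (_ * _).
  apply: eq_bigr => j _; congr chain_kernel.
    by rewrite (@ffun_rcons_lt _ _ _ _ _ (widen_ord (leqnSn r) j)).
  by rewrite (@ffun_rcons_lt _ _ _ _ _ (lift ord0 j)).
congr chain_kernel; first by rewrite (@ffun_rcons_lt _ _ _ _ _ ord_max).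
by rewrite (_ : lift ord0 ord_max = ord_max) ?ffun_rcons_max //; apply: val_inj.
Qed.

(** The weight in [chain_sum_paths] is taken to be the indicator of the end point M, and the product
    over j of the sums over b_j is expanded. *)
Lemma chain_sum_admissible r : \sum_(A : {ffun 'I_r.+1 -> 'I_M.+1})
    \sum_(B : {ffun 'I_r -> 'I_M.+1} | admissible A B)
      \prod_(j < r) fac (A (widen_ord (leqnSn r) j)) (A (lift ord0 j)) (B j) = chain_sum r M.
Proof.
transitivity (\sum_(x < M.+1) chain_sum r x * (x == M :> nat)%:R); last first.
  rewrite (bigD1 ord_max) // eqxx mulr1 big1 => [|x xM]; first exact: addr0.
  by rewrite (negbTE xM : (x == M :> nat) = false) mulr0.
rewrite -(chain_sum_paths r (fun x => (x == M :> nat)%:R)) [RHS]big_mkcond.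
apply: eq_bigr => A _.
pose Q j (b : 'I_M.+1) := chain_step (A (widen_ord (leqnSn r) j)) b (A (lift ord0 j)).
rewrite [X in if _ then X * _ else _](bigA_distr_big_dep Q).
rewrite (eq_bigl (fun B => (A ord0 == 1%N :> nat) && (A ord_max == M :> nat) && (B \in family Q))).
  case: (A ord0 == 1%N :> nat); last by rewrite big_pred0_eq.
  case: (A ord_max == M :> nat); first by rewrite mulr1.
  by rewrite mulr0 big_pred0_eq.
by move=> B; rewrite /admissible -andbA; congr (_ && (_ && _)).
Qed.

End ChainSums.

From mathcomp Require Import mpoly.
Local Open Scope classical_set_scope.
Local Open Scope ring_scope.

(** * Classes of locally closed sets *)

Section LocallyClosed.
Variable F : closedFieldType.
Implicit Types N M : nat.

Lemma proj_closedI N (C D : set 'rV[F]_N) : proj_closed C -> proj_closed D ->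
  proj_closed (C `&` D).
Proof.
move=> [s [sh ->]] [s' [sh' ->]]; exists (s ++ s'); split.
  by move=> p; rewrite mem_cat => /orP[/sh|/sh'].
apply/seteqP; split=> v /= => [[[v0 vs] [_ vs']]|[v0 vss]].
  by split=> // p; rewrite mem_cat => /orP[/vs|/vs'].
by split; split=> // p ps; apply: vss; rewrite mem_cat ps ?orbT.
Qed.

Lemma proj_closedU N (C D : set 'rV[F]_N) : proj_closed C -> proj_closed D ->
  proj_closed (C `|` D).
Proof.
move=> [s [sh ->]] [s' [sh' ->]]; exists [seq p * q | p <- s, q <- s']; split.
  move=> _ /allpairsP[[p q] /= [/sh[d pd] /sh'[e qe] ->]].
  by exists (d + e)%N; exact: dhomogM.
apply/seteqP; split=> v /=.
  move=> [[v0 vs]|[v0 vs]]; split=> // _ /allpairsP[[p q] /= [ps qs ->]].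
    by rewrite mevalM (vs p) ?mul0r.
  by rewrite mevalM (vs q) ?mulr0.
move=> [v0 vss]; have [vs|] := pselect (forall p, p \in s -> p.@[v 0] = 0); first by left.
move=> /existsNP[p /not_implyP[ps pv]]; right; split=> // q qs.
have := vss (p * q) (allpairs_f _ ps qs); rewrite mevalM => /eqP.
by rewrite mulf_eq0 => /orP[/eqP|/eqP].
Qed.

Lemma locally_closedI N (X Y : set 'rV[F]_N) : locally_closed X -> locally_closed Y ->
  locally_closed (X `&` Y).
Proof.
move=> [C [D [Cc Dc ->]]] [C' [D' [Cc' Dc' ->]]].
exists (C `&` C'), (D `|` D'); split; [exact: proj_closedI|exact: proj_closedU|].
by rewrite !setDE setCU setIACA.
Qed.

Lemma locally_closedIC N (X C : set 'rV[F]_N) : locally_closed X -> proj_closed C ->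
  locally_closed (X `&` C).
Proof.
move=> Xl Cc; apply: locally_closedI => //.
by exists C, set0; split; [|exact: proj_closed0|rewrite setD0].
Qed.

Lemma locally_closedDC N (X C : set 'rV[F]_N) : locally_closed X -> proj_closed C ->
  locally_closed (X `\` C).
Proof.
move=> [C' [D' [Cc' Dc' ->]]] Cc; exists C', (D' `|` C); split=> //; first exact: proj_closedU.
by rewrite setDDl.
Qed.

Definition qcap N (X Y : qvar F N) : qvar F N := QVar (locally_closedI (qsetP X) (qsetP Y)).

Lemma kclass_set N (X Y : qvar F N) : qset X = qset Y -> kclass X = kclass Y.
Proof.
case: X Y => [X Xl] [Y Yl] /= XY; subst Y; congr (kclass (QVar _)); exact: Prop_irrelevance.
Qed.

Lemma kclass_scissor N (X Y Z : qvar F N) (C : set 'rV[F]_N) : proj_closed C ->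
  qset Y = qset X `&` C -> qset Z = qset X `\` C -> kclass X = kclass Y + kclass Z.
Proof.
move=> Cc YE ZE; rewrite [RHS](@sq_addE (kg_setoid F)).
by apply/(@spiP (kg_setoid F)); exact: kg_scissor Cc YE ZE.
Qed.

Lemma kclass0 N (X : qvar F N) : qset X = set0 -> kclass X = 0.
Proof.
move=> X0; have := @kclass_scissor N X X X set0 (proj_closed0 F N).
rewrite X0 setI0 setD0 => /(_ erefl erefl) /eqP.
by rewrite addrC -subr_eq subrr => /eqP <-.
Qed.

Lemma kclass_iso N M (X : qvar F N) (Y : qvar F M) : isomorphic X Y -> kclass X = kclass Y.
Proof. by move=> XY; apply/(@spiP (kg_setoid F)); exact: kg_iso. Qed.

(* Every statement on varieties that is stable under cutting along closed sets
   may be checked on pieces lying inside or outside each of finitely many given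
   closed sets. *)
Lemma qvar_cut_ind N (P : qvar F N -> Prop) (cs : seq (set 'rV[F]_N)) (X : qvar F N) :
    (forall C, C \in cs -> proj_closed C) ->
    (forall (X Y Z : qvar F N) C, proj_closed C -> qset Y = qset X `&` C ->
       qset Z = qset X `\` C -> P Y -> P Z -> P X) ->
    (forall X' : qvar F N, qset X' `<=` qset X ->
       (forall C, C \in cs -> qset X' `<=` C \/ qset X' `&` C = set0) -> P X') ->
  P X.
Proof.
move=> csc Pcut; elim: cs X csc => [|C cs IH] X csc PX; first by apply: PX => // C; rewrite in_nil.
have Cc : proj_closed C by apply: csc; exact: mem_head.
have csc' : forall C, C \in cs -> proj_closed C by move=> C' C'cs; apply: csc; rewrite inE C'cs orbT.
pose Y := QVar (locally_closedIC (qsetP X) Cc); pose Z := QVar (locally_closedDC (qsetP X) Cc).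
apply: (Pcut X Y Z C) => //.
  apply: IH => // X' X'Y X'cs; apply: PX => [|C']; last rewrite inE => /orP[/eqP ->|/X'cs //].
    by move=> v /X'Y[].
  by left=> v /X'Y[].
apply: IH => // X' X'Z X'cs; apply: PX => [|C']; last rewrite inE => /orP[/eqP ->|/X'cs //].
  by move=> v /X'Z[].
by right; apply/seteqP; split=> // v [/X'Z[_ nCv]].
Qed.

(** Both sides are additive under cutting X along a closed set. After cutting along all the closed
    sets that define the Y_i, a nonempty piece lies in one Y_i and misses the others. *)
Lemma kclass_partition N (X : qvar F N) r (Y : 'I_r -> qvar F N) :
    (forall i j, i != j -> qset (Y i) `&` qset (Y j) = set0) ->
    qset X = [set w | exists i, qset (Y i) w] ->
  kclass X = \sum_(i < r) kclass (Y i).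
Proof.
move=> Ydis XE.
have /choice[C CP] : forall i, exists CD : set 'rV[F]_N * set 'rV[F]_N,
    [/\ proj_closed CD.1, proj_closed CD.2 & qset (Y i) = CD.1 `\` CD.2].
  by move=> i; have [C [D CD]] := qsetP (Y i); exists (C, D).
suff : kclass X = \sum_(i < r) kclass (qcap X (Y i)).
  move=> ->; apply: eq_bigr => i _; apply: kclass_set => /=.
  by rewrite setIidr // XE => w Yw; exists i.
pose cs := [seq (C i).1 | i <- enum 'I_r] ++ [seq (C i).2 | i <- enum 'I_r].
have csP D : D \in cs <-> exists i, D = (C i).1 \/ D = (C i).2.
  rewrite mem_cat; split=> [/orP[]/mapP[i _ ->]|[i [->|->]]]; [by exists i; left|by exists i; right| |].
    by apply/orP; left; apply/mapP; exists i; rewrite ?mem_enum.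
  by apply/orP; right; apply/mapP; exists i; rewrite ?mem_enum.
apply: (@qvar_cut_ind N (fun X => kclass X = \sum_(i < r) kclass (qcap X (Y i))) cs).
- by move=> D /csP[i [->|->]]; have [] := CP i.
- move=> X1 Y1 Z1 D Dc Y1E Z1E Y1P Z1P; rewrite (kclass_scissor Dc Y1E Z1E) Y1P Z1P.
  rewrite -big_split; apply: eq_bigr => i _; apply/esym; apply: (@kclass_scissor N _ _ _ D) => //=.
    by rewrite Y1E setIAC.
  by rewrite Z1E !setDE setIAC.
move=> X' X'X X'cs.
have side i : qset X' `<=` qset (Y i) \/ qset X' `&` qset (Y i) = set0.
  have [_ _ YE] := CP i; rewrite YE.
  have [X'C|X'C] : qset X' `<=` (C i).1 \/ qset X' `&` (C i).1 = set0.
      by apply: X'cs; apply/csP; exists i; left.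
    have [X'D|X'D] : qset X' `<=` (C i).2 \/ qset X' `&` (C i).2 = set0.
        by apply: X'cs; apply/csP; exists i; right.
      by right; apply/seteqP; split=> // v [/X'D Dv [_]].
    by left=> v X'v; split; [exact: X'C|move=> Dv; have : set0 v by rewrite -[set0]X'D].
  by right; apply/seteqP; split=> // v [X'v [Cv _]]; rewrite -[set0]X'C.
have [X'0|/set0P[w X'w]] := eqVneq (qset X') set0.
  by rewrite (kclass0 X'0) big1 // => i _; apply: kclass0; rewrite /= X'0 set0I.
have [i Yiw] : exists i, qset (Y i) w by have := X'X _ X'w; rewrite XE.
rewrite (bigD1 i) //= big1 ?addr0 => [|j ji].
  apply: kclass_set => /=; have [X'Y|X'Y] := side i; first by rewrite setIidl.
  by have : set0 w by rewrite -[set0]X'Y.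
apply: kclass0 => /=; have [X'Y|//] := side j.
have : set0 w by rewrite -[set0](Ydis _ _ ji); split=> //; exact: X'Y.
by [].
Qed.

Lemma constr_class_lc N (A : set 'rV[F]_N) (X : qvar F (1 + N)) :
  qset X = aff_cone A -> constr_class A = kclass X.
Proof.
move=> XA; apply: xget_unique => [|c [r [Y [[Ydis AY] ->]]]]; last first.
  by apply/esym/kclass_partition => //; rewrite XA.
exists 1%N, (fun=> X); split; last by rewrite big_ord1.
split=> [i j|]; first by rewrite !ord1 eqxx.
by rewrite -XA; apply/seteqP; split=> [w Xw|w [_ //]]; exists 0.
Qed.

Lemma constructible_lc N (A : set 'rV[F]_N) : locally_closed (aff_cone A) -> constructible A.
Proof.
move=> Al; exists 1%N, (fun=> QVar Al); split=> [i j|]; first by rewrite !ord1 eqxx.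
by apply/seteqP; split=> [w Aw|w [_ //]]; exists 0.
Qed.

Lemma constructible0 N : constructible (set0 : set 'rV[F]_N).
Proof.
have o0 : 'I_0 -> False by case.
exists 0%N, (fun i => False_rect _ (o0 i)); split; first by move=> i; case: (o0 i).
apply/seteqP; split=> w; first by move=> [c [v [_ Av _]]].
by case=> i _; case: (o0 i).
Qed.

End LocallyClosed.

(* Functions on affine space given by polynomials, in homogenised form. *)
Section PolyFun.
Variable F : closedFieldType.

Definition poly_fun_deg N d (g : 'rV[F]_N -> F) : Prop :=
  exists P : {mpoly F[1 + N]}, P \is d.-homog /\
    forall c (v : 'rV[F]_N), P.@[(c *: row_mx 1%:M v) 0] = c ^+ d * g v.

Definition poly_fun N (g : 'rV[F]_N -> F) : Prop := exists d, poly_fun_deg d g.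

Variable N : nat.
Implicit Types g h : 'rV[F]_N -> F.

Lemma dhomogXU n i : ('X_i : {mpoly F[n]}) \is 1.-homog.
Proof. by rewrite dhomogX; apply/eqP; exact: mdeg1. Qed.

Lemma aff_coord0 (c : F) (v : 'rV[F]_N) : (c *: row_mx 1%:M v) 0 (lshift N 0) = c.
Proof. by rewrite mxE row_mxEl mxE eqxx mulr1. Qed.

Lemma aff_coord (c : F) (v : 'rV[F]_N) i : (c *: row_mx 1%:M v) 0 (rshift 1 i) = c * v 0 i.
Proof. by rewrite mxE row_mxEr. Qed.

Lemma aff_neq0 (c : F) (v : 'rV[F]_N) : c != 0 -> c *: row_mx 1%:M v != 0.
Proof. by apply: contra_neq => /rowP/(_ (lshift N 0)); rewrite aff_coord0 mxE. Qed.

Lemma poly_fun_degW d e g : (d <= e)%N -> poly_fun_deg d g -> poly_fun_deg e g.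
Proof.
move=> de [P [Ph PE]]; exists ('X_(lshift N 0) ^+ (e - d) * P); split.
  have Xh : ('X_(lshift N 0) : {mpoly F[1 + N]}) ^+ (e - d) \is (e - d).-homog.
    by rewrite -[X in X.-homog]mul1n; apply: dhomogMn; exact: dhomogXU.
  by have := dhomogM Xh Ph; rewrite subnK.
by move=> c v; rewrite mevalM rmorphXn /= mevalXU aff_coord0 PE mulrA -exprD subnK.
Qed.

Lemma poly_fun_const a : poly_fun (fun _ : 'rV[F]_N => a).
Proof.
exists 0%N, a%:MP; split; last by move=> c v; rewrite mevalC mul1r.
by rewrite -[a%:MP]mulr1 mul_mpolyC; apply: dhomogZ; exact: dhomog1.
Qed.

Lemma poly_fun_coord i : poly_fun (fun v : 'rV[F]_N => v 0 i).
Proof.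
exists 1%N, 'X_(rshift 1 i); split; first exact: dhomogXU.
by move=> c v; rewrite mevalXU aff_coord.
Qed.

Lemma poly_funM g h : poly_fun g -> poly_fun h -> poly_fun (fun v => g v * h v).
Proof.
move=> [d [P [Ph PE]]] [e [Q [Qh QE]]]; exists (d + e)%N, (P * Q); split; first exact: dhomogM.
by move=> c v; rewrite mevalM PE QE exprD mulrACA.
Qed.

Lemma poly_funD g h : poly_fun g -> poly_fun h -> poly_fun (fun v => g v + h v).
Proof.
move=> [d gd] [e he]; exists (d + e)%N.
have [P [Ph PE]] := poly_fun_degW (leq_addr e d) gd.
have [Q [Qh QE]] := poly_fun_degW (leq_addl d e) he.
exists (P + Q); split; first exact: dhomogD.
by move=> c v; rewrite mevalD PE QE mulrDr.
Qed.

Lemma poly_fun_prod (I : Type) (r : seq I) (P : pred I) (g : I -> 'rV[F]_N -> F) :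
  (forall i, poly_fun (g i)) -> poly_fun (fun v => \prod_(i <- r | P i) g i v).
Proof.
move=> gi; elim: r => [|i r IH].
  by under eq_fun do rewrite big_nil; exact: poly_fun_const.
under eq_fun do rewrite big_cons; case: (P i) => //; exact: poly_funM.
Qed.

Lemma poly_fun_common (I : finType) (g : I -> 'rV[F]_N -> F) : (forall i, poly_fun (g i)) ->
  exists d, forall i, poly_fun_deg d (g i).
Proof.
move=> /choice[d dP]; exists (\max_i d i)%N => i; apply: poly_fun_degW (dP i).
exact: (@leq_bigmax _ d).
Qed.

Lemma aff_cone_cap0 (A : set 'rV[F]_N) g : poly_fun g -> locally_closed (aff_cone A) ->
  locally_closed (aff_cone (A `&` [set v | g v = 0])).
Proof.
move=> [d [P [Ph PE]]] Al.
have Pc : proj_closed [set w : 'rV[F]_(1 + N) | w != 0 /\ forall p, p \in [:: P] -> p.@[w 0] = 0].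
  by exists [:: P]; split=> // p; rewrite inE => /eqP ->; exists d.
rewrite (_ : aff_cone _ = aff_cone A `&` [set w : 'rV[F]_(1 + N) | w != 0 /\ forall p, p \in [:: P] -> p.@[w 0] = 0]).
  exact: locally_closedIC.
apply/seteqP; split=> w /=.
  move=> [c [v [c0 [Av gv] ->]]]; split; first by exists c, v.
  split; last by move=> p; rewrite inE => /eqP ->; rewrite PE gv mulr0.
  exact: aff_neq0.
move=> [[c [v [c0 Av ->]]] [_ /(_ P)]]; rewrite inE eqxx PE => /(_ isT)/eqP.
rewrite mulf_eq0 expf_eq0 (negbTE c0) andbF /= => /eqP gv; by exists c, v.
Qed.

Lemma aff_cone_cap_neq0 (A : set 'rV[F]_N) g : poly_fun g -> locally_closed (aff_cone A) ->
  locally_closed (aff_cone (A `&` [set v | g v != 0])).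
Proof.
move=> [d [P [Ph PE]]] Al.
have Pc : proj_closed [set w : 'rV[F]_(1 + N) | w != 0 /\ forall p, p \in [:: P] -> p.@[w 0] = 0].
  by exists [:: P]; split=> // p; rewrite inE => /eqP ->; exists d.
rewrite (_ : aff_cone _ = aff_cone A `\` [set w : 'rV[F]_(1 + N) | w != 0 /\ forall p, p \in [:: P] -> p.@[w 0] = 0]).
  exact: locally_closedDC.
apply/seteqP; split=> w /=.
  move=> [c [v [c0 [Av gv] ->]]]; split; first by exists c, v.
  move=> [_ /(_ P)]; rewrite inE eqxx PE => /(_ isT)/eqP; apply/negP.
  by rewrite mulf_neq0 // expf_neq0.
move=> [[c [v [c0 Av ->]]] nz]; exists c, v; split=> //; split=> //.
apply/eqP => gv; apply: nz; split.
  exact: aff_neq0.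
by move=> p; rewrite inE => /eqP ->; rewrite PE gv mulr0.
Qed.

Lemma aff_coneT : locally_closed (aff_cone (setT : set 'rV[F]_N)).
Proof.
have Pc : proj_closed [set w : 'rV[F]_(1 + N) | w != 0 /\
    forall p, p \in [:: 'X_(lshift N 0)] -> p.@[w 0] = 0].
  by exists [:: 'X_(lshift N 0)]; split=> // p; rewrite inE => /eqP ->; exists 1%N; exact: dhomogXU.
exists [set w : 'rV[F]_(1 + N) | w != 0], [set w : 'rV[F]_(1 + N) | w != 0 /\
    forall p, p \in [:: 'X_(lshift N 0)] -> p.@[w 0] = 0]; split=> //; first exact: proj_closedT.
apply/seteqP; split=> w /=.
  move=> [c [v [c0 _ ->]]]; split.
    exact: aff_neq0.
  move=> [_ /(_ 'X_(lshift N 0))]; rewrite inE eqxx mevalXU aff_coord0 => /(_ isT)/eqP.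
  by rewrite (negbTE c0).
move=> [w0 nz]; have wc : w 0 (lshift N 0) != 0.
  apply/eqP => wc; apply: nz; split=> // p; rewrite inE => /eqP ->; by rewrite mevalXU.
exists (w 0 (lshift N 0)), ((w 0 (lshift N 0))^-1 *: rsubmx w); split=> //.
apply/rowP => i; rewrite -(splitK i); case: (split i) => j /=.
  by rewrite [j]ord1 aff_coord0.
by rewrite aff_coord !mxE mulrA mulfV // mul1r.
Qed.

End PolyFun.

Section RatFun.
Variables (F : closedFieldType) (N : nat) (A : set 'rV[F]_N).
Implicit Types g h : 'rV[F]_N -> F.

Definition rat_fun g : Prop := exists p q, [/\ poly_fun p, poly_fun q &
  forall v, A v -> q v != 0 /\ g v = p v / q v].

Lemma rat_fun_ext g h : (forall v, A v -> g v = h v) -> rat_fun g -> rat_fun h.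
Proof.
move=> gh [p [q [pp qp E]]]; exists p, q; split=> // v Av.
by have [q0 gE] := E v Av; rewrite -gh.
Qed.

Lemma rat_fun_poly g : poly_fun g -> rat_fun g.
Proof.
move=> gp; exists g, (fun=> 1); split=> //; first exact: poly_fun_const.
by move=> v _; rewrite oner_neq0 divr1.
Qed.

Lemma rat_fun_const (a : F) : rat_fun (fun=> a).
Proof. exact/rat_fun_poly/poly_fun_const. Qed.

Lemma rat_fun_coord i : rat_fun (fun v => v 0 i).
Proof. exact/rat_fun_poly/poly_fun_coord. Qed.

Lemma rat_funM g h : rat_fun g -> rat_fun h -> rat_fun (fun v => g v * h v).
Proof.
move=> [p [q [pp qp E]]] [p' [q' [pp' qp' E']]].
exists (fun v => p v * p' v), (fun v => q v * q' v); split; try exact: poly_funM.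
move=> v Av; have [q0 ->] := E v Av; have [q'0 ->] := E' v Av.
by rewrite mulf_neq0 // invfM mulrACA.
Qed.

Lemma rat_funD g h : rat_fun g -> rat_fun h -> rat_fun (fun v => g v + h v).
Proof.
move=> [p [q [pp qp E]]] [p' [q' [pp' qp' E']]].
exists (fun v => p v * q' v + p' v * q v), (fun v => q v * q' v); split.
- by apply: poly_funD; exact: poly_funM.
- exact: poly_funM.
move=> v Av; have [q0 ->] := E v Av; have [q'0 ->] := E' v Av.
by rewrite mulf_neq0 // addf_div.
Qed.

Lemma rat_funN g : rat_fun g -> rat_fun (fun v => - g v).
Proof.
move=> /(rat_funM (rat_fun_const (-1))); apply: rat_fun_ext => v _; exact: mulN1r.
Qed.

Lemma rat_funV g : (forall v, A v -> g v != 0) -> rat_fun g -> rat_fun (fun v => (g v)^-1).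
Proof.
move=> g0 [p [q [pp qp E]]]; exists q, p; split=> // v Av.
have [q0 gE] := E v Av; have := g0 v Av; rewrite gE mulf_eq0 negb_or => /andP[-> _].
by rewrite invf_div.
Qed.

Lemma rat_fun_sum (I : Type) (r : seq I) (P : pred I) (g : I -> 'rV[F]_N -> F) :
  (forall i, rat_fun (g i)) -> rat_fun (fun v => \sum_(i <- r | P i) g i v).
Proof.
move=> gi; elim: r => [|i r IH].
  by under eq_fun do rewrite big_nil; exact: rat_fun_const.
under eq_fun do rewrite big_cons; case: (P i) => //; exact: rat_funD.
Qed.

(** [regular_map] asks for one denominator shared by all coordinates. *)
Lemma rat_fun_common (I : finType) (g : I -> 'rV[F]_N -> F) : (forall i, rat_fun (g i)) ->
  exists (p : I -> 'rV[F]_N -> F) q, [/\ forall i, poly_fun (p i), poly_fun q &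
    forall v, A v -> q v != 0 /\ forall i, g i v = p i v / q v].
Proof.
move=> /choice[p /choice[q E]].
exists (fun i v => p i v * \prod_(j | j != i) q j v), (fun v => \prod_j q j v); split.
- move=> i; apply: poly_funM; first by have [] := E i.
  by apply: poly_fun_prod => j; have [] := E j.
- by apply: poly_fun_prod => j; have [] := E j.
move=> v Av; split=> [|i].
  by apply/prodf_neq0 => j _; have [_ _ /(_ v Av)[]] := E j.
have [_ _ /(_ v Av)[q0 ->]] := E i; rewrite (bigD1 i (P := predT)) //= -mulf_div divff ?mulr1 //.
by apply/prodf_neq0 => j _; have [_ _ /(_ v Av)[]] := E j.
Qed.

End RatFun.

Section AffineIso.
Variable F : closedFieldType.

Definition aff_lift N M (f : 'rV[F]_N -> 'rV[F]_M) (w : 'rV[F]_(1 + N)) : 'rV[F]_(1 + M) :=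
  row_mx 1%:M (f ((w 0 (lshift N 0))^-1 *: rsubmx w)).

Lemma aff_liftE N M (f : 'rV[F]_N -> 'rV[F]_M) c v : c != 0 ->
  aff_lift f (c *: row_mx 1%:M v) = row_mx 1%:M (f v).
Proof.
move=> c0; rewrite /aff_lift aff_coord0; congr (row_mx _ (f _)).
by apply/rowP => i; rewrite 2!mxE aff_coord mulrA mulVf // mul1r.
Qed.

(** The point (1 : p_i/q) equals (q : p_i), and the p_i and q can be homogenised to the same
    degree. *)
Lemma aff_lift_regular N M (A : set 'rV[F]_N) (B : set 'rV[F]_M) (f : 'rV[F]_N -> 'rV[F]_M) :
    (forall v, A v -> B (f v)) -> (forall i, rat_fun A (fun v => f v 0 i)) ->
  regular_map (aff_cone A) (aff_cone B) (aff_lift f).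
Proof.
move=> fAB fr; split.
  move=> _ [c [v [c0 Av ->]]]; rewrite aff_liftE //; exists 1, (f v).
  by rewrite oner_neq0 scale1r; split=> //; exact: fAB.
have [p [q [pp qp E]]] := rat_fun_common fr.
have [d dP] : exists d, poly_fun_deg d q /\ forall i, poly_fun_deg d (p i).
  have [d dP] := @poly_fun_common _ _ _ (fun o : option 'I_M => if o is Some i then p i else q)
    (fun o => match o with Some i => pp i | None => qp end).
  by exists d; split; [exact: (dP None)|move=> i; exact: (dP (Some i))].
have [[Q [Qh QE]] /choice[P PP]] := dP.
move=> _ [c [v [c0 Av ->]]].
exists Q, (fun i => match split i with inl _ => Q | inr j => P j end), d, d; split=> //.
- by move=> i; case: (split i) => // j; have [] := PP j.
- by rewrite QE mulf_neq0 ?expf_neq0 //; case: (E v Av).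
move=> _ [c' [v' [c'0 Av' ->]]] _; rewrite aff_liftE //.
have [q0 fE] := E v' Av'; exists (c' ^+ d * q v'); first by rewrite mulf_neq0 ?expf_neq0.
apply/rowP => i; rewrite !mxE; case: (split i) => j.
  by rewrite QE mxE [j]ord1 eqxx mulr1.
have [_ PE] := PP j.
by rewrite PE fE -mulrA [q v' * _]mulrC mulfVK.
Qed.

Lemma aff_iso N M (A : set 'rV[F]_N) (B : set 'rV[F]_M)
    (f : 'rV[F]_N -> 'rV[F]_M) (g : 'rV[F]_M -> 'rV[F]_N) :
    (forall v, A v -> B (f v)) -> (forall i, rat_fun A (fun v => f v 0 i)) ->
    (forall v, B v -> A (g v)) -> (forall i, rat_fun B (fun v => g v 0 i)) ->
    (forall v, A v -> g (f v) = v) -> (forall v, B v -> f (g v) = v) ->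
  isomorphic (aff_cone A) (aff_cone B).
Proof.
move=> fAB fr gBA gr fK gK; exists (aff_lift f), (aff_lift g); split.
- exact: aff_lift_regular.
- exact: aff_lift_regular.
- move=> _ [c [v [c0 Av ->]]]; rewrite aff_liftE // -[row_mx _ (f v)]scale1r aff_liftE ?oner_neq0 //.
  by exists c^-1; rewrite ?invr_neq0 // fK // scalerA mulVf // scale1r.
- move=> _ [c [v [c0 Av ->]]]; rewrite aff_liftE // -[row_mx _ (g v)]scale1r aff_liftE ?oner_neq0 //.
  by exists c^-1; rewrite ?invr_neq0 // gK // scalerA mulVf // scale1r.
Qed.

End AffineIso.

(** * Products with the affine line *)

Section Product.
Variable F : closedFieldType.

Lemma kclassM N M (X : qvar F N) (Y : qvar F M) (Z : qvar F (N * M)) :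
  qset Z = segre X Y -> kclass X * kclass Y = kclass Z.
Proof.
move=> ZE; rewrite [LHS](@sq_mulE (kg_setoid F)).
by apply/(@spiP (kg_setoid F)); exact: kg_prod.
Qed.

Lemma dhomog_comp n m (p : {mpoly F[n]}) d (s : 'I_n -> 'I_m) : p \is d.-homog ->
  p \mPo [tuple 'X_(s i) | i < n] \is d.-homog.
Proof.
move=> ph; rewrite comp_mpolyE big_seq; apply: rpred_sum => mm mp; apply: dhomogZ.
have -> : d = (\sum_i mm i)%N by rewrite -mdegE; exact/esym/(dhomog_mf ph mp).
elim/big_rec2: _ => [|i k q _ qk]; first exact: dhomog1.
apply: dhomogM => //; rewrite tnth_mktuple -[X in X.-homog]mul1n; apply: dhomogMn.
exact: dhomogXU.
Qed.

Definition sub_coord n m (s : 'I_n -> 'I_m) (z : 'rV[F]_m) : 'rV[F]_n := \row_i z 0 (s i).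

(** The equations are pulled back along a coordinate projection, which is a map of projective spaces
    only where the projected vector is nonzero. *)
Lemma proj_closed_pre n m (s : 'I_n -> 'I_m) (C : set 'rV[F]_n) : proj_closed C ->
  exists2 E, proj_closed E & forall z, sub_coord s z != 0 -> E z <-> C (sub_coord s z).
Proof.
move=> [ps [psh ->]].
have evE (p : {mpoly F[n]}) (z : 'rV[F]_m) :
    (p \mPo [tuple 'X_(s i) | i < n]).@[z 0] = p.@[sub_coord s z 0].
  by rewrite comp_mpoly_meval; apply: meval_eq => i; rewrite tnth_mktuple mevalXU mxE.
exists [set z : 'rV[F]_m | z != 0 /\
  forall p, p \in [seq p \mPo [tuple 'X_(s i) | i < n] | p <- ps] -> p.@[z 0] = 0].
  exists [seq p \mPo [tuple 'X_(s i) | i < n] | p <- ps]; split=> // _ /mapP[p /psh[d pd] ->].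
  by exists d; exact: dhomog_comp.
move=> z sz; split=> /= -[z0 H]; split=> //.
  by move=> p pps; rewrite -evE; apply/H/map_f.
  by apply: contra_neq sz => ->; apply/rowP => i; rewrite !mxE.
by move=> _ /mapP[p pps ->]; rewrite evE H.
Qed.

Lemma locally_closed_pre n m (s : 'I_n -> 'I_m) (X : set 'rV[F]_n) : locally_closed X ->
  exists2 Y, locally_closed Y & forall z, sub_coord s z != 0 -> Y z <-> X (sub_coord s z).
Proof.
move=> [C [D [Cc Dc ->]]].
have [C' C'c C'E] := proj_closed_pre s Cc; have [D' D'c D'E] := proj_closed_pre s Dc.
exists (C' `\` D'); first by exists C', D'.
move=> z sz; split=> -[Cz Dz]; split; first exact/C'E.
- by move=> /(D'E _ sz).
- exact/C'E.
- by move=> /(D'E _ sz).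
Qed.

Lemma locally_closed_coord n (i : 'I_n) : locally_closed [set w : 'rV[F]_n | w 0 i != 0].
Proof.
exists [set w : 'rV[F]_n | w != 0], [set w : 'rV[F]_n | w != 0 /\ forall p, p \in [:: 'X_i] -> p.@[w 0] = 0].
split; first exact: proj_closedT.
  by exists [:: 'X_i]; split=> // p; rewrite inE => /eqP ->; exists 1%N; exact: dhomogXU.
apply/seteqP; split=> w /=.
  move=> wi; split; first by apply: contra_neq wi => ->; rewrite mxE.
  by move=> [_ /(_ 'X_i)]; rewrite inE eqxx mevalXU => /(_ isT)/eqP; rewrite (negbTE wi).
move=> [w0 nz]; apply/eqP => wi; apply: nz; split=> // p; rewrite inE => /eqP ->.
by rewrite mevalXU.
Qed.

Variables (N : nat) (A : set 'rV[F]_N).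
Hypothesis Al : locally_closed (aff_cone A).

Definition aff_prod (S : F -> Prop) : set 'rV[F]_(1 + N) :=
  [set v : 'rV[F]_(1 + N) | S (v 0 (lshift N 0)) /\ A (rsubmx v)].

Lemma aff_coneE (w : 'rV[F]_(1 + N)) :
  aff_cone A w <-> w 0 (lshift N 0) != 0 /\ A ((w 0 (lshift N 0))^-1 *: rsubmx w).
Proof.
split=> [[c [v [c0 Av ->]]]|[w0 Aw]].
  rewrite aff_coord0; split=> //; rewrite (_ : _ *: _ = v) //.
  by apply/rowP => i; rewrite 2!mxE aff_coord mulrA mulVf // mul1r.
exists (w 0 (lshift N 0)), ((w 0 (lshift N 0))^-1 *: rsubmx w); split=> //.
apply/rowP => i; rewrite -(splitK i); case: (split i) => j /=.
  by rewrite [j]ord1 aff_coord0.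
by rewrite aff_coord !mxE mulrA mulfV // mul1r.
Qed.

Let seg (i : 'I_(1 + N)) (j : 'I_2) : 'I_((1 + N) * 2) := mxvec_index i j.

Let j1 : 'I_2 := lift ord0 0.

(** Where the corner coordinate z_00 is nonzero, the 2 x 2 minors through that corner suffice for
    rank one. *)
Lemma segre_mem (z : 'rV[F]_((1 + N) * 2)) :
  segre (aff_cone A) (qline F) z <->
  [/\ z 0 (seg (lshift N 0) 0) != 0,
      forall i j, z 0 (seg i j) * z 0 (seg (lshift N 0) 0) =
        z 0 (seg i 0) * z 0 (seg (lshift N 0) j) &
      aff_cone A (sub_coord (seg^~ 0) z)].
Proof.
split=> [[v [w [Av w0 ->]]]|[z00 rk Az]].
  have E i j : mxvec (v^T *m w) 0 (seg i j) = v 0 i * w 0 j.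
    by rewrite /seg mxvecE mxE big_ord1 mxE.
  have [v0 Av'] := (aff_coneE v).1 Av.
  split; [by rewrite E mulf_neq0|by move=> i j; rewrite !E; ring|].
  rewrite (_ : sub_coord _ _ = w 0 0 *: v); last first.
    by apply/rowP => i; rewrite !mxE E mulrC.
  have [c [a [c0 Aa ->]]] := Av; exists (w 0 0 * c), a; split=> //; first by rewrite mulf_neq0.
  by rewrite scalerA.
pose z00' := z 0 (seg (lshift N 0) 0).
exists (sub_coord (seg^~ 0) z), (\row_j (z 0 (seg (lshift N 0) j) / z00')).
split=> //=; first by rewrite mxE mulfV // oner_neq0.
apply/rowP => k; case/mxvec_indexP: k => i j; rewrite mxvecE mxE big_ord1 !mxE.
by rewrite mulrA -rk mulfK.
Qed.

Lemma segre_lc : locally_closed (segre (aff_cone A) (qline F)).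
Proof.
have [Y Yl YE] := locally_closed_pre (seg^~ 0) Al.
pose q (ij : 'I_(1 + N) * 'I_2) : {mpoly F[(1 + N) * 2]} :=
  'X_(seg ij.1 ij.2) * 'X_(seg (lshift N 0) 0) - 'X_(seg ij.1 0) * 'X_(seg (lshift N 0) ij.2).
pose E := [set z : 'rV[F]_((1 + N) * 2) | z != 0 /\ forall p, p \in map q (enum predT) -> p.@[z 0] = 0].
have Ec : proj_closed E.
  exists (map q (enum predT)); split=> // _ /mapP[ij _ ->]; exists (1 + 1)%N.
  by apply: rpredB; apply: dhomogM; exact: dhomogXU.
rewrite (_ : segre _ _ = ([set z : 'rV_((1 + N) * 2) | z 0 (seg (lshift N 0) 0) != 0] `&` Y) `&` E).
  by apply: locally_closedIC => //; apply: locally_closedI => //; exact: locally_closed_coord.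
have sub0 (z : 'rV[F]_((1 + N) * 2)) : z 0 (seg (lshift N 0) 0) != 0 -> sub_coord (seg^~ 0) z != 0.
  by apply: contra_neq => /rowP/(_ (lshift N 0)); rewrite !mxE.
apply/seteqP; split=> z.
  move=> /segre_mem[z00 rk Az]; split; first by split=> //; apply/YE => //; exact: sub0.
  split; first by apply: contra_neq z00 => ->; rewrite mxE.
  by move=> _ /mapP[ij _ ->]; rewrite mevalB !mevalM !mevalXU rk subrr.
move=> [[z00 Yz] [z0 Ez]]; apply/segre_mem; split=> //; last by apply/YE => //; exact: sub0.
move=> i j; apply/eqP; rewrite -subr_eq0; apply/eqP.
by have := Ez (q (i, j)); rewrite map_f ?mem_enum // mevalB !mevalM !mevalXU; exact.
Qed.

Lemma aff_prodT_mem (w : 'rV[F]_(1 + (1 + N))) :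
  aff_cone (aff_prod (fun=> True)) w <->
  aff_cone A (row_mx (\row_(i < 1) w 0 (lshift (1 + N) 0)) (rsubmx (rsubmx w))).
Proof.
split.
  move=> [c [v [c0 [_ Av] ->]]]; exists c, (rsubmx v); split=> //.
  apply/rowP => i; rewrite -(splitK i); case: (split i) => j /=.
    by rewrite row_mxEl mxE aff_coord0 [j]ord1 aff_coord0.
  by rewrite row_mxEr 2!mxE !aff_coord mxE.
move=> [c [v [c0 Av E]]].
have E0 : w 0 (lshift (1 + N) 0) = c.
  by have /rowP/(_ (lshift N 0)) := E; rewrite row_mxEl mxE aff_coord0.
have E1 i : w 0 (rshift 1 (rshift 1 i)) = c * v 0 i.
  by have /rowP/(_ (rshift 1 i)) := E; rewrite row_mxEr 2!mxE aff_coord.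
exists c, (row_mx (\row_(i < 1) (w 0 (rshift 1 (lshift N 0)) / c)) v); split=> //.
  by split=> //; rewrite row_mxKr.
apply/rowP => i; rewrite -(splitK i); case: (split i) => j /=.
  by rewrite [j]ord1 aff_coord0.
rewrite aff_coord -(splitK j); case: (split j) => l /=.
  by rewrite row_mxEl mxE mulrC mulfVK // [l]ord1.
by rewrite row_mxEr E1.
Qed.

Lemma aff_prodT_lc : locally_closed (aff_cone (aff_prod (fun=> True))).
Proof.
pose s (i : 'I_(1 + N)) : 'I_(1 + (1 + N)) :=
  match split i with inl _ => lshift (1 + N) 0 | inr j => rshift 1 (rshift 1 j) end.
have [Y Yl YE] := locally_closed_pre s Al.
have sE (w : 'rV[F]_(1 + (1 + N))) :
    sub_coord s w = row_mx (\row_(i < 1) w 0 (lshift (1 + N) 0)) (rsubmx (rsubmx w)).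
  apply/rowP => i; rewrite mxE /s -{2}(splitK i); case: (split i) => j /=.
    by rewrite row_mxEl mxE.
  by rewrite row_mxEr !mxE.
have s0 (w : 'rV[F]_(1 + (1 + N))) : w 0 (lshift (1 + N) 0) != 0 -> sub_coord s w != 0.
  rewrite sE; apply: contra_neq => /rowP/(_ (lshift N 0)).
  by rewrite row_mxEl !mxE.
rewrite (_ : aff_cone _ = [set w : 'rV_(1 + (1 + N)) | w 0 (lshift (1 + N) 0) != 0] `&` Y).
  by apply: locally_closedI => //; exact: locally_closed_coord.
apply/seteqP; split=> w.
  move=> /aff_prodT_mem Aw; have [w0 _] := (aff_coneE _).1 Aw.
  rewrite row_mxEl mxE in w0; split=> //; apply/YE; first exact: s0.
  by rewrite sE.
by move=> [w0 /(YE _ (s0 _ w0))]; rewrite sE => Aw; apply/aff_prodT_mem.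
Qed.

(** Segre image and affine cone are isomorphic: a matrix z goes to (z_00, z_01, z_i0), and w goes to
    the tensor product of w without its new coordinate w_1 and the pair (w_0, w_1). *)
Lemma kclass_prodT :
  kclass (QVar aff_prodT_lc) = kclass (qline F) * kclass (QVar Al).
Proof.
rewrite mulrC (@kclassM _ _ _ _ (QVar segre_lc)) //; apply/esym/kclass_iso => /=.
pose fidx (i : 'I_(1 + (1 + N))) : 'I_((1 + N) * 2) :=
  match split i with inl _ => seg (lshift N 0) 0 | inr j =>
    match split j with inl _ => seg (lshift N 0) j1 | inr l => seg (rshift 1 l) 0 end end.
pose gl (i : 'I_(1 + N)) : 'I_(1 + (1 + N)) :=
  match split i with inl _ => lshift (1 + N) 0 | inr j => rshift 1 (rshift 1 j) end.
pose gr (j : 'I_2) : 'I_(1 + (1 + N)) := if j == 0 then lshift (1 + N) 0 else rshift 1 (lshift N 0).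
pose f (z : 'rV[F]_((1 + N) * 2)) := sub_coord fidx z.
pose g (w : 'rV[F]_(1 + (1 + N))) := mxvec (\matrix_(i, j) (w 0 (gl i) * w 0 (gr j))).
have gl0 : gl (lshift N 0) = lshift (1 + N) 0 by rewrite /gl (unsplitK (inl _)).
have gl1 i : gl (rshift 1 i) = rshift 1 (rshift 1 i) by rewrite /gl (unsplitK (inr _)).
have gr0 : gr 0 = lshift (1 + N) 0 by [].
have gr1 : gr j1 = rshift 1 (lshift N 0) by [].
have f0 z : f z 0 (lshift (1 + N) 0) = z 0 (seg (lshift N 0) 0).
  by rewrite mxE /fidx (unsplitK (inl _)).
have f1 z : f z 0 (rshift 1 (lshift N 0)) = z 0 (seg (lshift N 0) j1).
  by rewrite mxE /fidx (unsplitK (inr _)) (unsplitK (inl _)).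
have f2 z i : f z 0 (rshift 1 (rshift 1 i)) = z 0 (seg (rshift 1 i) 0).
  by rewrite mxE /fidx !(unsplitK (inr _)).
have fgl z i : f z 0 (gl i) = z 0 (seg i 0).
  rewrite -(splitK i); case: (split i) => j /=; first by rewrite [j]ord1 gl0 f0.
  by rewrite gl1 f2.
have fgr z j : f z 0 (gr j) = z 0 (seg (lshift N 0) j).
  case: (unliftP ord0 j) => [l ->|->]; last by rewrite gr0 f0.
  by rewrite [l]ord1 gr1 f1.
have gE w i j : g w 0 (seg i j) = w 0 (gl i) * w 0 (gr j) by rewrite mxvecE mxE.
have fcol z : row_mx (\row_(i < 1) f z 0 (lshift (1 + N) 0)) (rsubmx (rsubmx (f z))) =
    sub_coord (seg^~ 0) z.
  apply/rowP => i; rewrite [RHS]mxE -(splitK i); case: (split i) => j /=.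
    by rewrite row_mxEl mxE f0 [j]ord1.
  by rewrite row_mxEr 2!mxE f2.
have gcol w : sub_coord (seg^~ 0) (g w) = w 0 (lshift (1 + N) 0) *:
    row_mx (\row_(i < 1) w 0 (lshift (1 + N) 0)) (rsubmx (rsubmx w)).
  apply/rowP => i; rewrite mxE gE gr0 mulrC [RHS]mxE; congr (_ * _).
  rewrite -(splitK i); case: (split i) => j /=.
    by rewrite row_mxEl mxE [j]ord1 gl0.
  by rewrite row_mxEr 2!mxE gl1.
have aff_scale c (w : 'rV[F]_(1 + N)) : c != 0 -> aff_cone A w -> aff_cone A (c *: w).
  move=> c0 [d [v [d0 Av ->]]]; exists (c * d), v; rewrite mulf_neq0 //; split=> //.
  by rewrite scalerA.
exists f, g; split.
- split=> [z /segre_mem[z00 rk Az]|z zS].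
    by apply/aff_prodT_mem; rewrite fcol.
  exists 1, (fun i => 'X_(fidx i)), 0%N, 1%N; split.
  + exact: dhomog1.
  + by move=> i; exact: dhomogXU.
  + by rewrite meval1 oner_neq0.
  + move=> w _ _; exists 1; rewrite ?oner_neq0 // scale1r.
    by apply/rowP => i; rewrite !mxE mevalXU.
- split=> [w /aff_prodT_mem Aw|w wS].
    have [w0 _] := (aff_coneE _).1 Aw; rewrite row_mxEl mxE in w0.
    apply/segre_mem; split; rewrite ?gE ?gl0 ?gr0 ?mulf_neq0 //.
      by move=> i j; rewrite !gE gl0 gr0; ring.
    by rewrite gcol; exact: aff_scale.
  pose P : 'M[{mpoly F[1 + (1 + N)]}]_(1 + N, 2) := \matrix_(i, j) ('X_(gl i) * 'X_(gr j)).
  exists 1, (fun k => mxvec P 0 k), 0%N, 2%N; split.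
  + exact: dhomog1.
  + by move=> k; case/mxvec_indexP: k => i j; rewrite mxvecE mxE; apply: (@dhomogM _ _ _ 1 _ 1); exact: dhomogXU.
  + by rewrite meval1 oner_neq0.
  + move=> v _ _; exists 1; rewrite ?oner_neq0 // scale1r.
    apply/rowP => k; case/mxvec_indexP: k => i j; rewrite -/(seg i j) gE mxE mxvecE mxE.
    by rewrite mevalM !mevalXU.
- move=> z /segre_mem[z00 rk _]; exists (z 0 (seg (lshift N 0) 0)) => //.
  apply/rowP => k; case/mxvec_indexP: k => i j; by rewrite -/(seg i j) gE fgl fgr [RHS]mxE [RHS]mulrC rk.
- move=> w /aff_prodT_mem Aw; have [w0 _] := (aff_coneE _).1 Aw; rewrite row_mxEl mxE in w0.
  exists (w 0 (lshift (1 + N) 0)) => //; apply/rowP => i; rewrite [RHS]mxE.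
  rewrite -(splitK i); case: (split i) => j /=; first by rewrite [j]ord1 f0 gE gl0 gr0.
  rewrite -(splitK j); case: (split j) => l /=; first by rewrite [l]ord1 f1 gE gl0 gr1.
  by rewrite f2 gE gl1 gr0 mulrC.
Qed.

End Product.

(** * Sets given by a vanishing pattern of the coordinates *)

Section Pattern.
Variable F : closedFieldType.

Section ProdPiece.
Variables (N : nat) (A : set 'rV[F]_N).
Hypothesis Al : locally_closed (aff_cone A).
Local Notation first v := (v 0 (lshift N 0)).

Lemma aff_prod0_lc : locally_closed (aff_cone (aff_prod A (fun a => a = 0))).
Proof.
rewrite (_ : aff_prod _ _ = aff_prod A (fun=> True) `&` [set v : 'rV[F]_(1 + N) | first v = 0]).
  by apply: aff_cone_cap0; [exact: poly_fun_coord|exact: aff_prodT_lc].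
by apply/seteqP; split=> v /= [] => [v0 Av|[_ Av] v0].
Qed.

Lemma aff_prod_neq0_lc : locally_closed (aff_cone (aff_prod A (fun a => a != 0))).
Proof.
rewrite (_ : aff_prod _ _ = aff_prod A (fun=> True) `&` [set v : 'rV[F]_(1 + N) | first v != 0]).
  by apply: aff_cone_cap_neq0; [exact: poly_fun_coord|exact: aff_prodT_lc].
by apply/seteqP; split=> v /= [] => [v0 Av|[_ Av] v0].
Qed.

Lemma kclass_prod0 : kclass (QVar aff_prod0_lc) = kclass (QVar Al).
Proof.
apply: kclass_iso; apply: (@aff_iso _ _ _ _ _ (fun v : 'rV[F]_(1 + N) => rsubmx v)
  (fun a => row_mx (0 : 'rV[F]_1) a)).
- by move=> v [].
- by move=> i; apply: rat_fun_ext (rat_fun_coord _ (rshift 1 i)) => v _; rewrite mxE.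
- by move=> a Aa; split; rewrite /= ?row_mxKr // row_mxEl mxE.
- move=> i; rewrite -(splitK i); case: (split i) => j /=.
    by apply: rat_fun_ext (rat_fun_const _ 0) => v _; rewrite row_mxEl mxE.
  by apply: rat_fun_ext (rat_fun_coord _ j) => v _; rewrite row_mxEr.
- move=> v [/= v0 _]; apply/rowP => i; rewrite -(splitK i); case: (split i) => j /=.
    by rewrite row_mxEl mxE [j]ord1 v0.
  by rewrite row_mxEr mxE.
- by move=> a _; rewrite row_mxKr.
Qed.

Lemma kclass_prod_neq0 :
  kclass (QVar aff_prod_neq0_lc) = (kclass (qline F) - 1) * kclass (QVar Al).
Proof.
rewrite mulrBl mul1r -kclass_prodT -kclass_prod0.
pose i1 : 'I_(1 + (1 + N)) := rshift 1 (lshift N 0).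
pose C := [set w : 'rV[F]_(1 + (1 + N)) | w != 0 /\ forall p, p \in [:: 'X_i1] -> p.@[w 0] = 0].
have Cc : proj_closed C.
  by exists [:: 'X_i1]; split=> // p; rewrite inE => /eqP ->; exists 1%N; exact: dhomogXU.
have CE c (v : 'rV[F]_(1 + N)) : c != 0 -> C (c *: row_mx 1%:M v) <-> first v = 0.
  move=> c0; split=> [[_ /(_ 'X_i1)]|v0].
    rewrite inE eqxx mevalXU aff_coord => /(_ isT)/eqP.
    by rewrite mulf_eq0 (negbTE c0) => /eqP.
  split; first exact: aff_neq0.
  by move=> p; rewrite inE => /eqP ->; rewrite mevalXU aff_coord v0 mulr0.
rewrite (@kclass_scissor _ _ (QVar (aff_prodT_lc Al)) (QVar aff_prod0_lc) (QVar aff_prod_neq0_lc) C) //=.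
- by rewrite addrAC subrr add0r.
- apply/seteqP; split=> w.
    move=> [c [v [c0 [v0 Av] ->]]]; split; first by exists c, v.
    exact/CE.
  by move=> [[c [v [c0 [_ Av] ->]]] /(CE _ _ c0) v0]; exists c, v.
- apply/seteqP; split=> w.
    move=> [c [v [c0 [v0 Av] ->]]]; split; first by exists c, v.
    by move=> /(CE _ _ c0) e; rewrite e eqxx in v0.
  move=> [[c [v [c0 [_ Av] ->]]] nC]; exists c, v; split=> //; split=> //.
  by apply/eqP => v0; apply/nC/CE.
Qed.

End ProdPiece.

Definition coord_cond (o : option bool) (a : F) : Prop :=
  if o is Some b then (a != 0) = b else True.

Definition coord_pattern n (st : nat -> option bool) : set 'rV[F]_n :=
  [set v : 'rV[F]_n | forall i : 'I_n, coord_cond (st i) (v 0 i)].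

Arguments coord_pattern n st v : clear implicits.

Definition coord_class (o : option bool) : KVarL F :=
  match o with None => kclass (qline F) | Some true => kclass (qline F) - 1 | Some false => 1 end.

(** The class needs a proof of local closedness, so the induction builds this proof together with
    the value. *)
Lemma kclass_pattern n st : exists l : locally_closed (aff_cone (coord_pattern n st)),
  kclass (QVar l) = \prod_(i < n) coord_class (st i).
Proof.
elim: n st => [|n IH] st.
  have pT : coord_pattern 0 st = setT by apply/seteqP; split=> // v _ [].
  rewrite pT; exists (aff_coneT F 0); rewrite big_ord0 -kclass_point; apply: kclass_set => /=.
  apply/seteqP; split=> w; first by move=> [c [v [c0 _ ->]]]; exact: aff_neq0.
  have i0 (i : 'I_(1 + 0)) : i = lshift 0 0 by apply/val_inj; rewrite /= (ord1 i).
  move=> w0; exists (w 0 (lshift 0 0)), 0; split=> //.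
    by apply: contra_neq w0 => w0; apply/rowP => i; rewrite mxE (i0 i).
  by apply/rowP => i; rewrite (i0 i) aff_coord0.
have [l lE] := IH (fun i => st i.+1).
have pE : coord_pattern n.+1 st =
    aff_prod (coord_pattern n (fun i => st i.+1)) (coord_cond (st 0%N)) :> set 'rV[F]_(1 + n).
  apply/seteqP; split=> v.
    move=> vP; split; first exact: (vP (@lshift 1 n 0)).
    by move=> i; have := vP (@rshift 1 n i); rewrite mxE.
  move=> [v0 vP] i; case: (unliftP ord0 i) => [j ->|->].
    have := vP j; rewrite mxE (_ : rshift 1 j = lift ord0 j :> 'I_(1 + n)) //; exact/val_inj.
  by rewrite (_ : ord0 = @lshift 1 n 0 :> 'I_(1 + n)) //; exact/val_inj.
rewrite big_ord_recl -[X in _ * X]lE pE; case: (st 0%N) => [[]|].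
- rewrite (_ : aff_prod _ _ = aff_prod (coord_pattern n (fun i => st i.+1)) (fun a => a != 0)).
    by exists (aff_prod_neq0_lc l); exact: kclass_prod_neq0.
  by apply/seteqP; split=> v [].
- rewrite (_ : aff_prod _ _ = aff_prod (coord_pattern n (fun i => st i.+1)) (fun a => a = 0)).
    by exists (aff_prod0_lc l); rewrite kclass_prod0 mul1r.
  by apply/seteqP; split=> v [/= v0 Av]; split=> //=; [exact/eqP/negbFE|apply/negbF; rewrite v0].
- by exists (aff_prodT_lc l); exact: kclass_prodT.
Qed.

End Pattern.

Arguments coord_pattern {F} n st v.

(** * Cylinders of arcs *)

Section Agree.
Variable F : fieldType.
Implicit Types u v x y tau : fps F.

Definition fps_agree n u v := forall i, (i <= n)%N -> u i = v i.

Lemma fps_agree_root k u v n : fps_agree n u v -> fps_agree n (fps_root k u) (fps_root k v).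
Proof.
move=> uv i ilen; rewrite /fps_root /=; suff -> : fps_root_approx k u i = fps_root_approx k v i by [].
by elim: i ilen => [//|i IH] ilen; rewrite 2!fps_root_approxS (IH (ltnW ilen)) (uv _ ilen).
Qed.

Lemma fps_agree_unif k x y n : fps_agree (k + n) x y -> fps_agree n (fps_unif k x) (fps_unif k y).
Proof.
move=> xy i ilen; apply: fps_agreeM => // j ji; apply: (@fps_agree_root _ _ _ j) => // l lj /=.
by rewrite !xy ?leq_addr // leq_add2l (leq_trans lj) // (leq_trans ji).
Qed.

Lemma fps_agree_expand tau tau' y y' n : fps_agree n tau tau' -> fps_agree n y y' ->
  fps_agree n (fps_expand tau y) (fps_expand tau' y').
Proof.
move=> tt yy.
have key m : (m <= n.+1)%N -> fps_agree n (fps_expand_rem tau y m) (fps_expand_rem tau' y' m).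
  elim: m => [_|m IH mn i ilen]; first exact: yy.
  rewrite 2!fps_expand_remS 2!fpsBE 2!fpsCM (IH (ltnW mn) m mn) (IH (ltnW mn) i ilen); congr (_ - _ * _).
  by apply: (@fps_agreeX _ m _ _ n).
by move=> i ilen; apply: (key i) => //; exact: leq_trans ilen _.
Qed.

Lemma fps_agree_comp b b' tau n : fps_agree n b b' -> fps_agree n (fps_comp b tau) (fps_comp b' tau).
Proof.
move=> bb i ilen; apply: eq_bigr => j _; rewrite bb //.
by apply: leq_trans ilen; rewrite -ltnS.
Qed.

End Agree.

(** * Families of series with rational coefficients *)

Section RatFps.
Variables (F : closedFieldType) (N : nat) (A : set 'rV[F]_N).
Implicit Types S T : 'rV[F]_N -> fps F.

Lemma rat_funW (B : set 'rV[F]_N) g : B `<=` A -> rat_fun A g -> rat_fun B g.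
Proof. by move=> BA [p [q [pp qp E]]]; exists p, q; split=> // v /BA/E. Qed.

Definition rat_fps S := forall i, rat_fun A (fun v => S v i).

Lemma rat_fps_const (f : fps F) : rat_fps (fun=> f).
Proof. by move=> i; exact: rat_fun_const. Qed.

Lemma rat_fpsD S T : rat_fps S -> rat_fps T -> rat_fps (fun v => S v + T v).
Proof. by move=> Sr Tr i; exact: (rat_funD (Sr i) (Tr i)). Qed.

Lemma rat_fpsB S T : rat_fps S -> rat_fps T -> rat_fps (fun v => S v - T v).
Proof. by move=> Sr Tr i; exact: (rat_funD (Sr i) (rat_funN (Tr i))). Qed.

Lemma rat_fpsM S T : rat_fps S -> rat_fps T -> rat_fps (fun v => S v * T v).
Proof.
move=> Sr Tr i; apply: rat_fun_sum => j.
exact: (rat_funM (Sr j) (Tr (i - j)%N)).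
Qed.

Lemma rat_fpsX S n : rat_fps S -> rat_fps (fun v => S v ^+ n).
Proof.
move=> Sr; elim: n => [|n IH]; first exact: rat_fps_const.
by under eq_fun do rewrite exprS; exact: rat_fpsM.
Qed.

Lemma rat_fpsC g : rat_fun A g -> rat_fps (fun v => fpsC (g v)).
Proof.
move=> gr i; case: i => [|i].
  by apply: rat_fun_ext gr => v _.
by apply: rat_fun_ext (rat_fun_const A 0) => v _.
Qed.

Lemma rat_fps_root k S : rat_fps S -> rat_fps (fun v => fps_root k (S v)).
Proof.
move=> Sr; have key n : rat_fps (fun v => fps_root_approx k (S v) n).
  elim: n => [|n IH]; first exact: rat_fps_const.
  under eq_fun do rewrite fps_root_approxS.
  apply: rat_fpsD => //; apply: rat_fpsM; last exact: rat_fps_const.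
  apply: rat_fpsC; apply: rat_funM; last exact: rat_fun_const.
  by apply: rat_funD; [exact: Sr|apply: rat_funN; exact: rat_fpsX].
by move=> i; exact: key.
Qed.

Lemma rat_fps_unif k S : (forall v, A v -> S v k != 0) -> rat_fps S ->
  rat_fps (fun v => fps_unif k (S v)).
Proof.
move=> S0 Sr; apply: rat_fpsM; first exact: rat_fps_const.
apply: rat_fps_root => i; apply: rat_funM; first exact: Sr.
by apply: rat_funV.
Qed.

Lemma rat_fps_expand S T : rat_fps S -> rat_fps T -> rat_fps (fun v => fps_expand (S v) (T v)).
Proof.
move=> Sr Tr; have key n : rat_fps (fun v => fps_expand_rem (S v) (T v) n).
  elim: n => [|n IH] //; under eq_fun do rewrite fps_expand_remS.
  apply: rat_fpsB => //; apply: rat_fpsM; last exact: rat_fpsX.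
  by apply: rat_fpsC; exact: IH.
by move=> i; exact: key.
Qed.

Lemma rat_fps_comp S T : rat_fps S -> rat_fps T -> rat_fps (fun v => fps_comp (S v) (T v)).
Proof.
move=> Sr Tr i; apply: rat_fun_sum => j; apply: rat_funM; first exact: Sr.
exact: rat_fpsX.
Qed.

Lemma rat_cond_lc (B : set 'rV[F]_N) g o : B `<=` A -> rat_fun A g ->
  locally_closed (aff_cone B) ->
  locally_closed (aff_cone (B `&` [set v | coord_cond o (g v)])).
Proof.
move=> BA [p [q [pp qp E]]] Bl; case: o => [[]|] /=.
- rewrite (_ : _ `&` _ = B `&` [set v | p v != 0]); first exact: aff_cone_cap_neq0.
  apply/seteqP; split=> v [Bv] /=; have [q0 ->] := E v (BA v Bv); split=> //.
    by move: b; rewrite mulf_eq0 negb_or => /andP[].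
  by rewrite mulf_neq0 // invr_eq0.
- rewrite (_ : _ `&` _ = B `&` [set v | p v = 0]); first exact: aff_cone_cap0.
  apply/seteqP; split=> v [Bv] /=; have [q0 ->] := E v (BA v Bv); split=> //.
    by move: b => /negbFE; rewrite mulf_eq0 invr_eq0 (negbTE q0) orbF => /eqP.
  by rewrite b mul0r eqxx.
- by rewrite setIT.
Qed.

End RatFps.

Section FpsOfRow.
Variable F : closedFieldType.

Definition fps_of_row n (u : 'rV[F]_n) : fps F :=
  FPS (fun i => if i is i'.+1 then if insub i' is Some j then u 0 (j : 'I_n) else 0 else 0).

Lemma fps_of_rowE n (u : 'rV[F]_n) (j : 'I_n) : fps_of_row u j.+1 = u 0 j.
Proof. by rewrite /= valK. Qed.

Lemma fps_of_row_agree n (f : fps F) : f 0%N = 0 -> fps_agree n (fps_of_row (\row_(i < n) f i.+1)) f.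
Proof.
move=> f0 [|i] ilen; first by rewrite f0.
by rewrite (fps_of_rowE _ (Ordinal ilen)) mxE.
Qed.

Lemma rat_fps_of_row N n (A : set 'rV[F]_N) (s : 'rV[F]_N -> 'rV[F]_n) :
  (forall j, rat_fun A (fun v => s v 0 j)) -> rat_fps A (fun v => fps_of_row (s v)).
Proof.
move=> sr [|i]; first exact: rat_fun_const.
rewrite /=; case: insubP => [j _ _|_]; first exact: sr.
exact: rat_fun_const.
Qed.

End FpsOfRow.

Section Cylinder.
Variable F : numClosedFieldType.
Variables (k : nat) (w : nat -> bool) (l : nat).
Hypothesis k0 : (0 < k)%N.

Definition arc_cylinder : set (plane_arc F) := [set g | fps_ord (arcx g) k /\
  forall i, (0 < i <= l)%N -> (arc_coef k g i != 0) = w i].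

(** Passing from x to tau costs k orders, so the jet of order k + l determines the coefficients
    along tau up to l. *)
Local Notation n := (k + l)%N.
Local Notation jx v := (fps_of_row (lsubmx (v : 'rV[F]_(n + n)))).
Local Notation jy v := (fps_of_row (rsubmx (v : 'rV[F]_(n + n)))).
Local Notation tau v := (fps_unif k (jx v)).

(** Position i of a jet holds the coefficient of s^(i+1). *)
Definition ord_state i := if (i.+1 < k)%N then Some false else if i.+1 == k then Some true else None.
Definition cyl_state i := if (i < n)%N then ord_state i else
  if ((i - n).+1 <= l)%N then Some (w (i - n).+1) else None.
Definition cyl_state0 i := if (i < n)%N then ord_state i else None.

Let D := coord_pattern (F := F) (n + n) cyl_state0.

Definition cyl_jets : set 'rV[F]_(n + n) := [set v | D v /\
  forall i, (0 < i <= l)%N -> (fps_expand (tau v) (jy v) i != 0) = w i].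

Lemma cyl_state0_ord v : D v <-> fps_ord (jx v) k.
Proof.
split=> [Dv|[vk vi] i].
  have co (j : 'I_n) : coord_cond (ord_state j) (jx v j.+1).
    rewrite fps_of_rowE mxE; have := Dv (lshift n j).
    by rewrite /cyl_state0 (_ : nat_of_ord (lshift n j) = j) // ltn_ord.
  have kn : (k.-1 < n)%N by lia.
  split.
    have := co (Ordinal kn); rewrite (_ : nat_of_ord (Ordinal kn) = k.-1) //.
    by rewrite /ord_state prednK // ltnn eqxx.
  move=> [|i] ik //; have inn : (i < n)%N by lia.
  have := co (Ordinal inn); rewrite (_ : nat_of_ord (Ordinal inn) = i) //.
  by rewrite /ord_state ik => /negbFE/eqP.
rewrite /cyl_state0; case: ltnP => // inn.
have -> : v 0 i = jx v i.+1.
  rewrite (fps_of_rowE (lsubmx v) (Ordinal inn)) mxE; congr (v 0 _); exact/val_inj.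
rewrite /ord_state; case: ltnP => [ik|ki]; first by apply/negbF; rewrite vi ?eqxx.
by case: eqP => // ->.
Qed.

(** The polynomials read off a jet agree with the arc up to order n, and both the order of x and the
    coefficients up to l depend only on these terms. *)
Lemma cyl_jetsE : arc_cylinder = @jet F n @^-1` cyl_jets.
Proof.
have agx (g : plane_arc F) : fps_agree n (jx (jet n g)) (arcx g).
  by rewrite /jet row_mxKl; apply: fps_of_row_agree; exact: arcx0.
have agy (g : plane_arc F) : fps_agree n (jy (jet n g)) (arcy g).
  by rewrite /jet row_mxKr; apply: fps_of_row_agree; exact: arcy0.
have ordE (g : plane_arc F) : fps_ord (arcx g) k <-> D (jet n g).
  rewrite cyl_state0_ord /fps_ord !agx ?leq_addr //.
  split=> -[gk gi]; split=> // i ik; first by rewrite agx ?gi // (leq_trans (ltnW ik)) ?leq_addr.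
  by rewrite -agx ?gi // (leq_trans (ltnW ik)) ?leq_addr.
have coefE (g : plane_arc F) i : (i <= l)%N ->
    fps_expand (tau (jet n g)) (jy (jet n g)) i = arc_coef k g i.
  move=> il; apply: (@fps_agree_expand _ _ _ _ _ l) => //; first exact/fps_agree_unif/agx.
  by move=> j jl; apply: agy; rewrite (leq_trans jl) ?leq_addl.
apply/seteqP; split=> g /= -[go gc]; split; try exact/ordE.
  by move=> i il; rewrite coefE ?gc //; case/andP: il.
by move=> i il; rewrite -coefE ?gc //; case/andP: il.
Qed.

Lemma jx_rat (A : set 'rV[F]_(n + n)) : rat_fps A (fun v => jx v).
Proof.
apply: rat_fps_of_row => j; apply: rat_fun_ext (rat_fun_coord A (lshift n j)) => v _.
by rewrite mxE.
Qed.

Lemma jy_rat (A : set 'rV[F]_(n + n)) : rat_fps A (fun v => jy v).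
Proof.
apply: rat_fps_of_row => j; apply: rat_fun_ext (rat_fun_coord A (rshift n j)) => v _.
by rewrite mxE.
Qed.

Lemma tau_rat : rat_fps D (fun v => tau v).
Proof.
by apply: rat_fps_unif => [v /cyl_state0_ord[] //|]; exact: jx_rat.
Qed.

Lemma cyl_jets_lc : locally_closed (aff_cone cyl_jets).
Proof.
have [Dl _] := kclass_pattern F (n + n) cyl_state0.
suff key m : (m <= l)%N -> locally_closed (aff_cone (D `&` [set v |
    forall i, (0 < i <= m)%N -> (fps_expand (tau v) (jy v) i != 0) = w i])) by exact: key l _.
elim: m => [|m IH] ml.
  rewrite (_ : D `&` _ = D) //; apply/seteqP; split=> [v [] //|v Dv]; split=> // i /andP[i0].
  by rewrite leqNgt i0.
have cr := rat_fps_expand tau_rat (@jy_rat D) m.+1.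
have := @rat_cond_lc _ _ _ _ _ (Some (w m.+1)) (fun v (Dv : (D `&` _) v) => proj1 Dv) cr (IH (ltnW ml)).
congr (locally_closed (aff_cone _)); apply/seteqP; split=> v.
  move=> [[Dv vm] vm1]; split=> // i /andP[i0]; rewrite leq_eqVlt => /orP[/eqP -> //|im].
  by apply: vm; rewrite i0.
move=> [Dv vm]; split; last exact: (vm m.+1 (leqnn _)).
by split=> // i /andP[i0 im]; apply: vm; rewrite i0 ltnW.
Qed.

(** The change of coordinates from y to its coefficients along tau, inverse to composition with tau,
    turns conditions on coefficients into conditions on coordinates. It is rational because x_k does
    not vanish. *)
Lemma cyl_iso : isomorphic (aff_cone cyl_jets) (aff_cone (coord_pattern (F := F) (n + n) cyl_state)).
Proof.
pose f (v : 'rV[F]_(n + n)) : 'rV[F]_(n + n) :=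
  row_mx (lsubmx v) (\row_(j < n) fps_expand (tau v) (jy v) j.+1).
pose g (v : 'rV[F]_(n + n)) : 'rV[F]_(n + n) :=
  row_mx (lsubmx v) (\row_(j < n) fps_comp (jy v) (tau v) j.+1).
have lf v : lsubmx (f v) = lsubmx v by rewrite row_mxKl.
have lg v : lsubmx (g v) = lsubmx v by rewrite row_mxKl.
have DB v : coord_pattern (n + n) cyl_state v ->
    D v /\ forall i, (0 < i <= l)%N -> (jy v i != 0) = w i.
  move=> vB; split=> [i|[|i] // /= il].
    by have := vB i; rewrite /cyl_state /cyl_state0; case: ltnP.
  have inn : (i < n)%N by lia.
  have := vB (rshift n (Ordinal inn)); rewrite /cyl_state /= ltnNge leq_addr addKn il /=.
  by rewrite insubT /= mxE.
have BD v : D v -> (forall i, (0 < i <= l)%N -> (jy v i != 0) = w i) ->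
    coord_pattern (n + n) cyl_state v.
  move=> Dv vw i; have := Dv i; rewrite /cyl_state /cyl_state0; case: ltnP => // ni _.
  case: ltnP => // il /=.
  have inn : (i - n < n)%N by have := ltn_ord i; lia.
  rewrite -(vw (i - n).+1) // (fps_of_rowE _ (Ordinal inn)) mxE; congr (v 0 _ != 0).
  by apply/val_inj; rewrite /= subnKC.
have Dlsub v v' : lsubmx v = lsubmx v' -> D v -> D v'.
  by move=> vv; rewrite !cyl_state0_ord vv.
have t0 v : tau v 0%N = 0 by exact: fps_unif0.
have t1 v : tau v 1%N = 1 by exact: fps_unif1.
have e0 v : fps_expand (tau v) (jy v) 0%N = 0 by [].
have c0 v : fps_comp (jy v) (tau v) 0%N = 0 by rewrite fps_comp_coef0.
have fy v : fps_agree n (jy (f v)) (fps_expand (tau v) (jy v)).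
  by rewrite row_mxKr; exact: fps_of_row_agree.
have gy v : fps_agree n (jy (g v)) (fps_comp (jy v) (tau v)).
  by rewrite row_mxKr; exact: fps_of_row_agree.
have expand_comp (b ta : fps F) : ta 0%N = 0 -> ta 1%N = 1 -> fps_expand ta (fps_comp b ta) = b.
  move=> ta0 ta1; apply/eqP; rewrite -subr_eq0; apply/eqP.
  apply: (@fps_comp_eq0 _ _ ta) => //.
    by apply: contraTneq (oner_neq0 F) => tz; rewrite -ta1 tz fps0E eqxx.
  have /= -> := raddfB (fps_comp_morph ta0) (fps_expand ta (fps_comp b ta)) b.
  by rewrite fps_expandK // subrr.
have row_eq (v v' : 'rV[F]_(n + n)) : lsubmx v = lsubmx v' -> fps_agree n (jy v) (jy v') -> v = v'.
  move=> vv yy; rewrite -[v]hsubmxK -[v']hsubmxK vv; congr row_mx.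
  by apply/rowP => j; rewrite -!fps_of_rowE yy.
apply: (@aff_iso _ _ _ _ _ f g).
- move=> v [Dv vw]; apply: BD; first exact: Dlsub Dv.
  by move=> i il; rewrite fy ?vw //; case/andP: il => _ il; rewrite (leq_trans il) ?leq_addl.
- move=> i; rewrite -(splitK i); case: (split i) => j /=.
    apply: rat_fun_ext (rat_fun_coord _ (lshift n j)) => v _; by rewrite row_mxEl mxE.
  apply: rat_fun_ext (rat_funW _ (rat_fps_expand tau_rat (@jy_rat D) j.+1)) => v.
    by move=> _; rewrite row_mxEr mxE.
  by case.
- move=> v /DB[Dv vw]; split; first exact: Dlsub Dv.
  move=> i il; rewrite -vw // lg; congr (_ != 0).
  have il' : (i <= n)%N by case/andP: il => _ il; rewrite (leq_trans il) ?leq_addl.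
  by rewrite (fps_agree_expand (fun _ _ => erefl) (gy v) il') expand_comp.
- move=> i; rewrite -(splitK i); case: (split i) => j /=.
    apply: rat_fun_ext (rat_fun_coord _ (lshift n j)) => v _; by rewrite row_mxEl mxE.
  apply: rat_fun_ext (rat_funW _ (rat_fps_comp (@jy_rat D) tau_rat j.+1)) => v.
    by move=> _; rewrite row_mxEr mxE.
  by move=> /DB[].
- move=> v _; apply: row_eq; first by rewrite lg lf.
  move=> i ilen; rewrite gy // lf (fps_agree_comp _ (fy v)) //.
  by rewrite fps_expandK.
- move=> v _; apply: row_eq; first by rewrite lf lg.
  move=> i ilen; rewrite fy // lg.
  by rewrite (fps_agree_expand (fun _ _ => erefl) (gy v) ilen) expand_comp.
Qed.

Lemma cyl_class : constr_class cyl_jets = \prod_(i < n + n) coord_class F (cyl_state i).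
Proof.
have [Bl <-] := kclass_pattern F (n + n) cyl_state.
rewrite (@constr_class_lc _ _ _ (QVar cyl_jets_lc)) //.
apply: kclass_iso; exact: cyl_iso.
Qed.

End Cylinder.

(** * The motivic integral *)

Lemma char_muS k u l :
  char_mu k u l.+1 = (char_mu k u l + l * (char_gcd k u l - char_gcd k u l.+1))%N.
Proof. by rewrite /char_mu big_ord_recr. Qed.

Section Mot.
Variable F : closedFieldType.

Lemma mot_is_nmod : nmod_morphism (@mot F).
Proof.
split=> // x y; rewrite [RHS](_ : _ = sq_add (mot x) (mot y)) // /mot.
rewrite (@sq_addE (kseq_setoid F)).
by apply/(@spiP (kseq_setoid F)); exact: kseq_eqE.
Qed.

Lemma mot_is_monoid : monoid_morphism (@mot F).
Proof.
split=> // x y; rewrite [RHS](_ : _ = sq_mul (mot x) (mot y)) // /mot.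
rewrite (@sq_mulE (kseq_setoid F)).
by apply/(@spiP (kseq_setoid F)); exact: kseq_eqE.
Qed.

HB.instance Definition _ := GRing.isNmodMorphism.Build (KVarL F) (Mot F) (@mot F) mot_is_nmod.
HB.instance Definition _ := GRing.isMonoidMorphism.Build (KVarL F) (Mot F) (@mot F) mot_is_monoid.

Lemma motM x y : mot (x * y) = mot x * mot y :> Mot F.
Proof. exact: rmorphM. Qed.

Lemma motB1 x : mot (x - 1) = mot x - 1 :> Mot F.
Proof. by rewrite rmorphB rmorph1. Qed.

Lemma Lpow1 : Lpow F 1 = mot (kclass (qline F)).
Proof. by rewrite /Lpow [kLpow _ _]/= expr1. Qed.

Lemma LpowN1 : Lpow F (-1) = mot (kLinv F).
Proof. by rewrite /Lpow [kLpow _ _]/= expr1. Qed.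

Lemma kLinvK : kclass (qline F) * kLinv F = 1.
Proof.
rewrite [LHS](@sq_mulE (kg_setoid F)).
by apply/(@spiP (kg_setoid F)); exact: kg_Linv.
Qed.

Lemma kLpowN n : kLpow F (- n%:Z) = kLinv F ^+ n.
Proof. by case: n. Qed.

Lemma kLpowD1 (z : int) : kLpow F (z + 1) = kclass (qline F) * kLpow F z.
Proof.
case: z => [n|[|n]].
- by rewrite -PoszD addn1 /= exprS.
- by rewrite /= expr1 kLinvK.
- rewrite (_ : Negz n.+1 + 1 = - n.+1%:Z); last by rewrite NegzE; lia.
  by rewrite kLpowN [in RHS]/= [in RHS]exprS mulrA kLinvK mul1r.
Qed.

Lemma LpowD (y z : int) : Lpow F (y + z) = Lpow F y * Lpow F z.
Proof.
have S (x : int) : Lpow F (x + 1) = Lpow F 1 * Lpow F x.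
  by rewrite /Lpow kLpowD1 rmorphM.
have P (x : int) : Lpow F (x - 1) = Lpow F (-1) * Lpow F x.
  have e : Lpow F (-1) * Lpow F 1 = 1 by rewrite mulrC /Lpow -rmorphM /= !expr1 kLinvK rmorph1.
  by rewrite -{2}(subrK 1 x) S mulrA e mul1r.
elim/int_rec: y => [|n IH|n IH].
- by rewrite add0r /Lpow [kLpow F 0]/= rmorph1 mul1r.
- by rewrite -addn1 PoszD addrAC S IH S mulrA.
- by rewrite -addn1 PoszD opprD addrAC P IH P mulrA.
Qed.

Lemma LpowXn (y : int) n : Lpow F y ^+ n = Lpow F (y * n%:Z).
Proof.
elim: n => [|n IH]; first by rewrite mulr0 /Lpow [kLpow F 0]/= rmorph1.
by rewrite exprS IH -LpowD; congr Lpow; rewrite intS; ring.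
Qed.

End Mot.

Section Measure.
Variable F : numClosedFieldType.
Variable chi : motivic_measure F.

Definition coef_weight (b : bool) : Mot F := if b then 1 - Lpow F (-1) else Lpow F (-1).

Lemma prod_cond_const (R : comPzRingType) (a : R) (G : nat -> R) m n :
  (forall i, (m <= i < n)%N -> G i = a) -> \prod_(m <= i < n) G i = a ^+ (n - m).
Proof.
move=> Ga; rewrite big_nat (eq_bigr (fun=> a)) => [|i ii]; last exact: Ga.
by rewrite -big_nat prodr_const_nat.
Qed.

Lemma cyl_state_class k w l : (0 < k)%N ->
  \prod_(i < (k + l) + (k + l)) coord_class F (cyl_state k w l i) =
  (kclass (qline F) - 1) * kclass (qline F) ^+ (k + l) *
    \prod_(j < l) coord_class F (Some (w j.+1)).
Proof.
case: k => // k _.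
pose G i := coord_class F (cyl_state k.+1 w l i).
rewrite -(big_mkord xpredT G).
(* The blocks are: the vanishing coordinates of x, its leading coefficient, its free coordinates,
   the l prescribed coefficients of y, and the free ones. *)
rewrite (@big_cat_nat _ _ _ k) //=; last by clear; lia.
rewrite (@big_cat_nat _ _ _ k.+1 k) //=; last by clear; lia.
rewrite (@big_cat_nat _ _ _ (k.+1 + l) k.+1) //=; try by clear; lia.
rewrite (@big_cat_nat _ _ _ ((k.+1 + l) + l) (k.+1 + l)) //=; try by clear; lia.
rewrite big_nat1 (prod_cond_const (a := 1)) => [|i ik]; last first.
  rewrite /G /cyl_state /ord_state ltnS; case/andP: ik => _ ik.
  by rewrite ik (_ : i < k.+1 + l)%N //; move: ik; clear; lia.
rewrite expr1n mul1r.
rewrite (prod_cond_const (a := kclass (qline F)) (m := k.+1)) => [|i ik]; last first.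
  rewrite /G /cyl_state /ord_state.
  have -> : (i < k.+1 + l)%N by case/andP: ik.
  have -> : (i.+1 < k.+1)%N = false by move: ik; clear; lia.
  by have -> : (i.+1 == k.+1) = false by move: ik; clear; lia.
rewrite (prod_cond_const (a := kclass (qline F)) (m := k.+1 + l + l)) => [|i ik]; last first.
  rewrite /G /cyl_state.
  have -> : (i < k.+1 + l)%N = false by move: ik; clear; lia.
  by have -> : ((i - (k.+1 + l)).+1 <= l)%N = false by move: ik; clear; lia.
have -> : \prod_(k.+1 + l <= i < k.+1 + l + l) G i = \prod_(j < l) coord_class F (Some (w j.+1)).
  rewrite -{1}[(k.+1 + l)%N]add0n [(k.+1 + l + l)%N]addnC big_addn addnK big_mkord.
  apply: eq_bigr => j _; rewrite /G /cyl_state addnK.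
  have -> : (j + (k.+1 + l) < k.+1 + l)%N = false by clear; lia.
  by rewrite ltn_ord.
have -> : G k = kclass (qline F) - 1.
  by rewrite /G /cyl_state /ord_state ltnn eqxx addSn ltnS leq_addr.
have -> : (k.+1 + l - k.+1)%N = l by clear; lia.
have -> : (k.+1 + l + (k.+1 + l) - (k.+1 + l + l))%N = k.+1 by clear; lia.
rewrite exprD; ring.
Qed.

Lemma chi_cylinder k w l : (0 < k)%N ->
  mm_measurable chi (arc_cylinder k w l) /\
  chi (arc_cylinder k w l) =
    (Lpow F 1 - 1) * Lpow F (- k%:Z) * \prod_(j < l) coef_weight (w j.+1).
Proof.
move=> k0; rewrite (cyl_jetsE F w l k0).
have := @mm_cylinder _ chi _ _ (constructible_lc (cyl_jets_lc F w l k0)).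
move=> [ms ->]; split=> //; rewrite (cyl_class F w l k0) cyl_state_class //.
(* Of the factor L^-2(k+l), the part L^-(k+l) cancels the free coordinates, L^-k remains, and each
   of the l conditions on y takes one L^-1. *)
have -> : kLpow F (- (2 * (k + l))%N%:Z) = kLinv F ^+ (k + l) * (kLinv F ^+ k * kLinv F ^+ l).
  by rewrite kLpowN mul2n -addnn -!exprD.
set q := kclass (qline F); set lam := kLinv F; set Pr := \prod_(j < l) _.
have -> : (q - 1) * q ^+ (k + l) * Pr * (lam ^+ (k + l) * (lam ^+ k * lam ^+ l)) =
    (q - 1) * lam ^+ k * (Pr * lam ^+ l).
  have e : q ^+ (k + l) * lam ^+ (k + l) = 1 by rewrite -exprMn kLinvK expr1n.
  transitivity ((q ^+ (k + l) * lam ^+ (k + l)) * ((q - 1) * lam ^+ k * (Pr * lam ^+ l))).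
    by ring.
  by rewrite e mul1r.
have -> : Lpow F (- k%:Z) = mot (lam ^+ k) by rewrite /Lpow kLpowN.
have -> : \prod_(j < l) coef_weight (w j.+1) = mot (Pr * lam ^+ l).
  rewrite /Pr -[l in lam ^+ l]card_ord -prodr_const -big_split (rmorph_prod (@mot F)).
  apply: eq_bigr => j _; rewrite /coef_weight LpowN1.
  transitivity (mot (coord_class F (Some (w j.+1)) * lam)); last by [].
  case: (w j.+1); rewrite [coord_class _ _]/=; last by rewrite mul1r.
  by rewrite mulrBl mul1r kLinvK (rmorphB (@mot F)) (rmorph1 (@mot F)).
by rewrite !motM motB1 -Lpow1.
Qed.

Variable k : nat.
Hypothesis k0 : (0 < k)%N.
Local Notation nz g := (fun i => arc_coef k g i != 0).

(* Arcs of a cylinder for which, M coefficients further, the gcd of the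
   exponents has reached 1 and the Milnor number is n. *)
Definition cyl_level w l M n : set (plane_arc F) := [set g | arc_cylinder k w l g /\
  (char_gcd k (nz g) (l + M) = 1%N /\ char_mu k (nz g) (l + M) = n)].

Local Notation level_gf := (level_gf (Lpow F (-1))).

Lemma char_gcd_eq (u v : nat -> bool) l : (forall i, (0 < i <= l)%N -> u i = v i) ->
  forall j, (j <= l)%N -> char_gcd k u j = char_gcd k v j.
Proof.
move=> uv; elim=> // j IH jl /=; rewrite IH 1?ltnW // uv // jl.
Qed.

Lemma char_mu_eq (u v : nat -> bool) l : (forall i, (0 < i <= l)%N -> u i = v i) ->
  char_mu k u l = char_mu k v l.
Proof.
move=> uv; apply: eq_bigr => i _; rewrite (char_gcd_eq uv) ?(char_gcd_eq uv) //.
exact: ltnW.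
Qed.

(** The empty set is a cylinder, and additivity applied to its union with itself forces the
    value. *)
Lemma chi_set0 : mm_measurable chi set0 /\ chi set0 = 0.
Proof.
have ms : mm_measurable chi set0.
  have [+ _] := @mm_cylinder _ chi 0 _ (constructible0 F 0); congr (mm_measurable chi).
split=> //; have := mm_add ms ms (setI0 _); rewrite setU0 => e.
by apply: (addrI (chi set0)); rewrite addr0 -e.
Qed.

(** Induction on M for all w and l: the cylinder is cut according to whether the next coefficient
    vanishes, which mirrors the recursion of [level_gf]. *)
Lemma chi_level M w l n : mm_measurable chi (cyl_level w l M n) /\
  chi (cyl_level w l M n) = (fpsC (chi (arc_cylinder k w l)) *
    fps_t _ ^+ char_mu k w l * level_gf M (char_gcd k w l) l.+1) n.
Proof.
elim: M w l => [|M IH] w l.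
  have cylE (g : plane_arc F) : arc_cylinder k w l g ->
      char_gcd k (nz g) l = char_gcd k w l /\ char_mu k (nz g) l = char_mu k w l.
    by move=> [_ gw]; rewrite (char_gcd_eq gw) // (char_mu_eq gw).
  have [ms _] := @chi_cylinder k w l k0.
  have [e1|e1] := eqVneq (char_gcd k w l) 1%N; last first.
    rewrite level_gf0 (negbTE e1) mulr0 fps0E (_ : cyl_level _ _ _ _ = set0); first exact: chi_set0.
    apply/seteqP; split=> // g [gc []]; rewrite addn0; have [-> _] := cylE g gc.
    by move=> e2; rewrite e2 eqxx in e1.
  rewrite level_gf0 e1 eqxx mulr1 fpsCM fps_tXE; have [nE|nE] := eqVneq n (char_mu k w l).
    rewrite mulr1 (_ : cyl_level _ _ _ _ = arc_cylinder k w l) //.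
    apply/seteqP; split=> g; first by case.
    by move=> gc; split=> //; rewrite addn0; have [-> ->] := cylE g gc.
  rewrite mulr0 (_ : cyl_level _ _ _ _ = set0); first exact: chi_set0.
  apply/seteqP; split=> // g [gc []]; rewrite addn0; have [_ ->] := cylE g gc.
  by move=> _ e2; rewrite e2 eqxx in nE.
pose wb b i := if i == l.+1 then b else w i.
have wbE b i : (0 < i <= l)%N -> wb b i = w i.
  by move=> /andP[_ il]; rewrite /wb ltn_eqF // ltnS.
have split_cyl : cyl_level w l M.+1 n = cyl_level (wb false) l.+1 M n `|` cyl_level (wb true) l.+1 M n.
  have sub b (g : plane_arc F) : arc_cylinder k (wb b) l.+1 g -> arc_cylinder k w l g.
    move=> [gk gw]; split=> // i il; rewrite gw ?wbE //.
    by case/andP: il => -> il; rewrite ltnW.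
  apply/seteqP; split=> g.
    move=> [[gk gw] ge]; rewrite addnS -addSn in ge.
    have gb : arc_cylinder k (wb (arc_coef k g l.+1 != 0)) l.+1 g.
      split=> // i /andP[i0]; rewrite leq_eqVlt => /orP[/eqP ->|il]; first by rewrite /wb eqxx.
      by rewrite wbE ?gw // i0.
    by case: (arc_coef k g l.+1 != 0) gb => gb; [right|left].
  by case=> -[gc]; rewrite addSn -addnS => ge; split=> //; exact: sub gc.
have [ms0 E0] := IH (wb false) l.+1; have [ms1 E1] := IH (wb true) l.+1.
rewrite split_cyl; split; first exact: mm_measurableU.
rewrite mm_add //; last first.
  apply/seteqP; split=> // g [[[_ g0] _] [[_ g1] _]].
  by have := g0 l.+1; rewrite g1 ?ltnSn // /wb eqxx => /(_ isT).
have gcdE b : char_gcd k (wb b) l = char_gcd k w l by apply: (char_gcd_eq (wbE b)).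
have muE b : char_mu k (wb b) l = char_mu k w l by apply: (char_mu_eq (wbE b)).
have muS b : char_mu k (wb b) l.+1 =
    (char_mu k w l + l * (char_gcd k w l - char_gcd k (wb b) l.+1))%N.
  by rewrite char_muS muE gcdE.
have cylS b : chi (arc_cylinder k (wb b) l.+1) = chi (arc_cylinder k w l) * coef_weight b.
  have [_ ->] := @chi_cylinder k (wb b) l.+1 k0; have [_ ->] := @chi_cylinder k w l k0.
  have -> : \prod_(j < l.+1) coef_weight (wb b j.+1) =
      (\prod_(j < l) coef_weight (w j.+1)) * coef_weight b; last by rewrite mulrA.
  rewrite big_ord_recr (eq_bigr (fun j : 'I_l => coef_weight (w j.+1))) => [|j _].
    by rewrite [wb b _]/wb eqxx.
  by rewrite wbE //; exact: ltn_ord j.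
have gcdS b : char_gcd k (wb b) l.+1 =
    if b then gcdn (char_gcd k w l) l.+1 else char_gcd k w l.
  by rewrite /= gcdE /wb eqxx.
rewrite E0 E1 -fpsDE; congr (fcoef _ n).
rewrite !muS !cylS !gcdS subnn muln0 addn0 !rmorphM exprD.
rewrite level_gfS [l.+1.-1]/= -/(coef_weight false) -/(coef_weight true); ring.
Qed.

(** The drop to 1 happens at an exponent beyond m, where it contributes at least m. A prescribed
    finite Milnor number is thus a condition on finitely many coefficients. *)
Lemma char_mu_ge (u : nat -> bool) l m : char_gcd k u l = 1%N -> char_gcd k u m != 1%N ->
  (m <= char_mu k u l)%N.
Proof.
elim: l => [|l IH] ul um.
  have := char_gcd_le u k0 (leq0n m); rewrite ul => le1.
  by have := char_gcd_gt0 u m k0; move: um le1; case: (char_gcd k u m) => [|[]].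
rewrite char_muS.
have [ul1|ul1] := eqVneq (char_gcd k u l) 1%N.
  by rewrite (leq_trans (IH ul1 um)) ?leq_addr.
have ml : (m <= l)%N.
  rewrite leqNgt; apply/negP => lm; have := char_gcd_dvd k u lm; rewrite ul dvdn1.
  by rewrite (negbTE um).
rewrite ul; have := char_gcd_gt0 u l k0; move: ul1.
case: (char_gcd k u l) => [|[|e]] // _ _; rewrite subn1 /= mulnS addnA.
by rewrite (leq_trans ml) // -addnA addnCA leq_addr.
Qed.

Lemma fps_ord_comp_iff (b ta : fps F) m : fps_ord ta 1 -> fps_ord (fps_comp b ta) m <-> fps_ord b m.
Proof.
move=> t1; split=> [bm|bm]; last by have := fps_comp_ord (ltn0Sn 0) bm t1; rewrite muln1.
have b0 : b != 0.
  apply: contraTneq (fps_ord_neq0 bm) => ->.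
  by rewrite [fps_comp _ _](rmorph0 (fps_comp_morph (proj2 t1 0%N isT))) eqxx.
have [m' bm'] := fps_ord_ex b0.
have := fps_comp_ord (ltn0Sn 0) bm' t1; rewrite muln1 => /(fps_ord_uniq bm) mm.
by rewrite mm.
Qed.

(** Composition with tau, which has order 1, preserves orders, so the order of y is the first
    exponent with a nonzero coefficient. *)
Lemma arcs_ord_cylinder m (g : plane_arc F) : (0 < m)%N ->
  arcs_ord k m g <-> arc_cylinder k (fun i => i == m) m g.
Proof.
move=> m0.
have t1 : fps_ord (fps_unif k (arcx g)) 1.
  by split=> [|[] //]; rewrite ?fps_unif1 ?oner_neq0 // fps_unif0.
have yE : fps_ord (arcy g) m <-> fps_ord (fps_expand (fps_unif k (arcx g)) (arcy g)) m.
  have := fps_ord_comp_iff (fps_expand (fps_unif k (arcx g)) (arcy g)) m t1.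
  by rewrite (fps_expandK _ (fps_unif0 _ _) (fps_unif1 _ _)).
split=> [[gx /yE[bm bi]]|[gx gw]]; split=> //.
  move=> i /andP[i0]; rewrite leq_eqVlt => /orP[/eqP ->|im]; first by rewrite eqxx.
  by rewrite ltn_eqF // /arc_coef bi ?eqxx.
apply/yE; split; first by have := gw m; rewrite m0 leqnn eqxx => ->.
move=> [|i] im; first by rewrite /= arcy0.
by have /negbFE/eqP := etrans (gw i.+1 (ltnW im)) (ltn_eqF im).
Qed.

Lemma milnor_level m n : (0 < m)%N ->
  [set g | arcs_ord k m g /\ milnor g = Some n] = cyl_level (fun i => i == m) m n n.
Proof.
move=> m0; apply/seteqP; split=> g.
  move=> [gkm gn]; have gk : fps_ord (arcx g) k by case: gkm.
  split; first exact/arcs_ord_cylinder.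
  have [l gl] : exists l, char_gcd k (nz g) l = 1%N.
    apply: contrapT => nl; have : milnor g = None.
      apply: (milnor_nonprimitive k0 gk) => l; apply/eqP => gl; apply: nl; by exists l.
    by rewrite gn.
  (* Otherwise mu would be at least m + n, which exceeds n. *)
  have gm : char_gcd k (nz g) (m + n) = 1%N.
    apply/eqP; apply: contrapT => /negP/(char_mu_ge gl).
    have := milnor_primitive k0 gk gl; rewrite gn => -[<-].
    by rewrite -{2}[n]add0n leq_add2r leqNgt m0.
  by split=> //; have := milnor_primitive k0 gk gm; rewrite gn => -[].
move=> [gc [gm mun]]; have gkm : arcs_ord k m g by exact/arcs_ord_cylinder.
by split=> //; case: gkm => gk _; rewrite (milnor_primitive k0 gk gm) mun.
Qed.

Lemma char_gcd_delta m : (0 < m)%N -> char_gcd k (fun i => i == m) m = gcdn k m /\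
  char_mu k (fun i => i == m) m = (m.-1 * (k - gcdn k m))%N.
Proof.
case: m => // m _.
have e j : (j <= m)%N -> char_gcd k (fun i => i == m.+1) j = k.
  by elim: j => // j IH jm /=; rewrite ltn_eqF // IH // ltnW.
have em : char_gcd k (fun i => i == m.+1) m.+1 = gcdn k m.+1 by rewrite /= eqxx e.
split=> //; rewrite char_muS em e // [char_mu _ _ _]big1 // => i _.
by rewrite (e i (ltnW (ltn_ord i))) (e i.+1 (ltn_ord i)) subnn muln0.
Qed.

Theorem milnor_integral m : (0 < m)%N ->
  motivic_integrable chi (arcs_ord k m) (@milnor F) /\
  forall n, motivic_integral chi (arcs_ord k m) (@milnor F) n =
    (fpsC ((Lpow F 1 - 1) ^+ 2 * Lpow F (- (k + m)%:Z)) *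
     fps_t _ ^+ (m.-1 * (k - gcdn k m)) * level_gf n (gcdn k m) m.+1) n.
Proof.
move=> m0; have key n := @chi_level n (fun i => i == m) m n.
have [gE mE] := char_gcd_delta m0.
split=> n; first by rewrite (milnor_level n m0); have [] := key n.
rewrite [LHS]/= (milnor_level n m0); have [_ ->] := key n.
suff E : chi (arc_cylinder k (fun i => i == m) m) =
    (Lpow F 1 - 1) ^+ 2 * Lpow F (- (k + m)%:Z) by rewrite gE mE E.
have [_ ->] := @chi_cylinder k (fun i => i == m) m k0.
(* Below m all coefficients vanish and the one at m does not, with total weight L^-(m-1) (1 - L^-1)
   = (L - 1) L^-m. *)
have -> : \prod_(j < m) coef_weight (j.+1 == m) = Lpow F (-1) ^+ m.-1 * (1 - Lpow F (-1)).
  case: m m0 {key gE mE} => // m _; rewrite big_ord_recr eqxx.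
  rewrite (eq_bigr (fun=> Lpow F (-1))) => [|i _]; last by rewrite eqSS (ltn_eqF (ltn_ord i)).
  by rewrite prodr_const card_ord.
have -> : 1 - Lpow F (-1) = (Lpow F 1 - 1) * Lpow F (-1).
  by rewrite mulrBl mul1r -LpowD addrN [Lpow F 0](rmorph1 (@mot F)).
have -> : - (k + m)%N%:Z = - k%:Z + ((-1) * m.-1%:Z + -1) by move: m0; clear; lia.
rewrite LpowD LpowD -LpowXn; move: (Lpow F (-1) ^+ m.-1) (Lpow F (-1)) (Lpow F 1) (Lpow F (- k%:Z)).
by move=> a b c d; ring.
Qed.

End Measure.

Lemma fpsC_coef_eq (S : comPzRingType) (c : S) (f f1 g : fps S) n :
  (f * f1) n = g n -> (fpsC c * f * f1) n = (fpsC c * g) n.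
Proof. by move=> fg; rewrite -mulrA !fpsCM fg. Qed.

Lemma LLE (F : closedFieldType) (z : int) n : z = - n%:Z -> LL F z = fpsC (Lpow F (-1)) ^+ n.
Proof.
move=> ->; rewrite -(rmorphXn (@fpsC _)) LpowXn.
by rewrite mulN1r.
Qed.

Lemma chain_gf_sum (F : closedFieldType) a : (0 < a)%N ->
  let t := fps_t (Mot F) in
  let L := LL F in
  chain_gf (Lpow F (-1)) a =
  \sum_(r < a)
    \sum_(A : {ffun 'I_r.+1 -> 'I_a.+1})
      \sum_(B : {ffun 'I_r -> 'I_a.+1} | admissible A B)
        \prod_(j < r)
          let a0 : nat := A (widen_ord (leqnSn r) j) in
          let a1 : nat := A (lift ord0 j) in
          let b : nat := B j in
          (moebius (b %/ a0))%:~R *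
          ((L 1 - 1) * t ^+ ((a1 - 1) * b) * L (- b%:Z) *
           (1 - t ^+ ((a1 - 1) * (a1 - b)) * L (b%:Z - a1%:Z))) *
          fps_geom (t ^+ (a1 * (a1 - 1)) * L (1 - a1%:Z)) *
          fps_geom (t ^+ ((a1 - 1) * b) * L (- b%:Z)).
Proof.
move=> a0; cbv zeta; pose fac := chain_factor (Lpow F (-1)) (Lpow F 1).
have inv : Lpow F 1 * Lpow F (-1) = 1 by rewrite -LpowD addrN [Lpow F 0](rmorph1 (@mot F)).
have -> := esym (@chain_sumE _ a fac _ (chain_gf1 _) (chain_gf_step inv) (chain_factor_diag _ _) a a _ _).
- apply: eq_bigr => r _; rewrite -[LHS]chain_sum_admissible; apply: eq_bigr => A _.
  apply: eq_bigr => B /and3P[_ _ /forallP AB]; apply: eq_bigr => j _.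
  have := AB j; cbv zeta; move: (A (widen_ord _ _)) (A (lift _ _)) (B j) => x y b.
  move=> /and4P[_ bn _ _].
  (* As b_j < a_j, the three powers of L have exponents at most 0 and are natural powers of L^-1. *)
  have Lby : LL F (b%:Z - y%:Z) = fpsC (Lpow F (-1)) ^+ (y - b).
    by apply: LLE; move: bn; clear; lia.
  have Ly : LL F (1 - y%:Z) = fpsC (Lpow F (-1)) ^+ (y - 1).
    by apply: LLE; move: bn; clear; lia.
  have Lb : LL F (- b%:Z) = fpsC (Lpow F (-1)) ^+ b by apply: LLE.
  by rewrite Lby Ly Lb.
- by rewrite a0 leqnn.
- exact: leqnn.
Qed.

Theorem theorem2 (R : realType) (chi : motivic_measure R[i]) (k m : nat)
    (hk : (1 <= k)%N) (hm : (1 <= m)%N) :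
  let t := fps_t (Mot R[i]) in
  let L := LL R[i] in
  let a := gcdn k m in
  motivic_integrable chi (arcs_ord k m) (@milnor _) /\
  motivic_integral chi (arcs_ord k m) (@milnor _) =
    (L 1 - 1) ^+ 2 * t ^+ ((k - 1) * (m - 1)) * L (- (k + m)%:Z) *
    (* strict increase 1 = a_0 < a_1 < ... < a_r = a forces r < a *)
    \sum_(r < a)
      \sum_(A : {ffun 'I_r.+1 -> 'I_a.+1})
        \sum_(B : {ffun 'I_r -> 'I_a.+1} | admissible A B)
          \prod_(j < r)
            let a0 : nat := A (widen_ord (leqnSn r) j) in
            let a1 : nat := A (lift ord0 j) in
            let b : nat := B j in
            (moebius (b %/ a0))%:~R *
            ((L 1 - 1) * t ^+ ((a1 - 1) * b) * L (- b%:Z) *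
             (1 - t ^+ ((a1 - 1) * (a1 - b)) * L (b%:Z - a1%:Z))) *
            fps_geom (t ^+ (a1 * (a1 - 1)) * L (1 - a1%:Z)) *
            fps_geom (t ^+ ((a1 - 1) * b) * L (- b%:Z)).
Proof.
have a0 : (0 < gcdn k m)%N by rewrite gcdn_gt0 hk.
have E := @chain_gf_sum R[i] _ a0; cbv zeta in E |- *; rewrite -{}E.
have [ms int] := @milnor_integral R[i] chi k hk m hm; split; first exact: ms.
(* The integral is known one coefficient at a time, the coefficient n through the level n. *)
apply: fpsP => n; apply: (etrans (int n)).
apply: (etrans (fpsC_coef_eq _ (level_gf_chain (Lpow R[i] (-1)) n hm hk))).
rewrite !subn1; apply: (congr1 (fun f => fcoef f n)).
have -> : fpsC ((Lpow R[i] 1 - 1) ^+ 2 * Lpow R[i] (- (k + m)%:Z)) =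
    (LL R[i] 1 - 1) ^+ 2 * LL R[i] (- (k + m)%:Z).
  by rewrite (rmorphM (@fpsC _)) (rmorphXn (@fpsC _)) (rmorphB (@fpsC _)) (rmorph1 (@fpsC _)).
move: (chain_gf _ _) (_ ^+ (_ * _)) (LL _ (- _)) (LL _ 1) => c1 c2 c3 c4; ring.
Qed.
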